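(* For all integers $a,b\ge 1$ with $a<b$ and $b\equiv \pm 1 \pmod a$, the number $2-\frac{a}{b}$ is realisable; that is, there exists a graph $F$ with $\mathrm{ex}(n,F)=\Theta\big(n^{2-a/b}\big)$.
   Context: For a graph $F$, the extremal number $\mathrm{ex}(n,F)$ is the maximum number of edges in an $n$-vertex graph containing no subgraph isomorphic to $F$. A real number $r$ is called realisable if there exists a graph $F$ with $\mathrm{ex}(n,F)=\Theta(n^r)$ as $n\to\infty$ (implicit constants depending on $F$). *)

(* Defs.v *)
From HB Require Import structures.
From mathcomp Require Import all_boot.
From Stdlib Require Import Reals.
Set Implicit Arguments. Unset Strict Implicit. Unset Printing Implicit Defensive.

Definition simple_rel (k : nat) (F : 'I_k -> 'I_k -> bool) : Prop :=
  (forall x y, F x y = F y x) /\ (forall x, F x x = false).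

Definition hgraph (n : nat) := {ffun 'I_n * 'I_n -> bool}.

Definition simpleb (n : nat) (G : hgraph n) : bool :=
  [forall x : 'I_n, forall y : 'I_n, (G (x, y) == G (y, x)) && ~~ G (x, x)].

Definition nedges (n : nat) (G : hgraph n) : nat :=
  #|[set p : 'I_n * 'I_n | (val p.1 < val p.2) && G p]|.

Definition containsb (n k : nat) (G : hgraph n) (F : 'I_k -> 'I_k -> bool) : bool :=
  [exists f : {ffun 'I_k -> 'I_n},
     injectiveb f && [forall i, forall j, F i j ==> G (f i, f j)]].

Definition ex (n k : nat) (F : 'I_k -> 'I_k -> bool) : nat :=
  \max_(G : hgraph n | simpleb G && ~~ containsb G F) nedges G.

Definition BigTheta (f : nat -> R) (r : R) : Prop :=
  exists c C : R, (0 < c)%R /\ (0 < C)%R /\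
    exists N : nat, forall n : nat, (N <= n)%coq_nat ->
      (c * Rpower (INR n) r <= f n)%R /\ (f n <= C * Rpower (INR n) r)%R.

Definition realisable (r : R) : Prop :=
  exists (k : nat) (F : 'I_k -> 'I_k -> bool),
    simple_rel F /\ BigTheta (fun n => INR (ex n F)) r.

(* Main.v *)
(** A pattern is a graph whose vertices are split into roots and free vertices;
    gluing [l] copies of it along the roots gives the forbidden graph.

    Lower bound.  Take the vertices in [K^b], [K] the field with [q] elements
    inside an algebraically closed field of characteristic 2, and join two of
    them when [a] random polynomials of large bounded degree vanish on the pair;
    about one pair in [q^a] is an edge.  For fixed roots the copies of the
    pattern form a constructible set, whose size is therefore either bounded by
    a constant (quantifier elimination) or infinite.  If every set of free
    vertices [S] meets at least [(b / a) |S|] edges, a dimension count, carried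
    out with spaces of polynomial functions, shows that infinitely many copies
    occur for so few choices of the polynomials that a dense graph remains.

    Upper bound.  Two patterns start the argument: a path with its two ends as
    roots ([b = a + 1], by growing breadth-first levels) and a star with all
    but one of its edges subdivided, rooted at its leaves ([b = 2 a - 1], by
    counting copies all of whose relevant pairs have small codegree).  Adding
    two new roots, one joined to each colour class of free vertices, replaces
    [b] by [a + b]: some edge [x y] has unusually many edges between the
    neighbourhoods of [x] and [y], and one looks for the old pattern there.
    Iterating reaches every [b] congruent to 1 or -1 modulo [a]. *)

Require Import Defs.
From mathcomp Require Import all_boot all_algebra all_field.
From mathcomp Require Import perm zify.
From Stdlib Require Import Classical.
Set Implicit Arguments. Unset Strict Implicit. Unset Printing Implicit Defensive.
Import GRing.Theory.

(** * Uniform finiteness over algebraically closed fields *)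

Local Open Scope ring_scope.

Section UniformFiniteness.
Variable F : closedFieldType.
Implicit Types (e : seq F) (f : GRing.formula F) (s : seq F).

(** Random algebraic constructions usually count points of varieties over the finite field. Linear
    algebra replaces it: [m] marks can be placed on [q + 1] copies in [(q + 1) ^ m] ways, yet the
    marked parameters still number only [O(q ^ #|ZI|)], so the bad parameters form a fraction
    [O(q ^ -m)]. A large [m] pays for forgetting the roots and for the edge density. The exponent of
    the extension step arises as follows. With minimum degree [D] on [n] vertices, some edge has
    neighbourhoods joined with density about [D / n], whereas sets of size [D] contain the old
    pattern from density about [D ^ (- a / b)] on. The first exceeds the second when [D ^ (a + b)]
    exceeds [n ^ b], and this is the threshold for the pair [a], [a + b]. *)

Lemma closed_field_fresh s : exists y, y \notin s.
Proof.
case: s => [|a s]; first by exists 0.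
have sz : size (\prod_(x <- a :: s) ('X - x%:P) + 1) = (size s).+2.
  by rewrite size_polyDl size_prod_XsubC // size_poly1.
have [y] : exists y, root (\prod_(x <- a :: s) ('X - x%:P) + 1) y.
  by apply/closed_rootP; rewrite sz.
rewrite rootE !hornerE => /eqP y0; exists y; apply/negP => ys.
have : root (\prod_(x <- a :: s) ('X - x%:P)) y by rewrite root_prod_XsubC.
by rewrite rootE => /eqP r0; move: y0; rewrite r0 add0r; apply/eqP/oner_neq0.
Qed.

Lemma closed_field_fresh_seq s n :
  exists ys : seq F, [/\ uniq ys, size ys = n & {in ys, forall y, y \notin s}].
Proof.
elim: n => [|n [ys [uys sys nys]]]; first by exists [::].
have [y] := closed_field_fresh (s ++ ys); rewrite mem_cat negb_or => /andP[ys1 ys2].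
exists (y :: ys); split; rewrite /= ?ys2 ?uys ?sys // => z.
by rewrite inE => /predU1P[->//|/nys].
Qed.

(** Strong minimality of algebraically closed fields in quantitative form. The bound [D] is kept
    apart from the set so that one [D] can serve all values of the parameters. *)
Definition small_or_cosmall (D : nat) (P : F -> Prop) :=
  exists s, (size s <= D)%N /\
    ((forall y, P y -> y \in s) \/ (forall y, ~ P y -> y \in s)).

Lemma soc_weaken D D' P : (D <= D')%N -> small_or_cosmall D P -> small_or_cosmall D' P.
Proof. by move=> le [s [ss H]]; exists s; split=> //; apply: leq_trans le. Qed.

Lemma socN D P : small_or_cosmall D P -> small_or_cosmall D (fun y => ~ P y).
Proof.
move=> [s [ss H]]; exists s; split=> //; case: H => H; [right|left] => // y nP.
by apply: H; apply: NNPP.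
Qed.

Lemma socI D1 D2 P Q : small_or_cosmall D1 P -> small_or_cosmall D2 Q ->
  small_or_cosmall (D1 + D2) (fun y => P y /\ Q y).
Proof.
move=> [s [ss H]] [t [st K]]; exists (s ++ t); split; first by rewrite size_cat leq_add.
case: H => H; first by left=> y [/H ys _]; rewrite mem_cat ys.
case: K => K; first by left=> y [_ /K ys]; rewrite mem_cat ys orbT.
by right=> y /not_and_or[/H|/K] yi; rewrite mem_cat yi ?orbT.
Qed.

Lemma soc_iff D P Q : (forall y, P y <-> Q y) -> small_or_cosmall D P -> small_or_cosmall D Q.
Proof.
move=> PQ [s [ss H]]; exists s; split=> //.
by case: H => H; [left|right] => y; move: (H y) (PQ y); tauto.
Qed.

(** The right-hand side depends on syntax alone, so it bounds the number of roots for all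
    environments at once. *)
Lemma size_eval_poly_le e (p : seq (GRing.term F)) :
  (size (ClosedFieldQE.eval_poly e p) <= size p)%N.
Proof.
elim: p => [|c p IH] /=; first by rewrite size_poly0.
rewrite (leq_trans (size_polyD _ _)) // geq_max (leq_trans (size_polyC_leq1 _)) // andbT.
have [->|nz] := eqVneq (ClosedFieldQE.eval_poly e p) 0; first by rewrite mul0r size_poly0.
by rewrite size_mulX.
Qed.

(** Fixing all variables but [i] turns an equation into a polynomial in one variable, which is
    identically zero or has at most as many roots as its formal length. Boolean combinations add the
    bounds; disjunction and implication are reduced to negation and conjunction. *)
Lemma one_variable_qf f i : GRing.qf_form f -> GRing.rformula f ->
  exists D, forall e, small_or_cosmall D (fun y => GRing.holds (set_nth 0 e i y) f).
Proof.
elim: f => //=.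
- move=> b _ _; exists 0%N => e; exists [::]; split=> //.
  by case: b; [right|left].
- move=> t1 t2 _ /andP[r1 r2].
  pose p := (ClosedFieldQE.abstrX i (GRing.Add t1 (GRing.Opp t2))).
  exists (size p) => e; pose q := ClosedFieldQE.eval_poly e p.
  have qE y : q.[y] = GRing.eval (set_nth 0 e i y) t1 - GRing.eval (set_nth 0 e i y) t2.
    by rewrite /q /p ClosedFieldQE.abstrXP //= r1 r2.
  have [q0|qn0] := eqVneq q 0.
    exists [::]; split=> //; right=> y; case; apply/eqP.
    by rewrite -subr_eq0 -qE q0 horner0.
  have [s qs] := closed_field_poly_normal q.
  have lc0 : lead_coef q != 0 by rewrite lead_coef_eq0.
  exists s; split.
    apply: leq_trans (size_eval_poly_le e p); rewrite -/q qs size_scale //.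
    by rewrite size_prod_XsubC.
  left=> y /eqP; rewrite -subr_eq0 -qE -rootE qs rootZ //.
  by rewrite root_prod_XsubC.
- move=> f1 IH1 f2 IH2 /andP[q1 q2] /andP[r1 r2].
  have [D1 H1] := IH1 q1 r1; have [D2 H2] := IH2 q2 r2.
  by exists (D1 + D2)%N => e; apply: socI.
- move=> f1 IH1 f2 IH2 /andP[q1 q2] /andP[r1 r2].
  have [D1 H1] := IH1 q1 r1; have [D2 H2] := IH2 q2 r2.
  exists (D1 + D2)%N => e; apply: soc_iff (socN (socI (socN (H1 e)) (socN (H2 e)))).
  by move=> y /=; tauto.
- move=> f1 IH1 f2 IH2 /andP[q1 q2] /andP[r1 r2].
  have [D1 H1] := IH1 q1 r1; have [D2 H2] := IH2 q2 r2.
  exists (D1 + D2)%N => e; apply: soc_iff (socN (socI ((H1 e)) (socN (H2 e)))).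
  by move=> y /=; tauto.
- move=> f1 IH1 q1 r1; have [D1 H1] := IH1 q1 r1.
  by exists D1 => e; apply: socN.
Qed.

Lemma quantifier_free_equiv f :
  exists g, [/\ GRing.qf_form g, GRing.rformula g &
              forall e, GRing.holds e g <-> GRing.holds e f].
Proof.
have wf := @ClosedFieldQE.wf_ex_elim F.
have ok := @ClosedFieldQE.holds_ex_elim F (@solve_monicpoly F).
pose g := GRing.quantifier_elim (@ClosedFieldQE.ex_elim F) (GRing.to_rform f).
have /andP[g1 g2] := GRing.quantifier_elim_wf wf (GRing.to_rform_rformula f).
exists g; split=> // e.
rewrite -(GRing.to_rformP e f).
have P1 := GRing.quantifier_elim_rformP wf ok e (GRing.to_rform_rformula f).
have P2 := GRing.qf_evalP e g1.
by split=> [/P2 /P1|/P1 /P2].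
Qed.

Lemma one_variable f i :
  exists D, forall e, small_or_cosmall D (fun y => GRing.holds (set_nth 0 e i y) f).
Proof.
have [g [q r H]] := quantifier_free_equiv f.
have [D HD] := one_variable_qf i q r; exists D => e.
by apply: soc_iff (HD e) => y; apply: H.
Qed.

(** Semantic counterparts of terms and formulas: the predicate describing copies is shown definable
    by closure properties instead of being written out as a formula. *)
Definition termable (t : seq F -> F) := exists tm, forall e, GRing.eval e tm = t e.
Definition definable (Q : seq F -> Prop) := exists f, forall e, GRing.holds e f <-> Q e.

Lemma termable_ext t u : t =1 u -> termable t -> termable u.
Proof. by move=> tu [tm H]; exists tm => e; rewrite H tu. Qed.

Lemma termable_var i : termable (fun e => e`_i).
Proof. by exists (GRing.Var F i). Qed.

Lemma termable_const c : termable (fun _ => c).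
Proof. by exists (GRing.Const c). Qed.

Lemma termableD t u : termable t -> termable u -> termable (fun e => t e + u e).
Proof. by move=> [t' Ht] [u' Hu]; exists (GRing.Add t' u') => e /=; rewrite Ht Hu. Qed.

Lemma termableM t u : termable t -> termable u -> termable (fun e => t e * u e).
Proof. by move=> [t' Ht] [u' Hu]; exists (GRing.Mul t' u') => e /=; rewrite Ht Hu. Qed.

Lemma termableX t n : termable t -> termable (fun e => t e ^+ n).
Proof. by move=> [t' Ht]; exists (GRing.Exp t' n) => e /=; rewrite Ht. Qed.

Lemma termable_sum (I : Type) (r : seq I) (t : I -> seq F -> F) :
  (forall i, termable (t i)) -> termable (fun e => \sum_(i <- r) t i e).
Proof.
move=> H; elim: r => [|i r IH].
  by apply: termable_ext (termable_const 0) => e; rewrite big_nil.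
by apply: termable_ext (termableD (H i) IH) => e; rewrite big_cons.
Qed.

Lemma termable_prod (I : Type) (r : seq I) (t : I -> seq F -> F) :
  (forall i, termable (t i)) -> termable (fun e => \prod_(i <- r) t i e).
Proof.
move=> H; elim: r => [|i r IH].
  by apply: termable_ext (termable_const 1) => e; rewrite big_nil.
by apply: termable_ext (termableM (H i) IH) => e; rewrite big_cons.
Qed.

Lemma definable_iff P Q : (forall e, P e <-> Q e) -> definable P -> definable Q.
Proof. by move=> PQ [f H]; exists f => e; move: (H e) (PQ e); tauto. Qed.

Lemma definable_eq t u : termable t -> termable u -> definable (fun e => t e = u e).
Proof. by move=> [t' Ht] [u' Hu]; exists (GRing.Equal t' u') => e /=; rewrite Ht Hu. Qed.

Lemma definable_not P : definable P -> definable (fun e => ~ P e).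
Proof. by move=> [f H]; exists (GRing.Not f) => e /=; move: (H e); tauto. Qed.

Lemma definable_and P Q : definable P -> definable Q -> definable (fun e => P e /\ Q e).
Proof. by move=> [f H] [g K]; exists (GRing.And f g) => e /=; move: (H e) (K e); tauto. Qed.

Lemma definable_imply (b : Prop) P : definable P -> definable (fun e => b -> P e).
Proof.
have [bT|bF] := classic b.
  by apply: definable_iff => e; tauto.
by move=> _; exists (GRing.Bool true) => e; split.
Qed.

Lemma definable_forall_seq (I : eqType) (r : seq I) (P : I -> seq F -> Prop) :
  (forall i, definable (P i)) -> definable (fun e => {in r, forall i, P i e}).
Proof.
move=> H; elim: r => [|i r IH]; first by exists (GRing.Bool true).
apply: definable_iff (definable_and (H i) IH) => e; split.
  by move=> [Pi Pr] j; rewrite inE => /predU1P[->//|/Pr].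
by move=> K; split=> [|j jr]; apply: K; rewrite inE ?eqxx ?jr ?orbT.
Qed.

Lemma definable_forall (I : finType) (P : I -> seq F -> Prop) :
  (forall i, definable (P i)) -> definable (fun e => forall i, P i e).
Proof.
move=> H; apply: definable_iff (definable_forall_seq (enum I) H) => e.
by split=> K i; [apply: K; rewrite mem_enum|move=> _; apply: K].
Qed.

(** * Uniform bounds for the finite fibres of a definable family *)

Section TwoBlocks.
Variables A B : finType.

(** An environment stores the parameters in its first [#|A|] entries and the unknowns in the next
    [#|B|]; entries beyond its length read as 0. *)
Definition env_fst e : {ffun A -> F} := [ffun x => e`_(enum_rank x)].
Definition env_snd e : {ffun B -> F} := [ffun x => e`_(#|A| + enum_rank x)].

Lemma termable_fst x : termable (fun e => env_fst e x).
Proof. by apply: termable_ext (termable_var (enum_rank x)) => e; rewrite ffunE. Qed.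

Lemma termable_snd x : termable (fun e => env_snd e x).
Proof.
by apply: termable_ext (termable_var (#|A| + enum_rank x)) => e; rewrite ffunE.
Qed.

Variable P : {ffun A -> F} -> {ffun B -> F} -> Prop.
Hypothesis defP : definable (fun e => P (env_fst e) (env_snd e)).

Lemma coordinate_projection (l : B) :
  exists D, forall z, small_or_cosmall D (fun y => exists2 u, P z u & u l = y).
Proof.
have [f Hf] := defP; pose N := (#|A| + #|B|)%N.
pose I := iota #|A| #|B|.
(* Variable [N] lies just past both blocks, escapes the quantifiers, and holds the value of the
   coordinate. *)
pose g := foldr GRing.Exists
  (GRing.And f (GRing.Equal (GRing.Var F (#|A| + enum_rank l)) (GRing.Var F N))) I.
have [D HD] := one_variable g N; exists D => z.
have Iin i : (i \in I) = (#|A| <= i < N)%N by rewrite mem_iota.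
have rkA (x : A) : (enum_rank x < #|A|)%N by apply: ltn_ord.
have rkB (x : B) : (enum_rank x < #|B|)%N by apply: ltn_ord.
apply: soc_iff (HD (codom z)) => y; rewrite /g -GRing.foldExistsP /=; split.
  move=> [e He [/Hf Pe ly]].
  have zE : env_fst e = z.
    apply/ffunP => x; rewrite ffunE -He; last first.
      by rewrite !inE Iin leqNgt rkA.
    rewrite nth_set_nth /=; case: eqP => [eqN|_]; first by move: (rkA x); rewrite eqN ltnNge leq_addr.
    by rewrite nth_codom enum_rankK.
  exists (env_snd e); first by rewrite -zE.
  rewrite ffunE ly -He ?nth_set_nth /= ?eqxx //.
  by rewrite !inE Iin ltnn andbF.
move=> [u Pu ul].
exists (set_nth 0 (codom z ++ codom u) N y) => [i|].
  rewrite !inE Iin negb_and -!leqNgt !nth_set_nth /= => iN.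
  case: eqP => // /eqP niN; rewrite nth_cat size_codom.
  case: ltnP => // Ai; rewrite nth_default ?size_codom // nth_default // size_codom.
  by move: iN; rewrite Ai /= /N leq_subRL.
have fstE : env_fst (set_nth 0 (codom z ++ codom u) N y) = z.
  apply/ffunP => x; rewrite ffunE nth_set_nth /= nth_cat size_codom rkA nth_codom enum_rankK.
  by case: eqP => // eqN; move: (rkA x); rewrite eqN ltnNge leq_addr.
have sndE : env_snd (set_nth 0 (codom z ++ codom u) N y) = u.
  apply/ffunP => x; rewrite ffunE nth_set_nth /= nth_cat size_codom ltnNge leq_addr /=.
  rewrite addKn nth_codom enum_rankK /N eqn_add2l.
  by case: eqP => // eqN; move: (rkB x); rewrite eqN ltnn.
split; first by apply/Hf; rewrite fstE sndE.
have := congr1 (fun h : {ffun B -> F} => h l) sndE; rewrite ffunE => ->.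
by rewrite nth_set_nth /= eqxx.
Qed.

(** If one coordinate takes cofinitely many values, prescribing fresh values for it gives
    arbitrarily many points of the fibre. Otherwise each coordinate takes at most [D] values, and a
    point is determined by the positions of its coordinates in these lists. *)
Lemma uniform_finiteness : exists C, forall z,
  (forall n, exists us : seq {ffun B -> F},
      [/\ uniq us, size us = n & {in us, forall u, P z u}]) \/
  (forall us : seq {ffun B -> F}, uniq us -> {in us, forall u, P z u} -> (size us <= C)%N).
Proof.
have [D HD] : exists D, forall l z, small_or_cosmall D (fun y => exists2 u, P z u & u l = y).
  have [D HD] : exists D, {in enum B, forall l z,
      small_or_cosmall D (fun y => exists2 u, P z u & u l = y)}.
    elim: (enum B) => [|l r [D HD]]; first by exists 0%N.
    have [D' HD'] := coordinate_projection l; exists (D + D')%N => k.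
    rewrite inE => /predU1P[->|kr] z; first by apply: soc_weaken (HD' z); rewrite leq_addl.
    by apply: soc_weaken (HD k kr z); rewrite leq_addr.
  by exists D => l z; apply: HD; rewrite mem_enum.
exists (D.+1 ^ #|B|)%N => z.
have [[l Hl]|fin] := classic (exists l, exists s : seq F,
    forall y, ~ (exists2 u, P z u & u l = y) -> y \in s).
  left=> n; have [s Hs] := Hl.
  have [ys [uys <- nys]] := closed_field_fresh_seq s n.
  have [us [usl Pus]] : exists us : seq {ffun B -> F},
      [seq u l | u : {ffun B -> F} <- us] = ys /\ {in us, forall u, P z u}.
    elim: ys nys {uys} => [|y ys IH] nys; first by exists [::].
    have [u us|us [usl Pus]] := IH; first by apply: nys; rewrite inE us orbT.
    have [u Pu ul] : exists2 u, P z u & u l = y.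
      apply: NNPP => /Hs ys0; have := nys y; rewrite inE eqxx ys0; move=> /(_ isT) //.
    by exists (u :: us); rewrite /= ul usl; split=> // v; rewrite inE => /predU1P[->|/Pus].
  exists us; split=> //; last by rewrite -usl size_map.
  by apply: (@map_uniq _ _ (fun u : {ffun B -> F} => u l)); rewrite usl.
right=> us uus Pus.
have Hs l : exists s : seq F, (size s <= D)%N /\ {in us, forall u : {ffun B -> F}, u l \in s}.
  have [s [ss [H|H]]] := HD l z; last by case: fin; exists l, s.
  by exists s; split=> // u uu; apply: H; exists u => //; apply: Pus.
have [S HS] : exists S : B -> seq F, forall l, (size (S l) <= D)%N /\ {in us, forall u : {ffun B -> F}, u l \in S l}.
  have [S HS] : exists S : B -> seq F, {in enum B, forall l, (size (S l) <= D)%N /\ {in us, forall u : {ffun B -> F}, u l \in S l}}.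
    elim: (enum B) => [|l r [S HS]]; first by exists (fun _ => [::]).
    have [s sP] := Hs l; exists (fun k => if k == l then s else S k) => k.
    by rewrite inE; case: eqVneq => [->|_] //= /HS.
  by exists S => l; apply: HS; rewrite mem_enum.
pose h (u : {ffun B -> F}) : {ffun B -> 'I_D.+1} := [ffun l => inord (index (u l) (S l))].
have hinj : {in us &, injective h}.
  move=> u v uu vu huv; apply/ffunP => l.
  have := congr1 (fun w : {ffun B -> 'I_D.+1} => val (w l)) huv; rewrite !ffunE /= !inordK; last 2 first.
  - by rewrite ltnS (leq_trans (index_size _ _)) //; case: (HS l).
  - by rewrite ltnS (leq_trans (index_size _ _)) //; case: (HS l).
  by case: (HS l) => _ H; apply: (index_inj 0); apply: H.
have : uniq [seq h u | u <- us] by rewrite map_inj_in_uniq.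
move=> /card_uniqP; rewrite size_map => <-.
by rewrite (leq_trans (max_card _)) // card_ffun card_ord.
Qed.

End TwoBlocks.
End UniformFiniteness.

Local Close Scope ring_scope.

(** * Polynomial functions and interpolation *)

Lemma size_index_enum (T : finType) : size (index_enum T) = #|T|.
Proof. by rewrite cardT enumT [index_enum _]unlock. Qed.

Local Open Scope ring_scope.

Section PolynomialFunctions.
Variables (F : fieldType) (Y : Type) (S : Y -> Prop) (J : finType) (t : J -> Y -> F).

(** [d] bounds the exponent of each variable separately, so [d.+1 ^ #|J|] monomials span. The
    identity is required on [S] only, which lets relations valid on [S] eliminate variables. *)
Definition poly_in (d : nat) (g : Y -> F) :=
  exists A : {ffun J -> 'I_d.+1} -> F,
    forall y, S y -> g y = \sum_k A k * \prod_j t j y ^+ k j.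

Lemma poly_in_ext d g h : (forall y, S y -> g y = h y) -> poly_in d g -> poly_in d h.
Proof. by move=> gh [A HA]; exists A => y Sy; rewrite -gh // HA. Qed.

Lemma poly_inD d g h : poly_in d g -> poly_in d h -> poly_in d (fun y => g y + h y).
Proof.
move=> [A HA] [B HB]; exists (fun k => A k + B k) => y Sy.
by rewrite HA // HB // -big_split; apply: eq_bigr => k _; rewrite mulrDl.
Qed.

Lemma poly_inZ d c g : poly_in d g -> poly_in d (fun y => c * g y).
Proof.
move=> [A HA]; exists (fun k => c * A k) => y Sy.
by rewrite HA // mulr_sumr; apply: eq_bigr => k _; rewrite mulrA.
Qed.

Lemma poly_in_monomial d (k : J -> nat) : (forall j, (k j <= d)%N) ->
  poly_in d (fun y => \prod_j t j y ^+ k j).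
Proof.
move=> kd; pose k' : {ffun J -> 'I_d.+1} := [ffun j => inord (k j)].
exists (fun l => (l == k')%:R) => y Sy.
rewrite (bigD1 k') //= eqxx mul1r [X in _ + X]big1 ?addr0; last first.
  by move=> l lk; rewrite (negPf lk) mul0r.
by apply: eq_bigr => j _; rewrite ffunE inordK // ltnS.
Qed.

Lemma poly_in0 d : poly_in d (fun _ => 0).
Proof. by exists (fun _ => 0) => y Sy; rewrite big1 // => k _; rewrite mul0r. Qed.

Lemma poly_inC d c : poly_in d (fun _ => c).
Proof.
apply: (@poly_in_ext d (fun y => c * \prod_j t j y ^+ 0)).
  by move=> y _; rewrite big1 ?mulr1.
by apply: poly_inZ; apply: poly_in_monomial.
Qed.

Lemma poly_in_var d j : (0 < d)%N -> poly_in d (t j).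
Proof.
move=> d0; apply: (@poly_in_ext d (fun y => \prod_i t i y ^+ (i == j))).
  move=> y _; rewrite (bigD1 j) //= eqxx expr1 big1 ?mulr1 // => i /negPf->.
  by rewrite expr0.
by apply: poly_in_monomial => i; rewrite (leq_trans (leq_b1 _)).
Qed.

Lemma poly_in_sum d (I : Type) (r : seq I) (P : pred I) (g : I -> Y -> F) :
  (forall i, P i -> poly_in d (g i)) -> poly_in d (fun y => \sum_(i <- r | P i) g i y).
Proof.
move=> H; elim: r => [|i r IH].
  by apply: poly_in_ext (poly_in0 d) => y _; rewrite big_nil.
have [Pi|nPi] := boolP (P i); last first.
  by apply: poly_in_ext IH => y _; rewrite big_cons (negPf nPi).
by apply: poly_in_ext (poly_inD (H _ Pi) IH) => y _; rewrite big_cons Pi.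
Qed.

Lemma poly_in_weaken d d' g : (d <= d')%N -> poly_in d g -> poly_in d' g.
Proof.
move=> le [A HA]; apply: (@poly_in_ext d' (fun y => \sum_k A k * \prod_j t j y ^+ k j)).
  by move=> y Sy; rewrite HA.
apply: poly_in_sum => k _; apply: poly_inZ; apply: poly_in_monomial => j.
by apply: leq_trans le; rewrite -ltnS.
Qed.

Lemma poly_inM d d' g h : poly_in d g -> poly_in d' h -> poly_in (d + d') (fun y => g y * h y).
Proof.
move=> [A HA] [B HB].
apply: (@poly_in_ext _ (fun y => \sum_k \sum_l (A k * B l) * \prod_j t j y ^+ (k j + l j))).
  move=> y Sy; rewrite HA // HB // mulr_suml; apply: eq_bigr => k _.
  rewrite mulr_sumr; apply: eq_bigr => l _.
  rewrite mulrACA -big_split; congr (_ * _); apply: eq_bigr => j _; exact: exprD.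
apply: poly_in_sum => k _; apply: poly_in_sum => l _; apply: poly_inZ.
by apply: poly_in_monomial => j; apply: leq_add; rewrite -ltnS.
Qed.

Lemma poly_in_prod d (I : Type) (r : seq I) (P : pred I) (g : I -> Y -> F) :
  (forall i, P i -> poly_in d (g i)) ->
  poly_in (d * count P r) (fun y => \prod_(i <- r | P i) g i y).
Proof.
move=> H; elim: r => [|i r IH].
  by apply: poly_in_ext (poly_inC _ 1) => y _; rewrite big_nil.
have [Pi|nPi] := boolP (P i); last first.
  by rewrite /= (negPf nPi); apply: poly_in_ext IH => y _; rewrite big_cons (negPf nPi).
rewrite /= Pi mulnDr muln1.
by apply: poly_in_ext (poly_inM (H _ Pi) IH) => y _; rewrite big_cons Pi.
Qed.

Lemma poly_in_exp d g n : poly_in d g -> poly_in (d * n) (fun y => g y ^+ n).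
Proof.
move=> H; have := @poly_in_prod d _ (nseq n tt) xpredT (fun _ => g) (fun _ _ => H).
rewrite count_predT size_nseq; apply: poly_in_ext => y _.
by rewrite big_const_seq count_predT size_nseq iter_mulr_1.
Qed.

End PolynomialFunctions.

(* The functions [g i] have a diagonal value matrix, so they are linearly
   independent in the span of the monomials of degree at most [d]. *)
Lemma separated_points_full (F : fieldType) (Y : Type) (S : Y -> Prop) (J : finType)
    (t : J -> Y -> F) (d n : nat) (y : 'I_n -> Y) (g : 'I_n -> Y -> F) :
  (forall i, S (y i)) -> (forall i, poly_in S t d (g i)) ->
  (forall i j, (g i (y j) == 0) = (i != j)) ->
  row_full (\matrix_(k < #|{ffun J -> 'I_d.+1}|, j < n)
    \prod_l t l (y j) ^+ (enum_val k : {ffun J -> 'I_d.+1}) l).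
Proof.
move=> Sy gP gd.
have [A HA] : exists A : 'I_n -> {ffun J -> 'I_d.+1} -> F,
    forall i z, S z -> g i z = \sum_k A i k * \prod_j t j z ^+ k j.
  suff [A HA] : exists A : 'I_n -> {ffun J -> 'I_d.+1} -> F, {in enum 'I_n,
    forall i z, S z -> g i z = \sum_k A i k * \prod_j t j z ^+ k j}.
    by exists A => i; apply: HA; rewrite mem_enum.
  elim: (enum 'I_n) => [|i r [A HA]]; first by exists (fun _ _ => 0).
  have [B HB] := gP i; exists (fun j => if j == i then B else A j) => j.
  by rewrite inE; case: eqVneq => [->|_] //= /HA.
pose MA := \matrix_(i < n, k < #|{ffun J -> 'I_d.+1}|) A i (enum_val k).
set MB := \matrix_(k, j) _.
have MAB : MA *m MB = diag_mx (\row_i g i (y i)).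
  apply/matrixP => i j; rewrite !mxE.
  have -> : \sum_k MA i k * MB k j = g i (y j).
    rewrite HA // [RHS](reindex (@enum_val {ffun J -> 'I_d.+1} predT)) /=; last exact/onW_bij/enum_val_bij.
    by apply: eq_bigr => k _; rewrite !mxE.
  case: eqVneq => [->|ne]; first by rewrite mulr1n.
  by rewrite mulr0n; apply/eqP; rewrite gd.
have rk : \rank (MA *m MB) = n.
  rewrite MAB; apply: mxrank_unit; rewrite unitmxE det_diag unitfE.
  apply/prodf_neq0 => i _; rewrite mxE; apply: contraT => /negPn.
  by rewrite gd eqxx.
by rewrite /row_full eqn_leq rank_leq_col -{1}rk mxrankM_maxr.
Qed.

(** This stands in for a point count on a variety: with [d = O(q)] it gives [O(q ^ #|J|)] points,
    [#|J|] playing the part of the dimension. *)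
Lemma separated_points_bound (F : fieldType) (Y : Type) (S : Y -> Prop) (J : finType)
    (t : J -> Y -> F) (d n : nat) (y : 'I_n -> Y) (g : 'I_n -> Y -> F) :
  (forall i, S (y i)) -> (forall i, poly_in S t d (g i)) ->
  (forall i j, (g i (y j) == 0) = (i != j)) ->
  (n <= d.+1 ^ #|J|)%N.
Proof.
move=> Sy gP gd; have /eqP <- := separated_points_full Sy gP gd.
by apply: leq_trans (rank_leq_row _) _; rewrite card_ffun card_ord.
Qed.

(** For each [i], a product of coordinate differences vanishes at every other [w j] but not at
    [w i]. Its degree is at most [n - 1] in each variable, so the evaluation matrix of all monomials
    has rank [n], and [n] of its rows form an invertible matrix. *)
Lemma independent_monomials (F : fieldType) (B : finType) (d n : nat)
    (w : 'I_n -> {ffun B -> F}) : injective w -> (n <= d.+1)%N ->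
  exists I : 'I_n -> {ffun B -> 'I_d.+1},
    \det (\matrix_(i, j) \prod_l w i l ^+ I j l) != 0.
Proof.
move=> winj nd.
pose t (l : B) (x : {ffun B -> F}) := x l.
pose S := fun _ : {ffun B -> F} => True.
pose sep i j := odflt (fun _ => 0) (omap (fun l => fun x : {ffun B -> F} => x l - w j l)
  [pick l | w i l != w j l]).
have sepP i j : i != j -> (sep i j (w i) != 0) && (sep i j (w j) == 0).
  move=> ij; rewrite /sep; case: pickP => [l|H] /=; first by rewrite subrr eqxx andbT subr_eq0.
  case/eqP: ij; apply: winj; apply/ffunP => l; apply/eqP.
  by move/(_ l): H => /negbFE.
pose g i (x : {ffun B -> F}) := \prod_(j <- enum 'I_n | j != i) sep i j x.
have gP i : poly_in S t d (g i).
  apply: poly_in_weaken (poly_in_prod (d := 1) _ _); last first.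
    move=> j _; rewrite /sep; case: pickP => [l|_] /=; last exact: poly_inC.
    by move=> _; apply: (@poly_inD _ _ S _ t 1 (t l) (fun=> - w j l)); [apply: poly_in_var|apply: poly_inC].
  have := count_predC (pred1 i) (enum 'I_n).
  rewrite count_uniq_mem ?enum_uniq // mem_enum size_enum_ord /= => cn.
  by rewrite mul1n -ltnS -add1n; apply: leq_trans nd; rewrite -[X in (_ <= X)%N]cn.
have gd i j : (g i (w j) == 0) = (i != j).
  rewrite /g prodf_seq_eq0; apply/hasP/idP => [[k _ /andP[ki]]|ij].
    apply: contraL => /eqP <-.
    by have /andP[] := sepP i k (etrans (congr1 negb (eq_sym i k)) ki).
  by exists j; rewrite ?mem_enum // eq_sym ij; have /andP[] := sepP i j ij.
have full := @separated_points_full _ _ S _ t d n w g (fun=> I) gP gd.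
exists (fun j => enum_val (fullrankfun full j)).
rewrite -det_tr -unitfE -unitmxE.
suff -> : (\matrix_(i, j) \prod_l w i l ^+ (enum_val (fullrankfun full j) : {ffun B -> 'I_d.+1}) l)^T
  = rowsub (fullrankfun full) (\matrix_(k, j) \prod_l w j l ^+ (enum_val k : {ffun B -> 'I_d.+1}) l).
  exact: fullrowsub_unit.
by apply/matrixP => i j; rewrite !mxE.
Qed.

Local Close Scope ring_scope.

(** * Rooted patterns *)

(* A pattern has free vertices [U] and roots [Rt]; [ee] records every undirected
   edge once, starting from a free endpoint, and roots are never adjacent. *)
Section Patterns.
Variables (U Rt : finType) (ee : U -> U + Rt -> bool).

Definition touches (A : {set U}) (p : U * (U + Rt)) :=
  (p.1 \in A) || (if p.2 is inl v then v \in A else false).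

Definition pattern_edges : {set U * (U + Rt)} := [set p | ee p.1 p.2].

Definition balanced (a b : nat) :=
  forall A : {set U}, b * #|A| <= a * #|[set p in pattern_edges | touches A p]|.

Definition listed_once := forall u v, ee u (inl v) -> ~~ ee v (inl u).

(** A random polynomial in two points is not symmetric, so each edge needs an order of its ends;
    [o p] tells whether the free end [p.1] comes first. *)
Definition orient (T : Type) (o : U * (U + Rt) -> bool) (h : U + Rt -> T) p :=
  if o p then (h (inl p.1), h p.2) else (h p.2, h (inl p.1)).

(** Distinct listed pairs with equal images would be two listings of one edge from opposite ends,
    which [listed_once] excludes. *)
Lemma orient_inj (T : eqType) o (h : U + Rt -> T) : listed_once -> injective h ->
  {in pattern_edges &, injective (orient o h)}.
Proof.
move=> once hinj [u v] [u' v']; rewrite !inE /= /orient /= => e e'.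
case: ifP => _; case: ifP => _ [] /hinj E /hinj E'.
- by case: E => <-; rewrite E'.
- by move: e e'; rewrite -E E' => /once /negPf->.
- by move: e e'; rewrite E -E' => /once /negPf->.
- by case: E' => <-; rewrite E.
Qed.

(* [rep] identifies vertices of the [m] copies that occupy the same point. *)
Variables (m : nat) (o : U * (U + Rt) -> bool) (rep : 'I_m * U -> 'I_m * U).

Definition lift_copy (i : 'I_m) (v : U + Rt) : 'I_m * U + Rt :=
  match v with inl u => inl (rep (i, u)) | inr r => inr r end.

Definition union_edges : {set ('I_m * U + Rt) * ('I_m * U + Rt)} :=
  [set orient o (lift_copy ip.1) ip.2 | ip in [set ip : 'I_m * (U * (U + Rt)) | ip.2 \in pattern_edges]].

Lemma card_union_edges : #|union_edges| <= m * #|pattern_edges|.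
Proof.
apply: leq_trans (leq_imset_card _ _) _.
have -> : [set ip : 'I_m * (U * (U + Rt)) | ip.2 \in pattern_edges] = setX [set: 'I_m] pattern_edges.
  by apply/setP => ip; rewrite !inE.
by rewrite cardsX cardsT card_ord.
Qed.

(** Balancedness passes to unions of overlapping copies. When copies are added one at a time, every
    edge touching a vertex new to the union is itself new, so [balanced] applies to the set [A] of
    new vertices. *)
Lemma union_edges_ge a b : listed_once -> balanced a b ->
  (forall i, injective (fun u => rep (i, u))) ->
  b * #|rep @: setT| <= a * #|union_edges|.
Proof.
move=> once bal repinj.
have linj i : injective (lift_copy i).
  by move=> [u|r] [u'|r'] //= []; [move/repinj->|move->].
pose Vs (s : seq 'I_m) := [set rep v | v in [set v : 'I_m * U | v.1 \in s]].
pose Es (s : seq 'I_m) := [set orient o (lift_copy ip.1) ip.2 |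
  ip in [set ip : 'I_m * (U * (U + Rt)) | (ip.1 \in s) && (ip.2 \in pattern_edges)]].
suff H s : b * #|Vs s| <= a * #|Es s|.
  have -> : rep @: setT = Vs (enum 'I_m).
    by apply/setP => x; apply/imsetP/imsetP => [][v _ ->]; exists v; rewrite ?inE ?mem_enum.
  have -> : union_edges = Es (enum 'I_m); last exact: H.
  apply/setP => x; apply/imsetP/imsetP => [][ip]; rewrite inE => ipE ->;
    by exists ip; rewrite ?inE ?mem_enum //; move: ipE; rewrite inE ?mem_enum.
elim: s => [|i s IH].
  by rewrite /Vs (_ : [set v | _] = set0) ?imset0 ?cards0 ?muln0 //; apply/setP => v; rewrite !inE.
pose A := [set u | rep (i, u) \notin Vs s].
have VsS : Vs (i :: s) \subset Vs s :|: [set rep (i, u) | u in A].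
  apply/subsetP => v /imsetP[[j u]]; rewrite inE /= inE => /orP[/eqP->|js] ->; last first.
    by rewrite inE; apply/orP; left; apply/imsetP; exists (j, u); rewrite ?inE.
  rewrite inE; have [//|nin /=] := boolP (rep (i, u) \in Vs s).
  by apply/imsetP; exists u; rewrite ?inE.
have cV : #|Vs (i :: s)| <= #|Vs s| + #|A|.
  apply: leq_trans (subset_leq_card VsS) _; apply: leq_trans (leq_card_setU _ _) _.
  by rewrite leq_add2l leq_imset_card.
pose B := [set p in pattern_edges | touches A p].
pose EB := [set orient o (lift_copy i) p | p in B].
have cB : #|EB| = #|B|.
  apply: card_in_imset => p p'; rewrite !inE => /andP[pe _] /andP[pe' _].
  by apply: orient_inj; rewrite ?inE.
(* Edges of earlier copies end only at roots or at positions in [Vs s]; an edge in [EB] has an end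
   outside these. *)
have disj : Es s :&: EB = set0.
  apply/setP => e; rewrite !inE; apply/negP => /andP[/imsetP[[j p']]].
  rewrite inE /= => /andP[js p'E] -> /imsetP[p]; rewrite inE => /andP[pE tp] eqe.
  have bad u v : u \in A -> lift_copy i (inl u) = lift_copy j v -> False.
    case: v => [v|//] /=; rewrite inE => /negP nin [E]; apply: nin; rewrite E.
    by apply/imsetP; exists (j, v); rewrite ?inE.
  case: p pE tp eqe => [u v] _ tp eqe.
  have E1 := congr1 fst eqe; have E2 := congr1 snd eqe.
  move: E1 E2 tp; rewrite /orient /touches /=.
  case: (o p'); case: (o (u, v)) => /= E1 E2 /orP[uA|];
    try solve [exact: (bad u (inl p'.1) uA (esym E1))|exact: (bad u (inl p'.1) uA (esym E2))
              |exact: (bad u p'.2 uA (esym E1))|exact: (bad u p'.2 uA (esym E2))];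
    case: v {eqe} E1 E2 => // v E1 E2 vA;
    solve [exact: (bad v (inl p'.1) vA (esym E1))|exact: (bad v (inl p'.1) vA (esym E2))
          |exact: (bad v p'.2 vA (esym E1))|exact: (bad v p'.2 vA (esym E2))].
have sub : Es s :|: EB \subset Es (i :: s).
  apply/subsetP => e; rewrite inE => /orP[/imsetP[[j p]]|/imsetP[p]]; rewrite inE /=.
    by move=> /andP[js pE] ->; apply/imsetP; exists (j, p); rewrite // inE /= inE js orbT.
  by move=> /andP[pE _] ->; apply/imsetP; exists (i, p); rewrite // inE /= inE eqxx.
have := subset_leq_card sub; rewrite cardsU disj cards0 subn0 cB => cE.
apply: leq_trans (leq_mul (leqnn b) cV) _.
apply: leq_trans (leq_mul (leqnn a) cE).
by rewrite !mulnDr leq_add //; apply: bal.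
Qed.

End Patterns.

(** * Sparseness of the parameters with many copies *)

Local Open Scope ring_scope.

Lemma poly_in_det (F : fieldType) (Y : Type) (S : Y -> Prop) (J : finType) (t : J -> Y -> F)
    (d n : nat) (M : Y -> 'M[F]_n) :
  (forall i j, poly_in S t d (fun y => M y i j)) ->
  poly_in S t (d * n) (fun y => \det (M y)).
Proof.
move=> H; apply: poly_in_sum => s _; apply: poly_inZ.
have := @poly_in_prod _ _ S _ t d _ (index_enum 'I_n) xpredT (fun i y => M y i (s i)) (fun i _ => H _ _).
by rewrite count_predT size_index_enum card_ord.
Qed.

Lemma poly_in_adj (F : fieldType) (Y : Type) (S : Y -> Prop) (J : finType) (t : J -> Y -> F)
    (d n : nat) (M : Y -> 'M[F]_n) i j :
  (forall i j, poly_in S t d (fun y => M y i j)) ->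
  poly_in S t (d * n) (fun y => (\adj (M y)) i j).
Proof.
move=> H; apply: (@poly_in_ext _ _ _ _ _ _
   (fun y => (-1) ^+ (j + i) * \det (row' j (col' i (M y))))).
  by move=> y _; rewrite mxE.
apply: poly_inZ; apply: (@poly_in_weaken _ _ _ _ _ (d * n.-1)).
  by rewrite leq_mul2l leq_pred orbT.
apply: poly_in_det => k l.
by apply: poly_in_ext (H (lift j k) (lift i l)) => y _; rewrite !mxE.
Qed.

(** * Fractions with a fixed denominator *)

Section PolyRatio.
Variables (F : fieldType) (Y : Type) (S : Y -> Prop) (J : finType) (t : J -> Y -> F).
Variables (D : Y -> F) (dD : nat).
Hypothesis polyD : poly_in S t dD D.

(** Functions that become polynomial after multiplication by [D ^ k], as Cramer's rule produces
    them. The degree is tied to [k], so exponents and degrees add together in products. *)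
Definition poly_ratio (k : nat) (g : Y -> F) := poly_in S t (dD * k) (fun y => D y ^+ k * g y).

Lemma poly_ratioC c : poly_ratio 0 (fun=> c).
Proof. by rewrite /poly_ratio muln0; apply: poly_in_ext (poly_inC S t 0 c) => y _; rewrite mul1r. Qed.

Lemma poly_ratio_weaken k l g : (k <= l)%N -> poly_ratio k g -> poly_ratio l g.
Proof.
move=> /subnKC <- H; rewrite /poly_ratio addnC mulnDr.
apply: poly_in_ext (poly_inM (poly_in_exp (l - k) polyD) H) => y _.
by rewrite mulrA -exprD.
Qed.

Lemma poly_ratioB k g h : poly_ratio k g -> poly_ratio k h -> poly_ratio k (fun y => g y - h y).
Proof.
move=> H K; apply: poly_in_ext (poly_inD H (poly_inZ (-1) K)) => y _.
by rewrite mulN1r mulrBr.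
Qed.

Lemma poly_ratioM k l g h : poly_ratio k g -> poly_ratio l h -> poly_ratio (k + l) (fun y => g y * h y).
Proof.
move=> H K; rewrite /poly_ratio mulnDr; apply: poly_in_ext (poly_inM H K) => y _.
by rewrite exprD mulrACA.
Qed.

Lemma poly_ratio_prod k (I : Type) (r : seq I) (P : pred I) (g : I -> Y -> F) :
  (forall i, P i -> poly_ratio k (g i)) ->
  poly_ratio (k * size r) (fun y => \prod_(i <- r | P i) g i y).
Proof.
move=> H; elim: r => [|i r IH].
  by rewrite muln0; apply: poly_in_ext (poly_ratioC 1) => y _; rewrite big_nil.
rewrite /= mulnS; have [Pi|nPi] := boolP (P i); last first.
  apply: (@poly_in_ext _ _ _ _ _ _ (fun y => D y ^+ (k + k * size r) * \prod_(j <- r | P j) g j y)).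
    by move=> y _; rewrite big_cons (negPf nPi).
  by apply: poly_ratio_weaken IH; rewrite leq_addl.
by apply: poly_in_ext (poly_ratioM (H _ Pi) IH) => y _; rewrite big_cons Pi.
Qed.

Lemma poly_ratioX k g n : poly_ratio k g -> poly_ratio (k * n) (fun y => g y ^+ n).
Proof.
move=> H; have := @poly_ratio_prod k _ (nseq n tt) xpredT (fun _ => g) (fun _ _ => H).
rewrite size_nseq; apply: poly_in_ext => y _; congr (_ * _).
by rewrite big_const_seq count_predT size_nseq iter_mulr_1.
Qed.

End PolyRatio.

(** * Copies of a pattern cut out by polynomial equations *)

Section RandomPolynomialGraph.
Variables (F : fieldType) (a b d : nat) (U Rt : finType) (ee : U -> U + Rt -> bool).
Variable o : U * (U + Rt) -> bool.

Definition Mon := {ffun 'I_b + 'I_b -> 'I_d.+1}.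
Definition pt := {ffun 'I_b -> F}.

Definition jn (x y : pt) : {ffun 'I_b + 'I_b -> F} :=
  [ffun l => match l with inl i => x i | inr i => y i end].
Definition mon (k : Mon) (w : {ffun 'I_b + 'I_b -> F}) := \prod_l w l ^+ k l.
Definition pev (c : Mon -> F) (xy : pt * pt) := \sum_k c k * mon k (jn xy.1 xy.2).

Lemma jn_inj (p q : pt * pt) : jn p.1 p.2 = jn q.1 q.2 -> p = q.
Proof.
move=> E; case: p q E => [x y] [x' y'] /= /ffunP E; congr (_, _); apply/ffunP => i.
  by have := E (inl i); rewrite !ffunE.
by have := E (inr i); rewrite !ffunE.
Qed.

(* [ZI] indexes the parameters: the coefficients of [a] polynomials and the
   coordinates of the roots; [UI] indexes the coordinates of the free vertices. *)
Definition ZI : finType := ('I_a * Mon + Rt * 'I_b)%type.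
Definition UI : finType := (U * 'I_b)%type.

Definition vert (z : {ffun ZI -> F}) (u : {ffun UI -> F}) (v : U + Rt) : pt :=
  [ffun l => match v with inl x => u (x, l) | inr r => z (inr (r, l)) end].

(** The parameters will come from the finite field, but [u] ranges over all of [F]: this makes the
    copies a definable set over the closure. *)
Definition is_copy (z : {ffun ZI -> F}) (u : {ffun UI -> F}) :=
  injective (vert z u) /\
  forall p, p \in pattern_edges ee -> forall i, pev (fun k => z (inl (i, k))) (orient o (vert z u) p) = 0.

End RandomPolynomialGraph.

Local Close Scope ring_scope.

Lemma leq_card_bigcup (I T : finType) (P : pred I) (A : I -> {set T}) :
  #|\bigcup_(i | P i) A i| <= \sum_(i | P i) #|A i|.
Proof.
elim/big_rec2: _ => [|i k X _ le]; first by rewrite cards0.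
by apply: leq_trans (leq_card_setU _ _) _; rewrite leq_add2l.
Qed.

Local Open Scope ring_scope.

(* Mark [m] of [q + 1] copies over each bad parameter.  On a piece where the
   coincidences among the marked vertices are fixed and [edge_mx] is invertible,
   Cramer's rule expresses one coefficient per edge and polynomial through the
   remaining coordinates, of which there are at most [#|ZI|] by balancedness.
   Functions on the piece are then polynomials of degree [O(q)] in that many
   variables, so the piece has [O(q ^ #|ZI|)] elements. *)
Section RichParameters.
Variables (F : fieldType) (a b d m : nat) (U Rt : finType) (ee : U -> U + Rt -> bool).
Variable o : U * (U + Rt) -> bool.
Hypotheses (once : listed_once ee) (bal : balanced ee a b).
Hypothesis d_big : (m * #|pattern_edges ee| <= d.+1)%N.
Variables (q : nat) (kap : 'I_q -> F).
Hypothesis q_gt1 : (1 < q)%N.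
Hypothesis kapP : forall i j, i != j -> (kap i - kap j) ^+ q.-1 = 1.

Notation ZI := (ZI a b d Rt).
Notation UI := (UI b U).
Notation Mon := (Mon b d).

Definition zK (c : {ffun ZI -> 'I_q}) : {ffun ZI -> F} := [ffun i => kap (c i)].

Variables (bad : {set {ffun ZI -> 'I_q}}) (p : {ffun ZI -> 'I_q} -> 'I_q.+1 -> {ffun UI -> F}).
Hypothesis pinj : forall c, c \in bad -> injective (p c).
Hypothesis pcopy : forall c, c \in bad -> forall k, is_copy ee o (zK c) (p c k).

Notation Y := ({ffun ZI -> 'I_q} * {ffun 'I_m -> 'I_q.+1})%type.
Notation VV := ('I_m * U)%type.
Notation AV := ('I_m * U + Rt)%type.
Notation X := (ZI + 'I_m * U * 'I_b)%type.

Definition coord (x : X) (y : Y) : F :=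
  match x with inl i => zK y.1 i | inr vl => p y.1 (y.2 vl.1.1) (vl.1.2, vl.2) end.

Definition apt (y : Y) (v : AV) : pt F b :=
  [ffun l => match v with inl w => coord (inr (w, l)) y
                        | inr r => coord (inl (inr (r, l))) y end].

(** The choice depends only on the occupied point, so coinciding marked vertices are identified even
    when they belong to different copies. *)
Definition rep_of (y : Y) : {ffun VV -> VV} :=
  [ffun v => odflt v [pick w | apt y (inl w) == apt y (inl v)]].

Lemma apt_rep y v : apt y (inl (rep_of y v)) = apt y (inl v).
Proof. by rewrite ffunE; case: pickP => [w /eqP|]. Qed.

Lemma eq_rep y v w : apt y (inl v) = apt y (inl w) -> rep_of y v = rep_of y w.
Proof.
move=> E; rewrite !ffunE E; case: pickP => [//|/(_ w)]; by rewrite eqxx.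
Qed.

Lemma rep_idem y v : rep_of y (rep_of y v) = rep_of y v.
Proof. by apply: eq_rep; rewrite apt_rep. Qed.

Lemma vert_apt (y : Y) i v : vert (zK y.1) (p y.1 (y.2 i)) v =
  apt y (match v with inl u => inl (i, u) | inr r => inr r end).
Proof. by apply/ffunP => l; rewrite !ffunE; case: v. Qed.

Lemma apt_lift (y : Y) i v : apt y (lift_copy (rep_of y) i v) = vert (zK y.1) (p y.1 (y.2 i)) v.
Proof. by rewrite vert_apt; case: v => [u|r] //=; rewrite apt_rep. Qed.

Lemma rep_copy_inj (y : Y) i : y.1 \in bad -> injective (fun u => rep_of y (i, u)).
Proof.
move=> yb u u' E; have [vinj _] := pcopy yb (y.2 i).
have /vinj [] // : vert (zK y.1) (p y.1 (y.2 i)) (inl u) = vert (zK y.1) (p y.1 (y.2 i)) (inl u').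
by rewrite !vert_apt -(apt_rep y (i, u)) -(apt_rep y (i, u')) E.
Qed.

Lemma apt_lift_inj (y : Y) i j v w : y.1 \in bad ->
  apt y (lift_copy (rep_of y) i v) = apt y (lift_copy (rep_of y) j w) ->
  lift_copy (rep_of y) i v = lift_copy (rep_of y) j w.
Proof.
move=> yb; have vinj k := (pcopy yb (y.2 k)).1.
case: v w => [u|r] [u'|r'] /=.
- by move/eq_rep; rewrite !rep_idem => ->.
- rewrite apt_rep; have := vinj i (inl u) (inr r').
  by rewrite !vert_apt => H /H.
- rewrite apt_rep => /esym; have := vinj j (inl u') (inr r).
  by rewrite !vert_apt => H /H.
- have := vinj i (inr r) (inr r'); rewrite !vert_apt => H /H [->] //.
Qed.

Definition wpt (y : Y) (e : AV * AV) := jn (apt y e.1) (apt y e.2).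

(** On each edge of the union every one of the polynomials vanishes. This is the matrix of these
    equations in the coefficients of the selected monomials, [I] selecting one monomial per edge. *)
Definition edge_mx (rep : {ffun VV -> VV}) (I : {ffun AV * AV -> Mon}) (y : Y) :
    'M[F]_#|union_edges ee o rep| :=
  \matrix_(i, j) mon (I (enum_val j)) (wpt y (enum_val i)).

Definition piece rep I : {set Y} :=
  [set y | [&& y.1 \in bad, rep_of y == rep & \det (edge_mx rep I y) != 0]].

Lemma wpt_inj (y : Y) : y.1 \in bad -> {in union_edges ee o (rep_of y) &, injective (wpt y)}.
Proof.
move=> yb _ _ /imsetP[[i e]] _ -> /imsetP[[j f]] _ -> E.
have := @jn_inj F b (apt y _, apt y _) (apt y _, apt y _) E => {E} [[]].
rewrite /orient /=; case: (o e); case: (o f) => /= E1 E2; congr (_, _);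
  first [exact: (@apt_lift_inj _ _ _ (inl e.1) (inl f.1))|exact: (@apt_lift_inj _ _ _ e.2 f.2)
   |exact: (@apt_lift_inj _ _ _ (inl e.1) f.2)|exact: (@apt_lift_inj _ _ _ e.2 (inl f.1))].
Qed.

(** Distinct edges of the union give distinct points [wpt y e], at most [d + 1] in number, so
    [independent_monomials] supplies the selection. *)
Lemma piece_cover (y : Y) : y.1 \in bad -> exists rep I, y \in piece rep I.
Proof.
move=> yb; exists (rep_of y); set E := union_edges ee o (rep_of y).
pose w (i : 'I_#|E|) := wpt y (enum_val i).
have winj : injective w.
  move=> i j ij; apply: enum_val_inj; apply: (wpt_inj yb) => //; exact: enum_valP.
have nd : (#|E| <= d.+1)%N by apply: leq_trans d_big; apply: card_union_edges.
have [I HI] := independent_monomials winj nd.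
exists [ffun e => odflt [ffun=> ord0] (omap I [pick j | enum_val j == e])].
rewrite inE yb eqxx /=; apply: contraNN HI => /eqP <-; apply/eqP; congr (\det _).
apply/matrixP => i j; rewrite !mxE /mon; apply: eq_bigr => l _; congr (_ ^+ _).
rewrite ffunE; case: pickP => [k /eqP /enum_val_inj ->//|/(_ j)]; by rewrite eqxx.
Qed.

(** Degree bound for a Cramer numerator: at most [m * #|pattern_edges ee|] rows with entries of
    degree [d * (b + b)], and a right-hand side made of one coefficient times one monomial. *)
Definition delta := (d * (b + b) * (m * #|pattern_edges ee|) + (1 + d * (b + b)))%N.

(** For the parameter [c] and [k != k0], this vanishes when mark [j] is on copy [k] but not when it
    is on [k0]: some coordinate tells the two copies apart. *)
Definition sep_coord c j k0 k (y : Y) : F :=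
  if [pick x : UI | p c k0 x != p c k x] is Some x
  then coord (inr ((j, x.1), x.2)) y - p c k x else 0.

(** The first product is the indicator of [y.1 = y1.1], because the difference of two distinct field
    elements has [(q - 1)]-th power 1. Given this equality, the second product vanishes exactly when
    some mark differs. The total degree in the coordinates is linear in [q]. *)
Definition sep_fun (y1 y : Y) : F :=
  (\prod_(i <- index_enum ZI) (1 - (coord (inl i) y - coord (inl i) y1) ^+ q.-1)) *
  (\prod_(j <- index_enum 'I_m) \prod_(k <- index_enum 'I_q.+1 | k != y1.2 j)
      sep_coord y1.1 j (y1.2 j) k y).

Lemma sep_funP (y1 y : Y) : y1.1 \in bad -> (sep_fun y1 y == 0) = (y1 != y).
Proof.
move=> y1b; have q0 : q.-1 != 0%N by rewrite -lt0n -ltnS prednK // ltnW.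
have sepE j k k' : k' != k -> (sep_coord y1.1 j k k' (y1.1, [ffun=> k]) != 0) /\
     (forall z : Y, z.1 = y1.1 -> z.2 j = k' -> sep_coord y1.1 j k k' z == 0).
  move=> kk'; rewrite /sep_coord; case: pickP => [x px|H].
    split=> [|z z1 z2]; first by rewrite /coord /= ffunE -surjective_pairing subr_eq0.
    by rewrite /coord /= z1 z2 -surjective_pairing subrr.
  case/eqP: kk'; apply: (pinj y1b); apply/ffunP => x; apply/eqP.
  by rewrite eq_sym; move/(_ x)/negbFE: H.
rewrite /sep_fun mulf_eq0 !prodf_seq_eq0; case: (eqVneq y1 y) => [<-|ne] /=.
  apply/negbTE; rewrite negb_or; apply/andP; split; apply/hasPn => /=.
    by move=> i _; rewrite subrr expr0n (negPf q0) subr0 oner_eq0.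
  move=> j _; rewrite prodf_seq_eq0; apply/hasPn => k _ /=.
  rewrite negb_and; apply/orP; case: (eqVneq k (y1.2 j)) => [_|ne]; [by left|right].
  have [nz _] := sepE j _ _ ne; move: nz; rewrite /sep_coord; case: pickP => // x _.
  by rewrite /coord /= ffunE.
have [E1|ne1] := eqVneq y1.1 y.1.
  have /eqfunP /forallPn [j ne2] : ~ (y1.2 =1 y.2).
    move=> E2; case/eqP: ne; rewrite (surjective_pairing y1) (surjective_pairing y) E1.
    by congr (_, _); apply/ffunP.
  apply/orP; right; apply/hasP; exists j; first exact: mem_index_enum.
  rewrite /= prodf_seq_eq0; apply/hasP; exists (y.2 j); first exact: mem_index_enum.
  by rewrite eq_sym ne2 /=; have [_] := sepE j (y1.2 j) (y.2 j) (etrans (congr1 negb (eq_sym _ _)) ne2); apply.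
have /eqfunP /forallPn [i nei] : ~ (y1.1 =1 y.1) by move=> /ffunP E; case/eqP: ne1.
apply/orP; left; apply/hasP; exists i; first exact: mem_index_enum.
by rewrite /= /zK !ffunE kapP ?subrr // eq_sym.
Qed.

Lemma piece_bound rep I :
  (#|piece rep I| <= (delta * (q.-1 * #|{: ZI}| + q.+1 * m)).+1 ^ #|{: ZI}|)%N.
Proof.
have [->|[y0 y0P]] := set_0Vmem (piece rep I); first by rewrite cards0.
set E := union_edges ee o rep; set n := #|E|; pose S (y : Y) : Prop := y \in piece rep I.
have Sb y : S y -> y.1 \in bad by rewrite /S inE => /and3P[].
have Sr y : S y -> rep_of y = rep by rewrite /S inE => /and3P[_ /eqP].
pose D y := \det (edge_mx rep I y).
have SD y : S y -> D y != 0 by rewrite /S inE => /and3P[].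
have repK v : rep (rep v) = rep v by rewrite -(Sr _ y0P) rep_idem.
have repinj i : injective (fun u => rep (i, u)) by rewrite -(Sr _ y0P); apply: rep_copy_inj; apply: Sb.
have Iinj : {in E &, injective I}.
  move=> e f eE fE ef; apply: contraTeq (SD _ y0P) => ne; rewrite negbK /D -det_tr.
  apply/eqP; apply: (@determinant_alternate _ _ _ (enum_rank_in eE e) (enum_rank_in eE f)).
    by apply: contra ne => /eqP /(congr1 (@enum_val _ _)); rewrite !enum_rankK_in // => ->.
  by move=> j; rewrite !mxE !enum_rankK_in // ef.
pose IE := [set I e | e in E].
have cIE : #|IE| = n by rewrite card_in_imset.
(* Coordinates kept as variables: coefficients of unselected monomials, root coordinates, and the
   coordinates of one representative for each occupied point. *)
pose J : {set X} := [set x | match x with inl (inl ik) => ik.2 \notin IE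
   | inl (inr _) => true | inr vl => rep vl.1 == vl.1 end].
pose V := [set v | rep v == v].
(* Cramer's rule removes [a * n] coefficients, while the representatives add [b * #|V|] coordinates;
   [union_edges_ge] says that the second number is at most the first. *)
have cJ : (#|J| <= #|{: ZI}|)%N.
  have JE : J \subset ((fun ik => inl (inl ik)) @: setX [set: 'I_a] (~: IE)) :|:
      ((fun rl => inl (inr rl)) @: [set: Rt * 'I_b]) :|: ((fun vl => inr vl) @: setX V [set: 'I_b]).
    apply/subsetP => [[[[i k]|rl]|[v l]]]; rewrite !inE /= => H; apply/orP.
    - by left; apply/orP; left; apply/imsetP; exists (i, k); rewrite ?inE.
    - by left; apply/orP; right; apply/imsetP; exists rl; rewrite ?inE.
    - by right; apply/imsetP; exists (v, l); rewrite ?inE // H.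
  apply: leq_trans (subset_leq_card JE) _; apply: leq_trans (leq_card_setU _ _) _.
  apply: (@leq_trans (#|setX [set: 'I_a] (~: IE)| + #|[set: Rt * 'I_b]| + #|setX V [set: 'I_b]|)).
    rewrite leq_add ?leq_imset_card //; apply: leq_trans (leq_card_setU _ _) _.
    by rewrite leq_add ?leq_imset_card.
  rewrite !cardsX !cardsT card_sum !card_prod !card_ord cardsCs setCK cIE.
  have VE : V = rep @: setT.
    apply/setP => v; rewrite inE; apply/eqP/imsetP => [<-|[w _ ->]] //; by exists v.
  have := union_edges_ge o once bal repinj; rewrite -VE -/E -/n => bV.
  have nM : (n <= #|{: Mon}|)%N by rewrite -cIE max_card.
  rewrite addnAC leq_add2r mulnBr -[X in (_ <= X)%N](@subnK (a * n)) ?leq_mul2l ?nM ?orbT //.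
  by rewrite leq_add2l mulnC.
pose t (x : {x | x \in J}) := coord (val x).
have tvar x : x \in J -> poly_in S t 1 (coord x).
  by move=> xJ; apply: (@poly_in_var _ _ S _ t 1 (Sub x xJ)).
have pinr v l : poly_in S t 1 (coord (inr (v, l))).
  apply: (@poly_in_ext _ _ _ _ _ _ (coord (inr (rep v, l)))); last by apply: tvar; rewrite inE /= repK.
  by move=> y /Sr ry; have := apt_rep y v; rewrite ry => /ffunP/(_ l); rewrite !ffunE.
have ppt v l : poly_in S t 1 (fun y => apt y v l).
  case: v => [v|r].
    by apply: poly_in_ext (pinr v l) => y _; rewrite ffunE.
  by apply: (@poly_in_ext _ _ _ _ _ _ (coord (inl (inr (r, l))))); [move=> y _; rewrite ffunE|apply: tvar; rewrite inE].
have pw e l : poly_in S t 1 (fun y => wpt y e l).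
  by case: l => l; apply: poly_in_ext (ppt _ l) => y _; rewrite [RHS]ffunE.
set dm := (d * (b + b))%N.
have pmon (k : Mon) e : poly_in S t dm (fun y => mon k (wpt y e)).
  have := @poly_in_prod _ _ S _ t d _ (index_enum ('I_b + 'I_b)%type) xpredT
     (fun l y => wpt y e l ^+ k l) _.
  rewrite count_predT size_index_enum card_sum card_ord; apply=> l _.
  apply: (poly_in_weaken _ (poly_in_exp (k l) (pw e l))); rewrite mul1n -ltnS; exact: (ltn_ord (k l)).
have pD : poly_in S t (dm * n) D.
  by apply: poly_in_det => i j; apply: poly_in_ext (pmon _ _) => y _; rewrite mxE.
pose h i (e : 'I_n) (y : Y) := \sum_(k | k \notin IE) coord (inl (inl (i, k))) y * mon k (wpt y (enum_val e : AV * AV)).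
have ph i (e : 'I_n) : poly_in S t (1 + dm) (h i e).
  apply: poly_in_sum => k kI; apply: poly_inM (pmon _ _); apply: tvar.
  by rewrite inE.
(* The vanishing of polynomial [i] on the edges, split into selected and unselected coefficients, is
   a linear system for the former; multiplying by the adjugate solves it. *)
have cramer i (j : 'I_n) y : S y ->
    D y * coord (inl (inl (i, I (enum_val j)))) y = - \sum_e (\adj (edge_mx rep I y)) j e * h i e y.
  move=> Sy; pose cv : 'cV[F]_n := \col_l coord (inl (inl (i, I (enum_val l)))) y.
  have Mcv : edge_mx rep I y *m cv = - \col_e h i e y.
    apply/matrixP => e z; rewrite !mxE; apply/eqP; rewrite -addr_eq0; apply/eqP.
    have /imsetP[[k f]] := enum_valP e; rewrite inE /= => fE eE.
    have [_ /(_ f fE i)] := pcopy (Sb _ Sy) (y.2 k).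
    have -> : orient o (vert (zK y.1) (p y.1 (y.2 k))) f = (apt y (enum_val e).1, apt y (enum_val e).2).
      rewrite eE /orient; case: (o f) => /=; rewrite -!apt_lift (Sr _ Sy) //.
    rewrite /pev /= (bigID (mem IE)) /= => H0; rewrite -[RHS]H0; congr (_ + _).
    transitivity (\sum_(j < n) zK y.1 (inl (i, I (enum_val j))) * mon (I (enum_val j)) (wpt y (enum_val e))).
      by apply: eq_bigr => l _; rewrite !mxE mulrC.
    by symmetry; rewrite (big_imset _ Iinj) /= big_enum_val.
  have := congr1 (fun A => (\adj (edge_mx rep I y) *m A) j 0) Mcv.
  rewrite mulmxA mul_adj_mx mul_scalar_mx mulmxN !mxE => ->.
  by congr (- _); apply: eq_bigr => e _; rewrite !mxE.
have nN : (dm * n <= dm * (m * #|pattern_edges ee|))%N.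
  by rewrite leq_mul2l card_union_edges orbT.
have pDd : poly_in S t delta D.
  by apply: poly_in_weaken pD; apply: leq_trans nN _; rewrite leq_addr.
have ratio1 x : poly_in S t 1 (coord x) -> poly_ratio S t D delta 1 (coord x).
  move=> px; rewrite /poly_ratio muln1; apply: poly_in_weaken (poly_inM pD px).
  by apply: leq_add => //; rewrite leq_addr.
have ratio x : poly_ratio S t D delta 1 (coord x).
  case: x => [[[i k]|rl]|[v l]]; [|by apply/ratio1/tvar; rewrite inE|by apply/ratio1].
  have [kI|] := boolP (k \in IE); last by move=> kI; apply/ratio1/tvar; rewrite inE.
  have /imsetP[e eE ->] := kI; rewrite /poly_ratio muln1.
  apply: (@poly_in_ext _ _ _ _ _ _ (fun y => - 1 * \sum_j (\adj (edge_mx rep I y)) (enum_rank_in eE e) j * h i j y)).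
    by move=> y Sy; rewrite mulN1r -cramer // enum_rankK_in.
  apply: poly_inZ; apply: poly_in_sum => j _; apply: poly_in_weaken (poly_inM _ (ph i j)); last first.
    by apply: poly_in_adj => u v; apply: poly_in_ext (pmon (I (enum_val v)) (enum_val u)) => y _; rewrite mxE.
  exact: leq_add.
pose DD := (q.-1 * #|{: ZI}| + q.+1 * m)%N.
have rsep y1 : poly_ratio S t D delta DD (sep_fun y1).
  apply: poly_ratioM.
    rewrite -size_index_enum; apply: poly_ratio_prod => // i _.
    apply: poly_ratioB; first by apply: poly_ratio_weaken (poly_ratioC _ _ _ _ _).
    have := @poly_ratioX F Y S _ t D delta pDd 1 (fun y => coord (inl i) y - coord (inl i) y1) q.-1.
    rewrite mul1n; apply.
    by apply: poly_ratioB => //; apply: poly_ratio_weaken (poly_ratioC _ _ _ _ _).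
  have := @poly_ratio_prod F Y S _ t D delta pDd q.+1 _ (index_enum 'I_m) xpredT
    (fun j y => \prod_(k <- index_enum 'I_q.+1 | k != y1.2 j) sep_coord y1.1 j (y1.2 j) k y).
  rewrite size_index_enum card_ord; apply=> j _.
  have := @poly_ratio_prod F Y S _ t D delta pDd 1 _ (index_enum 'I_q.+1) (fun k => k != y1.2 j)
    (sep_coord y1.1 j (y1.2 j)).
  rewrite size_index_enum card_ord mul1n; apply=> k _.
  rewrite /sep_coord; case: pickP => [x _|_].
    by apply: poly_ratioB => //; apply: poly_ratio_weaken (poly_ratioC _ _ _ _ _).
  by apply: poly_ratio_weaken (poly_ratioC _ _ _ _ _).
(* Multiplication by [D ^ DD] clears the denominators and preserves zeros and nonzeros, as [D] has
   no zero on the piece. *)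
have := @separated_points_bound F Y S _ t (delta * DD) #|piece rep I| enum_val
  (fun i y => D y ^+ DD * sep_fun (enum_val i) y).
move=> /(_ (fun i => enum_valP i)) /(_ (fun i => rsep (enum_val i))) bound.
apply: leq_trans (bound _) _.
  move=> i j; rewrite mulf_eq0 expf_eq0 (negPf (SD _ (enum_valP j))) andbF /=.
  by rewrite sep_funP ?(inj_eq enum_val_inj) //; apply: Sb; apply: enum_valP.
by apply: leq_pexp2l => //; rewrite card_sig.
Qed.

(** Every bad parameter is counted with all its [(q + 1) ^ m] markings, and the number of pieces
    does not depend on [q]. *)
Lemma rich_parameters_count :
  (#|bad| * q.+1 ^ m <= #|{: {ffun VV -> VV} * {ffun AV * AV -> Mon}}| *
     (delta * (q.-1 * #|{: ZI}| + q.+1 * m)).+1 ^ #|{: ZI}|)%N.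
Proof.
have -> : (#|bad| * q.+1 ^ m)%N = #|setX bad [set: {ffun 'I_m -> 'I_q.+1}]|.
  by rewrite cardsX cardsT card_ffun !card_ord.
apply: leq_trans (_ : #|\bigcup_(ri : {ffun VV -> VV} * {ffun AV * AV -> Mon}) piece ri.1 ri.2| <= _)%N.
  apply/subset_leq_card/subsetP => y; rewrite inE => /andP[yb _].
  by have [r [I yP]] := piece_cover yb; apply/bigcupP; exists (r, I).
apply: leq_trans (leq_card_bigcup _ _) _.
rewrite -sum_nat_const; apply: leq_sum => ri _; exact: piece_bound.
Qed.

End RichParameters.

Lemma rich_parameters_bound (F : fieldType) (a b d m : nat) (U Rt : finType)
    (ee : U -> U + Rt -> bool) (o : U * (U + Rt) -> bool) :
  listed_once ee -> balanced ee a b -> (0 < m)%N -> (m * #|pattern_edges ee| <= d.+1)%N ->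
  exists C, forall (q : nat) (kap : 'I_q -> F), (1 < q)%N ->
    (forall i j, i != j -> (kap i - kap j) ^+ q.-1 = 1) ->
    forall bad : {set {ffun ZI a b d Rt -> 'I_q}},
    (forall c, c \in bad -> exists us : seq {ffun UI b U -> F},
       [/\ uniq us, size us = q.+1 & {in us, forall u, is_copy ee o (zK kap c) u}]) ->
    (#|bad| * q ^ m <= C * q ^ #|{: ZI a b d Rt}|)%N.
Proof.
move=> once bal m0 dbig.
set Z := #|{: ZI a b d Rt}|; set N := #|{: {ffun 'I_m * U -> 'I_m * U} *
  {ffun ('I_m * U + Rt) * ('I_m * U + Rt) -> Mon b d}}|.
(* [N] bounds the number of pieces; [Z + 2 * m] and the final 1 come from [q - 1 <= q],
   [q + 1 <= 2 q] and [1 <= q]. *)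
exists (N * (delta b d m ee * (Z + 2 * m) + 1) ^ Z)%N => q kap q1 kapP bad H.
have [p Hp] : exists p : {ffun ZI a b d Rt -> 'I_q} -> 'I_q.+1 -> {ffun UI b U -> F},
    forall c, c \in bad -> injective (p c) /\ (forall k, is_copy ee o (zK kap c) (p c k)).
  apply: (@fin_all_exists _ _ (fun c pc => c \in bad -> injective pc /\
     (forall k, is_copy ee o (zK kap c) (pc k)))) => c.
  have [cb|] := boolP (c \in bad); last by exists (fun _ => [ffun=> 0]).
  have [us [uus sus cus]] := H c cb; exists (fun k => nth [ffun=> 0] us k) => _.
  have lt k : (nat_of_ord (k : 'I_q.+1) < size us)%N by rewrite sus.
  split=> [k l|k]; last by apply: cus; rewrite mem_nth.
  by move/eqP; rewrite nth_uniq // => /eqP/val_inj.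
have := @rich_parameters_count F a b d m U Rt ee o once bal dbig q kap q1 kapP bad p
  (fun c cb => (Hp c cb).1) (fun c cb => (Hp c cb).2).
rewrite -/Z -/N => bound.
apply: leq_trans (leq_mul (leqnn _) _) (leq_trans bound _).
  by rewrite leq_exp2r.
rewrite -mulnA leq_mul2l; apply/orP; right; rewrite -expnMn.
apply: leq_trans (_ : ((delta b d m ee * (Z + 2 * m) + 1) * q) ^ Z <= _)%N => //.
have [->|Z0] := posnP Z; first by rewrite !expn0.
rewrite leq_exp2r // -addn1 [X in (_ <= X)%N]mulnDl mul1n; apply: leq_add; last exact: ltnW.
rewrite -mulnA; apply: leq_mul => //; rewrite mulnDl; apply: leq_add.
  by rewrite mulnC leq_mul2l leq_pred orbT.
rewrite -addn1 mulnDl mul1n -mulnA mul2n -addnn [(m * q)%N]mulnC leq_add2l.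
by rewrite leq_pmull // ltnW.
Qed.

Local Close Scope ring_scope.

(** * The random polynomial graph *)

Local Open Scope ring_scope.

Lemma closed_field_char2 : exists F : closedFieldType, 2%N \in [pchar F].
Proof.
have [K [f _]] := countable_algebraic_closure 'F_2.
exists K; rewrite inE /=; apply/eqP.
by rewrite -(rmorph_nat f) (_ : 2%:R = 0) ?rmorph0 //; apply/val_inj.
Qed.

(** * The finite fields of even order inside the closure *)

Section FiniteSubfield.
Variables (F : closedFieldType) (char2 : 2%N \in [pchar F]) (j : nat).
Let q := (2 ^ j.+1)%N.

Let q_char : [pchar F].-nat q.
Proof. by rewrite pnatX; apply/orP; left; rewrite pnatE. Qed.

(** The field with [q] elements is the set of roots of [X ^ q - X]; they are simple because the
    derivative is [-1] in characteristic 2. *)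
Lemma subfield_enum : exists kap : 'I_q -> F,
  [/\ injective kap, forall i, kap i ^+ q = kap i & forall x, x ^+ q = x -> exists i, kap i = x].
Proof.
have q1 : (1 < q)%N by rewrite /q expnS -{1}[2%N]muln1 leq_mul2l expn_gt0.
pose P : {poly F} := 'X^q - 'X.
have sP : size P = q.+1 by rewrite size_polyDl size_polyXn // size_polyN size_polyX ltnS.
have lP : lead_coef P = 1.
  by rewrite lead_coefDl ?lead_coefXn // size_polyXn size_polyN size_polyX ltnS.
have [s Ps] := closed_field_poly_normal P; rewrite lP scale1r in Ps.
have ss : size s = q by apply/eqP; rewrite -eqSS -sP Ps size_prod_XsubC.
have us : uniq s.
  rewrite -separable_prod_XsubC -Ps separable_poly.unlock derivB derivXn derivX.
  have -> : ('X^(q.-1) : {poly F}) *+ q = 0.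
    rewrite -mulr_natr -polyC_natr (_ : q%:R = 0 :> F) ?mulr0 //.
    by rewrite /q natrX (pcharf0 char2) expr0n.
  by rewrite sub0r -scaleN1r coprimepZr ?oppr_eq0 ?oner_eq0 // coprimep1.
have rs x : (x \in s) = (x ^+ q == x).
  by rewrite -root_prod_XsubC -Ps rootE !hornerE subr_eq0.
exists (fun i : 'I_q => s`_i); split=> [i k|i|x].
- by move/eqP; rewrite nth_uniq ?ss // => /eqP/val_inj.
- by apply/eqP; rewrite -rs mem_nth // ss.
- move/eqP; rewrite -rs => /(nthP 0)[i]; rewrite ss => iq <-.
  by exists (Ordinal iq).
Qed.

Lemma subfield_sub (x y : F) : x ^+ q = x -> y ^+ q = y -> (x - y) ^+ q = x - y.
Proof.
by move=> xq yq; rewrite oppr_pchar2 // exprDn_pchar // xq yq.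
Qed.

Lemma subfield_add (x y : F) : x ^+ q = x -> y ^+ q = y -> (x + y) ^+ q = x + y.
Proof. by move=> xq yq; rewrite exprDn_pchar // xq yq. Qed.

Lemma subfield_mul (x y : F) : x ^+ q = x -> y ^+ q = y -> (x * y) ^+ q = x * y.
Proof. by move=> xq yq; rewrite exprMn xq yq. Qed.

Lemma subfield_unit (x y : F) : x ^+ q = x -> y ^+ q = y -> x != y -> (x - y) ^+ q.-1 = 1.
Proof.
move=> xq yq ne; have nz : x - y != 0 by rewrite subr_eq0.
apply: (mulfI nz); rewrite mulr1 -exprS prednK ?expn_gt0 //.
exact: subfield_sub.
Qed.

End FiniteSubfield.

Section CopiesDefinable.
Variables (F : closedFieldType) (a b d : nat) (U Rt : finType) (ee : U -> U + Rt -> bool).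
Variable o : U * (U + Rt) -> bool.

Lemma definable_is_copy :
  definable (fun e => is_copy ee o (@env_fst F (ZI a b d Rt) e) (@env_snd F (ZI a b d Rt) (UI b U) e)).
Proof.
pose vt e v l := (vert (@env_fst F (ZI a b d Rt) e) (@env_snd F (ZI a b d Rt) (UI b U) e) v : pt F b) l.
have tv v l : termable (fun e => vt e v l).
  case: v => [u|r].
    by apply: termable_ext (@termable_snd F (ZI a b d Rt) (UI b U) (u, l)) => e; rewrite /vt [in RHS]ffunE.
  by apply: termable_ext (@termable_fst F (ZI a b d Rt) (inr (r, l))) => e; rewrite /vt [in RHS]ffunE.
apply: definable_and.
  apply: (@definable_iff _ (fun e => forall v w : U + Rt, v != w -> ~ (forall l, vt e v l = vt e w l))).
    move=> e; split=> [H v w E|vinj v w ne E].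
      by apply/eqP; apply/negPn/negP => /H; apply=> l; rewrite /vt E.
    by case/eqP: ne; apply: vinj; apply/ffunP.
  apply: definable_forall => v; apply: definable_forall => w; apply: definable_imply.
  apply: definable_not; apply: definable_forall => l; exact: definable_eq.
apply: definable_forall => p; apply: definable_imply; apply: definable_forall => i.
apply: definable_eq (termable_const 0); apply: termable_sum => k; apply: termableM.
  exact: termable_fst.
apply: termable_prod => l; apply: termableX.
rewrite /orient; case: (o p); case: l => l /=.
- by apply: termable_ext (tv (inl p.1) l) => e; rewrite [RHS]ffunE.
- by apply: termable_ext (tv p.2 l) => e; rewrite [RHS]ffunE.
- by apply: termable_ext (tv p.2 l) => e; rewrite [RHS]ffunE.
- by apply: termable_ext (tv (inl p.1) l) => e; rewrite [RHS]ffunE.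
Qed.

End CopiesDefinable.

Local Close Scope ring_scope.

(** * The graph glued from copies of a pattern *)

Section Blowup.
Variables (U Rt : finType) (ee : U -> U + Rt -> bool) (l : nat).

Definition blowup_vertex : finType := (Rt + 'I_l * U)%type.

Definition copy_vertex (i : 'I_l) (v : U + Rt) : blowup_vertex :=
  match v with inl u => inr (i, u) | inr r => inl r end.

Definition blowup_adj (x y : blowup_vertex) :=
  [exists i : 'I_l, [exists p in pattern_edges ee,
    ((x, y) == (copy_vertex i (inl p.1), copy_vertex i p.2)) ||
    ((y, x) == (copy_vertex i (inl p.1), copy_vertex i p.2))]].

Definition blowup (x y : 'I_#|blowup_vertex|) := blowup_adj (enum_val x) (enum_val y).

Lemma copy_vertex_inj i : injective (copy_vertex i).
Proof. by move=> [u|r] [u'|r'] //= [->]. Qed.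

Lemma blowup_adjP x y : reflect
  (exists i p, p \in pattern_edges ee /\
     ((x, y) = (copy_vertex i (inl p.1), copy_vertex i p.2) \/
      (y, x) = (copy_vertex i (inl p.1), copy_vertex i p.2))) (blowup_adj x y).
Proof.
apply: (iffP existsP) => [[i /existsP[p /andP[pe /orP[]/eqP H]]]|[i [p [pe H]]]].
- by exists i, p; split=> //; left.
- by exists i, p; split=> //; right.
by exists i; apply/existsP; exists p; rewrite pe; case: H => ->; rewrite eqxx ?orbT.
Qed.

Lemma blowup_simple : listed_once ee -> simple_rel blowup.
Proof.
move=> once; split=> [x y|x]; rewrite /blowup.
  apply/blowup_adjP/blowup_adjP => [][i [p [pe H]]]; exists i, p; split=> //; tauto.
apply/(introF (blowup_adjP _ _)) => -[i [p [pe H]]].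
have : copy_vertex i (inl p.1) = copy_vertex i p.2.
  by case: H => H; exact: etrans (esym (congr1 fst H)) (congr1 snd H).
move=> /copy_vertex_inj E; move: pe; rewrite inE -E => e.
by have := once _ _ e; rewrite e.
Qed.

Lemma containsP n (G : hgraph n) : containsb G blowup ->
  exists f : blowup_vertex -> 'I_n, injective f /\
    forall i p, p \in pattern_edges ee ->
      G (f (copy_vertex i (inl p.1)), f (copy_vertex i p.2)) /\
      G (f (copy_vertex i p.2), f (copy_vertex i (inl p.1))).
Proof.
move=> /existsP[f /andP[/injectiveP finj /forallP H]].
exists (fun x => f (enum_rank x)); split=> [x y /finj /enum_rank_inj //|i p pe].
have H' x y : blowup_adj x y -> G (f (enum_rank x), f (enum_rank y)).
  move=> xy; have := H (enum_rank x) => /forallP /(_ (enum_rank y)).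
  by rewrite /blowup !enum_rankK xy.
by split; apply: H'; apply/blowup_adjP; exists i, p; split=> //; [left|right].
Qed.

Lemma contains_intro n (G : hgraph n) (f : blowup_vertex -> 'I_n) : injective f ->
  (forall x y, G (x, y) = G (y, x)) ->
  (forall i p, p \in pattern_edges ee -> G (f (copy_vertex i (inl p.1)), f (copy_vertex i p.2))) ->
  containsb G blowup.
Proof.
move=> finj sym H; apply/existsP; exists [ffun x => f (enum_val x)]; apply/andP; split.
  by apply/injectiveP => x y; rewrite !ffunE => /finj /enum_val_inj.
apply/forallP => x; apply/forallP => y; apply/implyP => /blowup_adjP[i [p [pe E]]].
rewrite !ffunE; case: E => E.
  rewrite (congr1 fst E : enum_val x = copy_vertex i (inl p.1)).
  by rewrite (congr1 snd E : enum_val y = copy_vertex i p.2); apply: H.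
rewrite (congr1 fst E : enum_val y = copy_vertex i (inl p.1)) sym.
by rewrite (congr1 snd E : enum_val x = copy_vertex i p.2); apply: H.
Qed.

End Blowup.

Section Counting.
Lemma leq_card_fibers (A B : finType) (f : A -> B) (D : {set A}) (E : {set B}) k :
  {in D, forall x, f x \in E} ->
  (forall y, y \in E -> #|[set x in D | f x == y]| <= k) -> #|D| <= k * #|E|.
Proof.
move=> fE fk; rewrite -sum1_card (partition_big f (mem E)) //=.
rewrite mulnC -sum_nat_const; apply: leq_sum => y yE.
apply: leq_trans (fk y yE); rewrite -sum1_card.
by under [X in _ <= X]eq_bigl => x do rewrite inE.
Qed.

Lemma card_lt_pairs n : 1 < n -> n ^ 2 <= 4 * #|[set p : 'I_n * 'I_n | p.1 < p.2]|.
Proof.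
move=> n1; set A := [set p | _].
pose B := [set p : 'I_n * 'I_n | p.2 < p.1]; pose C := [set p : 'I_n * 'I_n | p.1 == p.2].
have cB : #|B| <= #|A|.
  have -> : B = (fun p => (p.2, p.1)) @: A.
    apply/setP => [[x y]]; apply/idP/imsetP => [|[[u v]]]; rewrite inE /=.
      by move=> yx; exists (y, x); rewrite ?inE.
    by move=> uv [-> ->]; rewrite inE.
  exact: leq_imset_card.
have cC : #|C| <= n.
  have -> : C = (fun x => (x, x)) @: [set: 'I_n].
    apply/setP => [[x y]]; apply/idP/imsetP => [|[u _ [-> ->]]]; rewrite inE /= ?eqxx //.
    by move=> /eqP-> ; exists y; rewrite ?inE.
  by apply: leq_trans (leq_imset_card _ _) _; rewrite cardsT card_ord.
have : #|[set: 'I_n * 'I_n]| <= #|A| + #|B| + #|C|.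
  have -> : [set: 'I_n * 'I_n] = A :|: B :|: C.
    by apply/setP => p; rewrite !inE -val_eqE /=; case: ltngtP.
  apply: leq_trans (leq_card_setU _ _) _; rewrite leq_add2r; exact: leq_card_setU.
rewrite cardsT card_prod card_ord; nia.
Qed.

Lemma pigeonhole (A B : finType) (f : A -> B) k : k * #|B| < #|A| ->
  exists y, k < #|[set x | f x == y]|.
Proof.
move=> H; apply: NNPP => nex; move: H; rewrite ltnNge => /negP; apply.
rewrite -!cardsT; apply: (@leq_card_fibers _ _ f) => // y _.
rewrite leqNgt; apply/negP => lt; apply: nex; exists y.
by apply: leq_trans lt _; apply/subset_leq_card/subsetP => x; rewrite !inE.
Qed.
End Counting.

Local Open Scope ring_scope.

(** * Edge density of the polynomial graphs *)

Section PolynomialGraphs.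
Variables (F : closedFieldType) (char2 : 2%N \in [pchar F]) (a b d j : nat).
Let q := (2 ^ j.+1)%N.
Variable kap : 'I_q -> F.
Hypotheses (kap_inj : injective kap) (kap_fix : forall i, kap i ^+ q = kap i).
Hypothesis kap_surj : forall x, x ^+ q = x -> exists i, kap i = x.
Notation Mon := (Mon b d).
Notation n := (q ^ b)%N.

Fact card_points : n = #|{: {ffun 'I_b -> 'I_q}}|.
Proof. by rewrite card_ffun !card_ord. Qed.

Definition point_of (x : 'I_n) : {ffun 'I_b -> 'I_q} := enum_val (cast_ord card_points x).
Definition ptF (x : 'I_n) : pt F b := [ffun l => kap (point_of x l)].

Lemma ptF_inj : injective ptF.
Proof.
move=> x y E; apply: (cast_ord_inj (eq_n := card_points)); apply: enum_val_inj.
apply/ffunP => l; apply: kap_inj.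
by have /ffunP/(_ l) := E; rewrite !ffunE.
Qed.

Definition poly_edge (c : {ffun 'I_a * Mon -> 'I_q}) (x y : 'I_n) :=
  [forall i : 'I_a, pev (fun k => kap (c (i, k))) (ptF x, ptF y) == 0].

(** The polynomials take the smaller vertex first, which yields a symmetric relation without
    symmetric polynomials; the orientations [o] record this order. *)
Definition poly_graph c : hgraph n :=
  [ffun xy : 'I_n * 'I_n => if (xy.1 < xy.2)%N then poly_edge c xy.1 xy.2
              else if (xy.2 < xy.1)%N then poly_edge c xy.2 xy.1 else false].

Lemma poly_graph_simple c : simpleb (poly_graph c).
Proof.
apply/forallP => x; apply/forallP => y; rewrite !ffunE /= ltnn andbT.
by case: ltngtP.
Qed.

Lemma nedges_poly_graph c :
  nedges (poly_graph c) = (\sum_(xy : 'I_n * 'I_n | xy.1 < xy.2) poly_edge c xy.1 xy.2)%N.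
Proof.
rewrite /nedges -sum1_card big_mkcond [RHS]big_mkcond; apply: eq_bigr => xy _.
by rewrite inE ffunE; case: ltnP => //= _; case: poly_edge.
Qed.

Lemma mon_fixed (k : Mon) x y : mon k (jn (ptF x) (ptF y)) ^+ q = mon k (jn (ptF x) (ptF y)).
Proof.
rewrite /mon; elim/big_ind: _ => [|u v Hu Hv|l _]; first by rewrite expr1n.
  exact: subfield_mul.
rewrite exprAC; congr (_ ^+ _); rewrite /jn ffunE.
by case: l => l /=; rewrite /ptF ffunE kap_fix.
Qed.

(** The constant terms can be corrected so that all [a] polynomials vanish at the given pair. The
    correction forgets only the [a] old constant terms, so its fibres have at most [q ^ a]
    elements. *)
Lemma card_poly_edge x y :
  (q ^ (a * #|{: Mon}|) <= q ^ a * #|[set c | poly_edge c x y]|)%N.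
Proof.
have q0 : (0 < q)%N by rewrite expn_gt0.
pose g z := odflt (Ordinal q0) [pick i | kap i == z].
have gK z : z ^+ q = z -> kap (g z) = z.
  move=> /kap_surj[i iz]; rewrite /g; case: pickP => [k /eqP//|/(_ i)].
  by rewrite iz eqxx.
pose k0 : Mon := [ffun=> ord0].
pose w := jn (ptF x) (ptF y).
have mon0 : mon k0 w = 1 by rewrite /mon big1 // => l _; rewrite [k0 l]ffunE expr0.
pose rest (c : {ffun 'I_a * Mon -> 'I_q}) i := \sum_(k | k != k0) kap (c (i, k)) * mon k w.
(* The required constant term lies in the finite field, hence is some [kap i]. *)
have rest_fixed c i : (- rest c i) ^+ q = - rest c i.
  rewrite oppr_pchar2 // /rest; elim/big_ind: _ => [|u v Hu Hv|k _].
  - by rewrite expr0n eqn0Ngt q0.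
  - exact: subfield_add.
  - by apply: subfield_mul; [apply: kap_fix|apply: mon_fixed].
pose fx (c : {ffun 'I_a * Mon -> 'I_q}) : {ffun 'I_a * Mon -> 'I_q} :=
  [ffun ik => if ik.2 == k0 then g (- rest c ik.1) else c ik].
have -> : (q ^ (a * #|{: Mon}|))%N = #|[set: {ffun 'I_a * Mon -> 'I_q}]|.
  by rewrite cardsT [RHS]card_ffun card_prod !card_ord.
apply: (@leq_card_fibers _ _ fx) => [c _|c' _].
  rewrite inE; apply/forallP => i; apply/eqP; rewrite /pev (bigD1 k0) //= -/w mon0 mulr1.
  rewrite ffunE eqxx /= gK ?rest_fixed // (eq_bigr (fun k => kap (c (i, k)) * mon k w)).
    by rewrite -/(rest c i) addNr.
  by move=> k /negPf nk; rewrite ffunE /= nk.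
pose h (c : {ffun 'I_a * Mon -> 'I_q}) : {ffun 'I_a -> 'I_q} := [ffun i => c (i, k0)].
have hinj : {in [set c in setT | fx c == c'] &, injective h}.
  move=> c1 c2; rewrite !inE /= => /eqP E1 /eqP E2 E; apply/ffunP => -[i k].
  have [->|nk] := eqVneq k k0; first by have /ffunP/(_ i) := E; rewrite !ffunE.
  have /ffunP/(_ (i, k)) := etrans E1 (esym E2).
  by rewrite !ffunE /= (negPf nk).
rewrite -(card_in_imset hinj); apply: leq_trans (max_card _) _.
by rewrite card_ffun !card_ord.
Qed.

(* The average number of edges is at least [n ^ 2 / (4 q ^ a)], so discarding a
   fraction [1 / (8 q ^ a)] of the coefficient vectors leaves a dense graph. *)
Lemma good_dense_graph (bad : {set {ffun 'I_a * Mon -> 'I_q}}) : (0 < b)%N ->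
  (8 * q ^ a * #|bad| <= q ^ (a * #|{: Mon}|))%N ->
  exists2 c, c \notin bad & (n ^ 2 <= 8 * q ^ a * nedges (poly_graph c))%N.
Proof.
move=> b0 few; set M := (q ^ (a * #|{: Mon}|))%N in few *.
have cM : #|{: {ffun 'I_a * Mon -> 'I_q}}| = M.
  by rewrite [LHS]card_ffun card_prod !card_ord.
have q1 : (1 < q)%N by rewrite /q expnS -{1}[2%N]muln1 leq_mul2l expn_gt0.
have n1 : (1 < n)%N by apply: leq_trans q1 (leq_pexp2l (ltnW q1) b0).
have M0 : (0 < M)%N by rewrite expn_gt0 (ltnW q1).
pose P := #|[set xy : 'I_n * 'I_n | (xy.1 < xy.2)%N]|.
have sumE : (M * P <= q ^ a * \sum_c nedges (poly_graph c))%N.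
  have -> : (\sum_c nedges (poly_graph c) =
     \sum_(xy : 'I_n * 'I_n | xy.1 < xy.2) #|[set c | poly_edge c xy.1 xy.2]|)%N.
    rewrite (eq_bigr _ (fun c _ => nedges_poly_graph c)) exchange_big /=.
    apply: eq_bigr => xy _; rewrite -sum1_card [RHS]big_mkcond.
    by apply: eq_bigr => c _; rewrite inE; case: poly_edge.
  rewrite big_distrr /= mulnC -sum_nat_const.
  by under eq_bigl => xy do rewrite inE; apply: leq_sum => xy _; apply: card_poly_edge.
apply: NNPP => nex.
have good c : c \notin bad -> (8 * q ^ a * nedges (poly_graph c) < n ^ 2)%N.
  by move=> cb; rewrite ltnNge; apply/negP => le; apply: nex; exists c.
have le_n2 c : (nedges (poly_graph c) <= P)%N.
  apply/subset_leq_card/subsetP => xy; rewrite !inE => /andP[] //.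
have P2 : (P <= n ^ 2)%N.
  by apply: leq_trans (max_card _) _; rewrite card_prod card_ord.
have P4 := card_lt_pairs n1; rewrite -/P in P4.
set S := (\sum_c nedges (poly_graph c))%N in sumE.
have Sgood : (8 * q ^ a * \sum_(c | c \notin bad) nedges (poly_graph c) <= (M - #|bad|) * n ^ 2)%N.
  have -> : (M - #|bad| = #|~: bad|)%N by rewrite [RHS]cardsCs setCK cM.
  rewrite -sum_nat_const big_distrr /=.
  rewrite (eq_bigl (mem (~: bad))) => [|c]; last by rewrite !inE.
  by apply: leq_sum => c cb; apply/ltnW/good; move: cb; rewrite !inE.
have Sbad : (8 * q ^ a * \sum_(c | c \in bad) nedges (poly_graph c) <= M * P)%N.
  apply: leq_trans (leq_mul few (leqnn P)); rewrite -[X in (_ <= X)%N]mulnA leq_mul2l -sum_nat_const.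
  by rewrite leq_sum ?orbT.
(* This is incompatible with [n ^ 2 <= 4 * P], since [M * n ^ 2] is positive. *)
have : (8 * (M * P) <= M * n ^ 2 + M * P)%N.
  apply: leq_trans (leq_mul (leqnn 8) sumE) _; rewrite mulnA /S (bigID (mem bad)) /=.
  rewrite mulnDr addnC; apply: leq_add => //; apply: leq_trans Sgood _.
  by rewrite leq_mul2r leq_subr orbT.
have := leq_mul (leqnn M) P4; have : (0 < M * n ^ 2)%N by rewrite muln_gt0 M0 expn_gt0 ltnW.
rewrite mulnCA; move: (M * n ^ 2)%N (M * P)%N => x y; lia.
Qed.

End PolynomialGraphs.

Local Close Scope ring_scope.

(** A blow-up in the polynomial graph contains, for some orientation [o], more copies on the same
    roots than the uniform finite bound allows. Over the closure these roots then carry infinitely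
    many copies, so the coefficients are bad. *)
Lemma blowup_lower_bound (U Rt : finType) (ee : U -> U + Rt -> bool) (a b : nat) (u0 : U) :
  listed_once ee -> balanced ee a b -> 0 < b ->
  exists l j0, forall j, j0 <= j -> exists G : hgraph ((2 ^ j.+1) ^ b),
    [/\ simpleb G, ~~ containsb G (blowup ee (l := l.+1)) &
        ((2 ^ j.+1) ^ b) ^ 2 <= 8 * (2 ^ j.+1) ^ a * nedges G].
Proof.
move=> once bal b0; have [F char2] := closed_field_char2.
(* In [m], [b * #|Rt|] pays for forgetting the root coordinates, [a] for the edge density, and the
   extra 1 gains a factor [q] that absorbs [8 * C]. *)
pose m := b * #|Rt| + a.+1; pose d := m * #|pattern_edges ee|.
pose O := {ffun U * (U + Rt) -> bool}.
have [C0 HC0] := fin_all_exists (fun o : O => uniform_finiteness (definable_is_copy F a b d ee o)).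
have m0 : 0 < m by rewrite /m addnS.
have dm : m * #|pattern_edges ee| <= d.+1 by rewrite leqnSn.
have [C1 HC1] := fin_all_exists (fun o : O => rich_parameters_bound F o once bal m0 dm).
pose C := \sum_(o : O) C1 o; pose C0s := \sum_(o : O) C0 o.
(* With one copy more than [C0s * #|O|], some orientation occurs more than [C0s] times; [8 * C <= j]
   ensures [8 * C <= q]. *)
exists (C0s * #|O|), (8 * C) => j jC; set q := 2 ^ j.+1.
have [kap [kinj kfix ksurj]] := subfield_enum char2 j.
have q1 : 1 < q by rewrite /q expnS -{1}[2%N]muln1 leq_mul2l expn_gt0.
have q0 := ltnW q1.
have kapP i k : i != k -> ((kap i - kap k) ^+ q.-1 = 1)%R.
  by move=> ik; apply: subfield_unit => //; rewrite (inj_eq kinj).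
pose rich (o : O) c := exists us : seq {ffun UI b U -> F},
  [/\ uniq us, size us = q.+1 & {in us, forall u, is_copy ee o (zK (a := a) (d := d) kap c) u}].
have dec oc : exists t : bool, t <-> rich oc.1 oc.2.
  by have [H|H] := classic (rich oc.1 oc.2); [exists true|exists false].
have [isrich Hrich] := fin_all_exists dec.
pose coefs (c : {ffun ZI a b d Rt -> 'I_q}) : {ffun 'I_a * Mon b d -> 'I_q} := [ffun ik => c (inl ik)].
pose bad := \bigcup_(o : O) (coefs @: [set c | isrich (o, c)]).
have few : 8 * q ^ a * #|bad| <= q ^ (a * #|{: Mon b d}|).
  have H1 : #|bad| * q ^ m <= C * q ^ #|{: ZI a b d Rt}|.
    apply: leq_trans (leq_mul (leq_card_bigcup _ _) (leqnn _)) _.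
    rewrite !big_distrl; apply: leq_sum => o _ /=.
    apply: leq_trans (leq_mul (leq_imset_card _ _) (leqnn _)) _.
    apply: (HC1 o q kap q1 kapP) => c; rewrite inE => /Hrich //.
  have x0 : 0 < q ^ (b * #|Rt|) by rewrite expn_gt0 q0.
  move: H1; rewrite card_sum !card_prod !card_ord /m !expnD [#|Rt| * b]mulnC.
  rewrite mulnCA [X in _ <= X]mulnA [X in _ <= X]mulnC leq_pmul2l // expnS => H1.
  have qC : 8 * C <= q by apply: leq_trans jC (leq_trans (leqnSn j) (ltnW (ltn_expl _ _))).
  rewrite -(leq_pmul2l q0); apply: leq_trans (_ : 8 * (C * q ^ (a * #|{: Mon b d}|)) <= _).
    by apply: leq_trans (leq_mul (leqnn 8) H1); rewrite -[8 * _ * _]mulnA mulnCA leq_mul2l /= [X in _ <= X]mulnC -mulnA.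
  by rewrite mulnA leq_mul2r qC orbT.
have [c cgood dense] := good_dense_graph char2 kfix ksurj b0 few.
exists (poly_graph kap c); split=> //; first exact: poly_graph_simple.
apply/negP => /containsP[f [finj fedge]].
pose R : {ffun ZI a b d Rt -> 'I_q} := [ffun i => match i with inl ik => c ik
   | inr rl => point_of (f (inl rl.1)) rl.2 end].
pose uu i : {ffun UI b U -> F} := [ffun xl => ptF kap (f (inr (i, xl.1))) xl.2].
pose oo i : O := [ffun p => f (copy_vertex i (inl p.1)) < f (copy_vertex i p.2)].
have vertE i v : vert (zK kap R) (uu i) v = ptF kap (f (copy_vertex i v)).
  by apply/ffunP => l; rewrite !ffunE; case: v => [u|r] /=; rewrite !ffunE.
have copyE i : is_copy ee (oo i) (zK kap R) (uu i).
  split=> [v w|p pe k].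
    by rewrite !vertE => /(ptF_inj kinj) /finj /copy_vertex_inj.
  have [G1 G2] := fedge i p pe.
  have ne : f (copy_vertex i (inl p.1)) != f (copy_vertex i p.2).
    rewrite (inj_eq finj) (inj_eq (@copy_vertex_inj _ _ _ i)).
    apply/eqP => E; move: pe; rewrite inE -E => e; by have := once _ _ e; rewrite e.
  have cE : (fun k' => zK kap R (inl (k, k'))) =1 (fun k' => kap (c (k, k'))).
    by move=> k'; rewrite !ffunE.
  rewrite /pev; under eq_bigr => k' _ do rewrite cE.
  move: G1 G2 ne; rewrite /orient !ffunE /= !vertE -val_eqE /=.
  by case: ltngtP => // _ /forallP/(_ k)/eqP E /forallP/(_ k)/eqP E' _.
(* Different copies place the free vertex [u0] at different points, so they stay different as tuples
   of coordinates. *)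
have uuinj : injective uu.
  move=> i k E; have := vertE i (inl u0); rewrite E vertE => /(ptF_inj kinj) /finj.
  by case.
have [o Ho] : exists o : O, C0s < #|[set i | oo i == o]|.
  by apply: pigeonhole; rewrite card_ord.
have [rich1|fin] := HC0 o (zK kap R); last first.
  have := fin [seq uu i | i <- enum [set i | oo i == o]].
  rewrite map_inj_uniq // enum_uniq => /(_ isT) le.
  have {le} : #|[set i | oo i == o]| <= C0 o.
    rewrite cardE -(size_map uu); apply: le => u /mapP[i]; rewrite mem_enum inE => /eqP <- ->.
    exact: copyE.
  apply/negP; rewrite -ltnNge; apply: leq_ltn_trans Ho.
  by rewrite /C0s (bigD1 o) //= leq_addr.
have richR : isrich (o, R) by apply/Hrich; apply: rich1.
case/negP: cgood; apply/bigcupP; exists o => //; apply/imsetP; exists R; first by rewrite inE.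
by apply/ffunP => ik; rewrite !ffunE.
Qed.

(** * Adding isolated vertices *)

Section Padding.
Variables (n n' : nat) (le : n' <= n).

Definition pad (G : hgraph n') : hgraph n :=
  [ffun xy : 'I_n * 'I_n => match insub (val xy.1) : option 'I_n', insub (val xy.2) : option 'I_n' with
     | Some x, Some y => G (x, y) | _, _ => false end].

Lemma pad_simple G : simpleb G -> simpleb (pad G).
Proof.
move=> /forallP H; apply/forallP => x; apply/forallP => y; rewrite !ffunE /=.
case: insubP => [x' _ _|_]; case: insubP => [y' _ _|_] //=.
  by have /forallP/(_ y') := H x'.
by have /forallP/(_ x')/andP[_ ->] := H x'.
Qed.

Lemma pad_nedges G : nedges G <= nedges (pad G).
Proof.
pose w (xy : 'I_n' * 'I_n') := (widen_ord le xy.1, widen_ord le xy.2).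
have winj : injective w.
  move=> [x y] [x' y'] E; congr (_, _); apply: val_inj.
    exact: (congr1 (fun z => val z.1) E).
  exact: (congr1 (fun z => val z.2) E).
rewrite /nedges -(card_imset _ winj); apply/subset_leq_card/subsetP => e /imsetP[[x y] H ->].
by move: H; rewrite !inE /= => /andP[xy Gxy]; rewrite ffunE /= xy !valK.
Qed.

(** Every vertex of the blow-up lies on an edge, so none can be sent to an added isolated vertex. *)
Lemma pad_contains (U Rt : finType) (ee : U -> U + Rt -> bool) l (G : hgraph n') :
  simpleb G -> (forall v, exists2 p, p \in pattern_edges ee & v = inl p.1 \/ v = p.2) ->
  containsb (pad G) (blowup ee (l := l)) -> 0 < l -> containsb G (blowup ee (l := l)).
Proof.
move=> Gs cov /containsP[f [finj fedge]] l0.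
have lt v : val (f v) < n'.
  have [i [w ->]] : exists i w, v = copy_vertex i w.
    by case: v => [r|[i u]]; [exists (Ordinal l0), (inr r)|exists i, (inl u)].
  have [p pe [->|->]] := cov w; have [] := fedge i p pe; rewrite !ffunE /=.
    by case: insubP => // x xlt.
  by case: insubP => // x _ _; case: insubP => // y ylt.
apply: (@contains_intro _ _ _ _ _ _ (fun v => Ordinal (lt v))).
- by move=> x y [/val_inj /finj].
- by move=> x y; move/forallP: Gs => /(_ x)/forallP/(_ y)/andP[/eqP].
move=> i p pe; have [] := fedge i p pe; rewrite ffunE /=.
case: insubP => [x _ xE|//]; case: insubP => [y _ yE|//] Gxy _.
have -> : Ordinal (lt (copy_vertex i (inl p.1))) = x by apply: val_inj; rewrite xE.
by have -> : Ordinal (lt (copy_vertex i p.2)) = y by apply: val_inj; rewrite yE.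
Qed.
End Padding.

(** * Min-degree bounds *)

Lemma cauchy_schwarz_nat (I : finType) (f h : I -> nat) :
  (\sum_i f i * h i) ^ 2 <= (\sum_i f i ^ 2) * (\sum_i h i ^ 2).
Proof.
rewrite -(leq_pmul2l (ltn0Sn 1)).
have -> : 2 * (\sum_i f i * h i) ^ 2 = \sum_i \sum_j 2 * ((f i * h i) * (f j * h j)).
  rewrite -mulnn big_distrl big_distrr; apply: eq_bigr => i _ /=.
  by rewrite big_distrr big_distrr.
have -> : 2 * ((\sum_i f i ^ 2) * (\sum_i h i ^ 2)) =
    \sum_i \sum_j (f i ^ 2 * h j ^ 2 + f j ^ 2 * h i ^ 2).
  under [RHS]eq_bigr => i _ do rewrite big_split /=.
  rewrite [RHS]big_split /= [X in _ = _ + X]exchange_big /= addnn -mul2n; congr (2 * _).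
  by rewrite big_distrl; apply: eq_bigr => i _; rewrite big_distrr.
apply: leq_sum => i _; apply: leq_sum => j _.
have [le _] := nat_Cauchy (f i * h j) (f j * h i).
by rewrite -!expnMn; apply: leq_trans le; rewrite [f j * h j]mulnC mulnACA [f j * h i]mulnC.
Qed.

(** * Four-cycles and densely joined neighbourhoods *)

Section FourCycles.
Variables (V : finType) (r : V -> V -> bool).
Let dl i := \sum_k r i k.
Let dr k := \sum_i r i k.
Let C4 := \sum_i \sum_k r i k * \sum_i' \sum_k' (r i k' * r i' k * r i' k').
Let w1 := \sum_i dl i.
Let w3 := \sum_i \sum_k r i k * (dl i * dr k).

(** [w1], [w3] and [C4] count edges, walks of length 3 and closed walks of length 4. With [n = #|V|]
    and [w2] the sum of squared left degrees, Cauchy-Schwarz gives [w1 ^ 2 <= n w2],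
    [w2 ^ 2 <= n ^ 2 C4] and [w3 ^ 2 <= C4 n w2]. Multiplying the first by the third and then using
    the second yields the square of the claim. *)
Lemma four_cycles_walks : w1 * w3 <= #|V| ^ 2 * C4.
Proof.
pose w2 := \sum_i dl i ^ 2.
pose cl (ij : V * V) := \sum_k r ij.1 k * r ij.2 k.
pose cr (kl : V * V) := \sum_i r i kl.1 * r i kl.2.
have sum_pair (f : V -> V -> nat) : \sum_i \sum_j f i j = \sum_(ij : V * V) f ij.1 ij.2.
  exact: pair_bigA.
have C4l : C4 = \sum_ij cl ij ^ 2.
  rewrite -(sum_pair (fun i j => cl (i, j) ^ 2)) /C4; apply: eq_bigr => i _.
  under eq_bigr => k _ do rewrite big_distrr /=.
  rewrite exchange_big; apply: eq_bigr => i' _ /=.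
  rewrite -mulnn /cl big_distrl /=; apply: eq_bigr => k _.
  rewrite !big_distrr /=; apply: eq_bigr => k' _.
  by case: (r i k); case: (r i k'); case: (r i' k); case: (r i' k').
have C4r : C4 = \sum_kl cr kl ^ 2.
  rewrite -(sum_pair (fun i j => cr (i, j) ^ 2)) /C4 exchange_big /=; apply: eq_bigr => k _.
  under eq_bigr => i _ do [rewrite exchange_big /= big_distrr /=].
  rewrite exchange_big; apply: eq_bigr => k' _ /=.
  rewrite -mulnn /cr big_distrl /=; apply: eq_bigr => i _.
  rewrite !big_distrr /=; apply: eq_bigr => i' _.
  by case: (r i k); case: (r i k'); case: (r i' k); case: (r i' k').
have h1 : w1 ^ 2 <= #|V| * w2.
  have := cauchy_schwarz_nat (fun _ : V => 1) dl.
  by under eq_bigr do rewrite mul1n; rewrite sum1_card.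
have h2 : w2 ^ 2 <= #|V| ^ 2 * C4.
  have -> : w2 = \sum_kl cr kl.
    rewrite -(sum_pair (fun k l => cr (k, l))) /cr /=.
    under [RHS]eq_bigr => k _ do rewrite exchange_big /=.
    rewrite exchange_big /=; apply: eq_bigr => i _; rewrite -mulnn /dl big_distrl /=.
    by apply: eq_bigr => k _; rewrite big_distrr.
  have := cauchy_schwarz_nat (fun _ : V * V => 1) cr.
  by under eq_bigr do rewrite mul1n; rewrite sum1_card card_prod -C4r.
have h3 : w3 ^ 2 <= C4 * (#|V| * w2).
  have -> : w3 = \sum_ij cl ij * dl ij.1.
    rewrite -(sum_pair (fun i j => cl (i, j) * dl i)) /w3 /cl /=; apply: eq_bigr => i _.
    under [RHS]eq_bigr => j _ do rewrite big_distrl /=.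
    rewrite exchange_big /=; apply: eq_bigr => k _.
    by rewrite -big_distrl -big_distrr /= mulnA mulnAC.
  apply: leq_trans (cauchy_schwarz_nat _ _) _; rewrite -C4l leq_mul2l.
  rewrite -(sum_pair (fun i j => dl i ^ 2)) /w2 big_distrr /=; apply/orP; right.
  by apply: leq_sum => i _; rewrite sum_nat_const.
rewrite -(leq_exp2r _ _ (ltn0Sn 1)) !expnMn.
apply: leq_trans (leq_mul h1 h3) _.
have -> : #|V| * w2 * (C4 * (#|V| * w2)) = (#|V| ^ 2 * C4) * w2 ^ 2 by rewrite -!mulnn; nia.
apply: leq_trans (leq_mul (leqnn _) h2) _.
by rewrite mulnn expnMn.
Qed.

(** Both [C4] and [w3] are sums over edges, so the inequality holds between the two terms of some
    edge: its neighbourhoods are joined at least as densely as the whole graph. *)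
Lemma dense_edge : 0 < w1 -> exists i k, r i k /\
  w1 * (dl i * dr k) <= #|V| ^ 2 * \sum_i' \sum_k' (r i k' * r i' k * r i' k').
Proof.
move=> w1_gt0; apply: NNPP => nex.
have lt i k : r i k -> #|V| ^ 2 * (\sum_i' \sum_k' (r i k' * r i' k * r i' k')) < w1 * (dl i * dr k).
  by move=> rik; rewrite ltnNge; apply/negP => le; apply: nex; exists i, k.
have w1w3 : w1 * w3 = \sum_i \sum_k r i k * (w1 * (dl i * dr k)).
  rewrite /w3 big_distrr; apply: eq_bigr => i _ /=; rewrite big_distrr /=.
  by apply: eq_bigr => k _; rewrite mulnCA.
have C4E : #|V| ^ 2 * C4 + w1 = \sum_i \sum_k r i k *
    (#|V| ^ 2 * (\sum_i' \sum_k' (r i k' * r i' k * r i' k')) + 1).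
  rewrite /C4 big_distrr /= /w1 -big_split; apply: eq_bigr => i _ /=.
  by rewrite big_distrr /dl -big_split; apply: eq_bigr => k _ /=; rewrite mulnDr muln1 mulnCA.
have : #|V| ^ 2 * C4 + w1 <= w1 * w3.
  rewrite w1w3 C4E; apply: leq_sum => i _; apply: leq_sum => k _.
  by case rik: (r i k); rewrite ?mul0n // !mul1n addn1 lt.
have := four_cycles_walks; lia.
Qed.

End FourCycles.

Definition bipartite_by (V : finType) (g : V -> V -> bool) (col : V -> bool) :=
  (forall x y, g x y = g y x) /\ (forall x y, g x y -> col x != col y).

Definition nbrs (V : finType) (g : V -> V -> bool) x : {set V} := [set y | g x y].

Definition inner_pairs (V : finType) (g : V -> V -> bool) (X : {set V}) : {set V * V} :=
  [set p | [&& p.1 \in X, p.2 \in X & g p.1 p.2]].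

(** * Subsets of large minimum degree *)

Section MinDegree.
Variables (V : finType) (g : V -> V -> bool).
Hypotheses (gsym : forall x y, g x y = g y x).

(** [S] maximises the number of inner pairs plus [2 * k] for each discarded vertex. Discarding a
    vertex with fewer than [k] neighbours in [S] would be a gain, and by density the empty set is
    worse than [X]. *)
Lemma min_degree_subset (X : {set V}) k : 2 * k * #|X| < #|inner_pairs g X| ->
  exists S : {set V}, [/\ S \subset X, S != set0 &
    forall v, v \in S -> k <= #|nbrs g v :&: S|].
Proof.
move=> dense.
pose pot (S : {set V}) := #|inner_pairs g S| + 2 * k * #|X :\: S|.
have [S SX Smax] : exists2 S : {set V}, S \subset X & forall S' : {set V}, S' \subset X -> pot S' <= pot S.
  have [S SX Smax] := @arg_maxnP _ X (fun S : {set V} => S \subset X) pot (subxx X).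
  by exists S.
exists S; split=> // [|v vS].
  apply/eqP => S0; have := Smax X (subxx X).
  rewrite /pot setDv cards0 muln0 addn0 S0 setD0 (_ : inner_pairs g set0 = set0).
    by rewrite cards0 add0n leqNgt dense.
  by apply/setP => p; rewrite !inE.
rewrite leqNgt; apply/negP => lt.
have := Smax (S :\ v) (subset_trans (subsetDl _ _) SX); rewrite leqNgt => /negP; apply.
have sub : inner_pairs g S \subset inner_pairs g (S :\ v) :|:
    ((fun w => (v, w)) @: (nbrs g v :&: S) :|: (fun w => (w, v)) @: (nbrs g v :&: S)).
  apply/subsetP => -[x y]; rewrite !inE /= => /and3P[xS yS gxy].
  have [xv|xv] := eqVneq x v.
    by apply/orP; right; apply/orP; left; apply/imsetP; exists y; rewrite ?xv // !inE yS -xv gxy.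
  have [yv|yv] := eqVneq y v; last by rewrite xS yS gxy.
  by apply/orP; right; apply/orP; right; apply/imsetP; exists x; rewrite ?yv // !inE xS -yv gsym gxy.
have := subset_leq_card sub => /leq_trans/(_ (leq_card_setU _ _)).
have := leq_card_setU ((fun w => (v, w)) @: (nbrs g v :&: S)) ((fun w => (w, v)) @: (nbrs g v :&: S)).
have := leq_imset_card (fun w => (v, w)) (nbrs g v :&: S).
have := leq_imset_card (fun w => (w, v)) (nbrs g v :&: S).
rewrite /pot; have -> : X :\: (S :\ v) = v |: (X :\: S).
  apply/setP => x; rewrite !inE negb_and negbK; case: eqVneq => [->|] //=.
  by rewrite (subsetP SX).
rewrite cardsU1 !inE vS /= mulnDr muln1.
move=> c1 c2 [c3 _] c4; move: c1 c2 c3 c4 lt.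
set A := #|inner_pairs g S|; set B := #|inner_pairs g (S :\ v)|; set Q := #|_ :&: _|.
set R1 := #|[set (w, v) | w in _]|; set R2 := #|[set (v, w) | w in _]|; set R3 := #|_ :|: _|.
move: A B Q R1 R2 R3 (2 * k * _) => A B Q R1 R2 R3 P; lia.
Qed.
End MinDegree.

Section Blowups.
Variables (U Rt : finType) (ee : U -> U + Rt -> bool) (side : U + Rt -> bool) (l : nat).

Definition blowup_side (x : blowup_vertex U Rt l) :=
  match x with inl r => side (inr r) | inr iu => side (inl iu.2) end.

(** [flip] allows the two colour classes to be exchanged. Colours are tracked because new roots are
    attached to whole classes of free vertices. *)
Definition has_blowup (V : finType) (g : V -> V -> bool) (col : V -> bool) (S : {set V}) :=
  exists (f : blowup_vertex U Rt l -> V) (flip : bool),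
    [/\ injective f, forall x, f x \in S,
        forall i p, p \in pattern_edges ee -> g (f (copy_vertex i (inl p.1))) (f (copy_vertex i p.2))
      & forall x, col (f x) = blowup_side x (+) flip].

Lemma has_blowupS (V : finType) (g : V -> V -> bool) col (S S' : {set V}) : S \subset S' ->
  has_blowup g col S -> has_blowup g col S'.
Proof.
by move=> /subsetP SS' [f [fl [fi fS fe fc]]]; exists f, fl; split=> // x; apply: SS'.
Qed.

End Blowups.

(** The last numerical hypothesis says that [D] exceeds a constant times [n ^ (1 - a / b)]; clearing
    denominators keeps the argument in the natural numbers. *)
Definition min_degree_bound (U Rt : finType) (ee : U -> U + Rt -> bool) side (a b : nat) :=
  forall l, exists C, forall (V : finType) (g : V -> V -> bool) (col : V -> bool) (D : nat),
    bipartite_by g col -> 0 < #|V| -> (forall v, D <= #|nbrs g v|) ->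
    C * #|V| ^ (b - a) < D ^ b -> has_blowup ee side l g col setT.

Lemma min_degree_bound_set (U Rt : finType) (ee : U -> U + Rt -> bool) side a b l :
  a <= b -> 0 < b -> min_degree_bound ee side a b ->
  exists C, forall (V : finType) (g : V -> V -> bool) (col : V -> bool) (X : {set V}),
    bipartite_by g col -> C * #|X| ^ (2 * b - a) < #|inner_pairs g X| ^ b ->
    has_blowup ee side l g col X.
Proof.
move=> ab b0 /(_ l)[C HC]; exists (C.+1 * 8 ^ b) => V g col X [gsym gcol] dense.
set N := #|X| in dense *; set E := #|inner_pairs g X| in dense.
have N0 : 0 < N.
  rewrite lt0n; apply/eqP => /cards0_eq X0; move: dense; rewrite /E X0 (_ : inner_pairs g set0 = set0).
    by rewrite cards0 exp0n.
  by apply/setP => p; rewrite !inE.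
(* A quarter of the average degree, as inner pairs are ordered; rounding down costs at most another
   factor 2, whence [8 ^ b]. *)
pose k := E %/ (4 * N).
have Elt : E < 4 * N * k.+1 by rewrite mulnC ltn_ceil // muln_gt0.
have kE : k * (4 * N) <= E by apply: leq_trunc_div.
have expD : N ^ (2 * b - a) = N ^ b * N ^ (b - a).
  by rewrite -expnD addnBA // mul2n -addnn.
have NX : 0 < N ^ (b - a) by rewrite expn_gt0 N0.
have NB : 0 < N ^ b by rewrite expn_gt0 N0.
have k0 : 0 < k.
  rewrite lt0n; apply/eqP => k0; rewrite k0 muln1 in Elt.
  have h4 : E ^ b <= (4 * N) ^ b by rewrite leq_exp2r // ltnW.
  have h48 : 4 ^ b <= 8 ^ b by rewrite leq_exp2r.
  move: dense; rewrite expD ltnNge => /negP; apply; apply: leq_trans h4 _.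
  rewrite expnMn -[C.+1 * _ * _]mulnA; apply: leq_trans (leq_mul h48 (leq_pmulr _ NX)) _.
  by rewrite leq_pmull.
have E8 : E <= 8 * N * k.
  apply: leq_trans (ltnW Elt) _.
  by rewrite mulnS -[8]/(4 + 4) mulnDl mulnDl leq_add2r leq_pmulr.
have [S [SX S0 Sdeg]] : exists S : {set V}, [/\ S \subset X, S != set0 &
    forall v, v \in S -> k <= #|nbrs g v :&: S|].
  apply: min_degree_subset => //; rewrite -/E -/N.
  have : 0 < E by apply: leq_trans kE; rewrite !muln_gt0 k0 N0.
  by move: kE; rewrite mulnCA; move: (k * N) => *; lia.
have kb : C * #|S| ^ (b - a) < k ^ b.
  have SN : #|S| ^ (b - a) <= N ^ (b - a).
    have [->|ba] := posnP (b - a); first by rewrite !expn0.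
    by rewrite leq_exp2r //; apply: subset_leq_card.
  have : E ^ b <= (8 * N * k) ^ b by rewrite leq_exp2r.
  have : 0 < 8 ^ b by rewrite expn_gt0.
  move: dense SN; rewrite !expnMn expD.
  move: (E ^ b) (N ^ b) (N ^ (b - a)) (8 ^ b) (#|S| ^ (b - a)) (k ^ b) NX NB => e n x t s y *.
  have lt1 : C.+1 * t * (n * x) < t * n * y by lia.
  have : C.+1 * x < y by nia.
  nia.
pose V' := {x : V | x \in S}.
have cV' : #|{: V'}| = #|S| by rewrite card_sig; apply: eq_card => x; rewrite inE.
have [] := HC V' (fun x y => g (val x) (val y)) (fun x => col (val x)) k.
- by split=> [x y|x y /gcol].
- by rewrite cV' card_gt0.
- move=> v; apply: leq_trans (Sdeg _ (valP v)) _.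
  rewrite -(card_imset _ val_inj); apply/subset_leq_card/subsetP => w; rewrite !inE => /andP[gw wS].
  by apply/imsetP; exists (Sub w wS); rewrite ?inE.
- by rewrite cV'.
move=> f [fl [finj _ fe fc]]; exists (fun x => val (f x)), fl; split=> // [x y /val_inj/finj//|x].
by apply: (subsetP SX); apply: (valP (f x)).
Qed.

(** Discarding a smallest value never lowers the average. *)
Lemma heavy_subset (V : finType) (f : V -> nat) (Y : {set V}) m : m <= #|Y| ->
  exists Y' : {set V}, [/\ Y' \subset Y, #|Y'| = m & m * \sum_(y in Y) f y <= #|Y| * \sum_(y in Y') f y].
Proof.
move: {2}(#|Y| - m) (erefl (#|Y| - m)) => k; elim: k Y => [|k IH] Y kE mY.
  have cm : #|Y| = m by apply/eqP; rewrite eqn_leq mY -subn_eq0 kE.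
  by exists Y; rewrite cm.
have Y0 : 0 < #|Y| by rewrite (leq_trans _ (leq_subr m _)) // kE.
have [y0 y0Y] : exists y, y \in Y by apply/set0Pn; rewrite -card_gt0.
have [y] := @arg_minnP _ y0 (mem Y) f y0Y; rewrite /= -/(y \in Y) => yY ymin.
have cY : #|Y| = #|Y :\ y|.+1 by rewrite (cardsD1 y) yY.
have mY1 : m <= #|Y :\ y| by rewrite -ltnS -cY -subn_gt0 kE.
have kE1 : #|Y :\ y| - m = k by move: kE; rewrite cY subSn // => -[].
have [Y' [sub cY' le]] := IH (Y :\ y) kE1 mY1.
exists Y'; split=> //; first exact: subset_trans sub (subsetDl _ _).
have [m0|m0] := posnP m; first by rewrite m0 mul0n.
have c0 : 0 < #|Y :\ y| by apply: leq_trans m0 _; rewrite -cY'; apply: subset_leq_card.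
have fy : #|Y :\ y| * f y <= \sum_(z in Y :\ y) f z.
  by rewrite -sum_nat_const; apply: leq_sum => z; rewrite !inE => /andP[_ /ymin].
rewrite (big_setD1 y) //= cY.
move: (\sum_(z in Y :\ y) f z) (\sum_(z in Y') f z) (f y) (#|Y :\ y|) c0 fy le => s s' x c c0 fy le.
rewrite -(leq_pmul2l c0).
apply: leq_trans (_ : m * (c.+1 * s) <= _).
  by rewrite mulnCA leq_mul2l mulnDr mulSn leq_add2r fy orbT.
by rewrite mulnCA [c * _]mulnCA leq_mul2l le orbT.
Qed.

Definition cross_pairs (V : finType) (g : V -> V -> bool) (X Y : {set V}) : {set V * V} :=
  [set p | [&& p.1 \in X, p.2 \in Y & g p.1 p.2]].

Lemma cross_pairs_sum (V : finType) (g : V -> V -> bool) (X Y : {set V}) :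
  #|cross_pairs g X Y| = \sum_(y in Y) #|[set x in X | g x y]|.
Proof.
rewrite -sum1_card (eq_bigl (fun p : V * V => (p.1 \in X) && ((p.2 \in Y) && g p.1 p.2))).
  rewrite -(pair_big_dep (mem X) (fun x y => (y \in Y) && g x y) (fun _ _ => 1)) /=.
  rewrite (exchange_big_dep (mem Y)) /= => [|x y _ /andP[] //].
  apply: eq_bigr => y yY; rewrite -sum1_card; apply: eq_bigl => x.
  by rewrite !inE yY.
by move=> p; rewrite inE.
Qed.

Lemma cross_pairsC (V : finType) (g : V -> V -> bool) (X Y : {set V}) :
  (forall x y, g x y = g y x) -> #|cross_pairs g X Y| = #|cross_pairs g Y X|.
Proof.
move=> gsym; have swap_inj : injective (fun p : V * V => (p.2, p.1)) by move=> [x y] [x' y'] [-> ->].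
rewrite -(card_imset _ swap_inj); apply: eq_card => -[x y]; apply/imsetP/idP => [[[u v]]|].
  by rewrite inE /= => /and3P[uX vY guv] [-> ->]; rewrite inE /= gsym uX vY guv.
by rewrite inE /= => /and3P[xY yX gxy]; exists (y, x); rewrite // inE /= gsym yX xY.
Qed.

(** In the larger set only as many vertices are kept as the smaller one has, chosen rich in
    neighbours. The density does not drop, and the union has at most [2 * m] vertices, whence the
    factor [2 ^ (2 * b - a)]. *)
Lemma min_degree_bound_cross (U Rt : finType) (ee : U -> U + Rt -> bool) side a b l :
  a <= b -> 0 < b -> min_degree_bound ee side a b ->
  exists C, forall (V : finType) (g : V -> V -> bool) (col : V -> bool) (X Y : {set V}),
    bipartite_by g col ->
    C * (#|X| * #|Y|) ^ b < #|cross_pairs g X Y| ^ b * minn #|X| #|Y| ^ a ->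
    has_blowup ee side l g col (X :|: Y).
Proof.
move=> ab b0 HD; have [C HC] := @min_degree_bound_set _ _ ee side a b l ab b0 HD.
exists (C * 2 ^ (2 * b - a)) => V g col X Y bip.
wlog XY : X Y / #|X| <= #|Y|.
  move=> W; have /orP[le|lt] := leq_total #|X| #|Y|; first exact: W.
  move=> dense; rewrite setUC; apply: W => //.
  by rewrite minnC [#|Y| * _]mulnC cross_pairsC //; case: bip.
rewrite (minn_idPl XY); set m := #|X|; set M := #|Y| => dense.
have [m0|m0] := posnP m.
  have c0 : cross_pairs g X Y = set0 by apply/setP => p; rewrite !inE (cards0_eq m0) inE.
  by move: dense; rewrite c0 cards0 exp0n.
have M0 : 0 < M by apply: leq_trans m0 XY.
have [Y' [sub cY' le]] := heavy_subset (fun y => #|[set x in X | g x y]|) XY.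
rewrite -!cross_pairs_sum -/M -/m in le; set E := #|cross_pairs g X Y| in dense le.
set E' := #|cross_pairs g X Y'| in le.
apply: (@has_blowupS _ _ _ _ _ _ _ _ (X :|: Y')); first by rewrite setUS.
apply: HC => //.
have N2 : #|X :|: Y'| <= 2 * m.
  by apply: leq_trans (leq_card_setU _ _) _; rewrite cY' mul2n -addnn.
have E'E : E' <= #|inner_pairs g (X :|: Y')|.
  apply/subset_leq_card/subsetP => -[x y]; rewrite !inE /= => /and3P[-> -> ->].
  by rewrite orbT.
have ba : 0 < 2 * b - a by lia.
have E'b : E' ^ b <= #|inner_pairs g (X :|: Y')| ^ b by rewrite leq_exp2r.
apply: leq_trans E'b; apply: leq_ltn_trans (_ : C * (2 * m) ^ (2 * b - a) < _).
  by rewrite leq_mul2l leq_exp2r ?N2 ?orbT.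
rewrite expnMn mulnA -(ltn_pmul2l (_ : 0 < M ^ b * m ^ a)); last by rewrite muln_gt0 !expn_gt0 m0 M0.
have -> : M ^ b * m ^ a * (C * 2 ^ (2 * b - a) * m ^ (2 * b - a)) =
    m ^ b * (C * 2 ^ (2 * b - a) * (m * M) ^ b).
  have -> : m ^ (2 * b - a) = m ^ (b - a) * m ^ b by rewrite -expnD; congr (_ ^ _); lia.
  have -> : m ^ b = m ^ a * m ^ (b - a) by rewrite -expnD subnKC.
  rewrite !expnMn; have -> : m ^ b = m ^ a * m ^ (b - a) by rewrite -expnD subnKC.
  move: (m ^ a) (m ^ (b - a)) (M ^ b) (2 ^ _) => *; nia.
apply: leq_trans (_ : m ^ b * (E ^ b * m ^ a) <= _).
  by rewrite ltn_pmul2l // expn_gt0 m0.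
have := le; rewrite -(leq_exp2r _ _ b0) !expnMn => le'.
by rewrite [X in X <= _]mulnA [X in _ <= X]mulnAC leq_mul2r le' orbT.
Qed.

(** * Extending a pattern by new roots *)

Section Extension.
Variables (U Rt : finType) (ee : U -> U + Rt -> bool) (side : U + Rt -> bool).

(* Only the colours that occur, so that no new root is isolated. *)
Definition new_root : finType := {c : bool | [exists u, side (inl u) == c]}.
Definition ext_root : finType := (Rt + new_root)%type.

Definition ext_edge (u : U) (w : U + ext_root) :=
  match w with
  | inl v => ee u (inl v)
  | inr (inl r) => ee u (inr r)
  | inr (inr c) => side (inl u) == val c
  end.

Definition ext_side (w : U + ext_root) :=
  match w with
  | inl v => side (inl v)
  | inr (inl r) => side (inr r)
  | inr (inr c) => ~~ val c
  end.

Definition old_vertex (w : U + Rt) : U + ext_root :=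
  match w with inl v => inl v | inr r => inr (inl r) end.

Fact new_root_proof u : [exists v, side (inl v) == side (inl u)].
Proof. by apply/existsP; exists u. Qed.

Definition root_of u : new_root := exist _ (side (inl u)) (new_root_proof u).

Lemma ext_edge_old u w : ext_edge u (old_vertex w) = ee u w.
Proof. by case: w. Qed.

Lemma ext_listed_once : listed_once ee -> listed_once ext_edge.
Proof. by move=> once u v /once. Qed.

Lemma ext_covered : (forall r, exists u, ee u (inr r)) -> forall r, exists u, ext_edge u (inr r).
Proof.
move=> cov [r|[c cP]]; first exact: cov.
by have /existsP[u uc] := cP; exists u.
Qed.

(** Each free vertex acquires exactly one edge to a new root, so a set [A] meets [#|A|] further
    edges. *)
Lemma ext_balanced a b : balanced ee a b -> balanced ext_edge a (a + b).
Proof.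
move=> bal A.
pose f1 (p : U * (U + Rt)) := (p.1, old_vertex p.2).
pose f2 u : U * (U + ext_root) := (u, inr (inr (root_of u))).
set T := [set p in pattern_edges ext_edge | _].
have f1inj : injective f1 by move=> [u [v|r]] [u' [v'|r']] [] -> // ->.
have f2inj : injective f2 by move=> u u' [->].
have sub : (f1 @: [set p in pattern_edges ee | touches A p]) :|: (f2 @: A) \subset T.
  apply/subsetP => p; rewrite inE => /orP[/imsetP[q]|/imsetP[u uA ->]].
    rewrite !inE => /andP[qe qt] ->; rewrite /= ext_edge_old qe /=.
    by move: qt; rewrite /touches /=; case: (q.2).
  by rewrite !inE /= eqxx /touches /= uA.
have dis : f1 @: [set p in pattern_edges ee | touches A p] :&: f2 @: A = set0.
  apply/setP => p; rewrite !inE; apply/negP => /andP[/imsetP[[q1 q2]] _ -> /imsetP[u _]].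
  by case: q2.
have := subset_leq_card sub; rewrite cardsU dis cards0 subn0 !card_imset // => le.
apply: leq_trans (leq_mul (leqnn a) le); rewrite mulnDr mulnDl addnC leq_add2r.
exact: bal.
Qed.

(** The ends of a dense edge [x y] become the new roots: a blow-up of the old pattern inside the two
    neighbourhoods has every free vertex adjacent to [x] or [y] according to its colour. The
    neighbourhoods may have different sizes, which calls for [min_degree_bound_cross]. *)
Theorem ext_min_degree_bound a b : 0 < a -> a <= b ->
  min_degree_bound ee side a b -> min_degree_bound ext_edge ext_side a (a + b).
Proof.
move=> a0 ab HD l; have b0 : 0 < b by apply: leq_trans a0 ab.
have [C HC] := min_degree_bound_cross l ab b0 HD.
exists (C.+1 * 8 ^ b * 2 ^ a) => V g col D [gsym gcol] V0 deg; rewrite addKn => dense.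
set n := #|V| in V0 dense.
have D0 : 0 < D by rewrite lt0n; apply/eqP => E; move: dense; rewrite E exp0n ?addn_gt0 ?a0 // ltn0.
(* This will absorb the pairs that involve [x] or [y] themselves. *)
have D2 : 8 * n < D ^ 2.
  have h : D ^ (a + b) <= (D ^ 2) ^ b.
    by rewrite -expnM leq_pexp2l // mul2n -addnn leq_add2r.
  rewrite ltnNge; apply/negP => le; move: dense; rewrite ltnNge => /negP; apply.
  apply: leq_trans h _; apply: leq_trans (_ : (8 * n) ^ b <= _); first by rewrite leq_exp2r.
  rewrite expnMn leq_mul2r; apply/orP; right.
  by rewrite -[C.+1 * _ * _]mulnA mulnCA leq_pmulr // muln_gt0 expn_gt0.
pose r x y := [&& ~~ col x, col y & g x y].
pose w1 := \sum_x \sum_y r x y.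
have rx x : ~~ col x -> \sum_y r x y = #|nbrs g x|.
  move=> cx; rewrite -sum1_card [RHS]big_mkcond; apply: eq_bigr => y _; rewrite inE /r cx /=.
  by case gxy: (g x y); rewrite ?andbF //; move/gcol: gxy; rewrite (negPf cx); case: (col y).
have ry y : col y -> \sum_x r x y = #|nbrs g y|.
  move=> cy; rewrite -sum1_card [RHS]big_mkcond; apply: eq_bigr => x _; rewrite inE /r cy /= gsym.
  by case gxy: (g y x); rewrite ?andbF //; move/gcol: gxy; rewrite cy; case: (col x).
have w1D : D * n <= 2 * w1.
  have hX : D * #|[set x | ~~ col x]| <= w1.
    rewrite mulnC -sum_nat_const /w1 [X in _ <= X](bigID (fun x => ~~ col x)) /=.
    apply: leq_trans (leq_addr _ _); under eq_bigl do rewrite inE.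
    by apply: leq_sum => x cx; rewrite rx.
  have hY : D * #|[set x | col x]| <= w1.
    rewrite mulnC -sum_nat_const /w1 [X in _ <= X]exchange_big [X in _ <= X](bigID col) /=.
    apply: leq_trans (leq_addr _ _); under eq_bigl do rewrite inE.
    by apply: leq_sum => x cx; rewrite ry.
  have -> : n = #|[set x | col x]| + #|[set x | ~~ col x]|.
    rewrite /n -cardsT -(cardsID [set x | col x]) setTI; congr (_ + _).
    by apply: eq_card => x; rewrite !inE andbT.
  by rewrite mulnDr mul2n -addnn leq_add.
have w1_gt0 : 0 < w1 by rewrite -(ltn_pmul2l (ltn0Sn 1)) muln0; apply: leq_trans w1D; rewrite muln_gt0 D0.
have [x [y [rxy]]] := dense_edge w1_gt0; rewrite -/w1 -/n.
have /and3P[cx cy gxy] := rxy.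
rewrite rx // ry //; set dx := #|nbrs g x|; set dy := #|nbrs g y|.
set e := \sum_i' \sum_k' _ => dens.
pose X' := nbrs g y :\ x; pose Y' := nbrs g x :\ y.
set E := #|cross_pairs g X' Y'|.
have eE : e <= E + dx + dy.
  have -> : e = #|[set p : V * V | [&& r x p.2, r p.1 y & r p.1 p.2]]|.
    rewrite /e pair_bigA /= -sum1_card [RHS]big_mkcond; apply: eq_bigr => p _ /=.
    by rewrite inE; case: (r x p.2); case: (r p.1 y); case: (r p.1 p.2).
  have sub : [set p : V * V | [&& r x p.2, r p.1 y & r p.1 p.2]] \subset
     cross_pairs g X' Y' :|: (fun w => (x, w)) @: nbrs g x :|: (fun w => (w, y)) @: nbrs g y.
    apply/subsetP => -[u v]; rewrite !inE /= => /and3P[/and3P[_ cv gxv] /and3P[cu _ guy] /and3P[_ _ guv]].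
    have [ux|ux] := eqVneq u x.
      by apply/orP; left; apply/orP; right; apply/imsetP; exists v; rewrite ?ux // inE.
    have [vy|vy] := eqVneq v y.
      by apply/orP; right; apply/imsetP; exists u; rewrite ?vy // inE gsym.
    by rewrite /= gsym guy gxv guv.
  apply: leq_trans (subset_leq_card sub) _; apply: leq_trans (leq_card_setU _ _) _.
  apply: leq_add (leq_imset_card _ _); apply: leq_trans (leq_card_setU _ _) _.
  by rewrite leq_add2l leq_imset_card.
have Ddx : D <= dx := deg x; have Ddy : D <= dy := deg y.
have main : D * (dx * dy) <= 4 * n * E.
  have h1 : D * (dx * dy) <= 2 * n * e.
    rewrite -(leq_pmul2l V0) -/n.
    apply: leq_trans (_ : 2 * (w1 * (dx * dy)) <= _); last first.
      by apply: leq_trans (leq_mul (leqnn 2) dens) _; rewrite -mulnn -!mulnA mulnCA leqnn.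
    by rewrite !mulnA leq_mul2r leq_mul2r [n * D]mulnC w1D !orbT.
  have h2 : D * (dx + dy) <= 2 * (dx * dy).
    rewrite mulnDr mul2n -addnn addnC; apply: leq_add; first by rewrite leq_mul2r Ddx orbT.
    by rewrite mulnC leq_mul2l Ddy orbT.
  rewrite -(leq_pmul2l D0).
  have h3 : D * (D * (dx * dy)) <= 2 * n * (D * E) + 2 * n * (2 * (dx * dy)).
    apply: leq_trans (leq_mul (leqnn D) h1) _; rewrite mulnCA -mulnDr leq_mul2l; apply/orP; right.
    apply: leq_trans (leq_mul (leqnn D) eE) _; by rewrite -addnA mulnDr leq_add2l.
  have h4 : 8 * n * (dx * dy) <= D * (D * (dx * dy)).
    by rewrite [X in _ <= X]mulnA mulnn leq_mul2r ltnW ?orbT.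
  rewrite [D * (4 * n * E)]mulnCA; move: h3 h4; rewrite [2 * n * (2 * _)]mulnACA.
  rewrite -[2 * n * (D * E)]mulnA -[8 * n * _]mulnA -[4 * n * (D * E)]mulnA.
  by move: (n * (D * E)) (n * (dx * dy)) (D * (D * (dx * dy))) => *; lia.
have D_gt1 : 1 < D.
  by rewrite ltnNge; apply/negP => D1; move: D2; rewrite (_ : D = 1); [lia|lia].
have cX' : #|X'| = dy.-1 by rewrite [dy](cardsD1 x) inE gsym gxy.
have cY' : #|Y'| = dx.-1 by rewrite [dx](cardsD1 y) inE gxy.
have [f [fl [finj fS fe fc]]] : has_blowup ee side l g col (X' :|: Y').
  apply: HC; first by [].
  rewrite cX' cY' -/E.
  have min2 : D <= 2 * minn dy.-1 dx.-1 by rewrite minnE; lia.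
  have mina : D ^ a <= 2 ^ a * minn dy.-1 dx.-1 ^ a by rewrite -expnMn leq_exp2r.
  have mainb : D ^ b * (dx * dy) ^ b <= (4 * n) ^ b * E ^ b by rewrite -!expnMn leq_exp2r.
  have le1 : (dy.-1 * dx.-1) ^ b <= (dx * dy) ^ b.
    by rewrite leq_exp2r // [dx * dy]mulnC leq_mul // leq_pred.
  apply: leq_ltn_trans (leq_mul (leqnn C) le1) _.
  set mn := minn _ _ in min2 mina *.
  have dd0 : 0 < (dx * dy) ^ b by rewrite expn_gt0 muln_gt0 !(leq_trans D0).
  have n0 : 0 < (4 * n) ^ b * 2 ^ a by rewrite muln_gt0 !expn_gt0 muln_gt0 V0.
  rewrite -(ltn_pmul2l n0).
  have step : D ^ (a + b) * (dx * dy) ^ b <= (4 * n) ^ b * 2 ^ a * (E ^ b * mn ^ a).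
    rewrite [_ * 2 ^ a * _]mulnACA expnD [D ^ a * _]mulnC -mulnA mulnCA mulnC.
    by rewrite -[X in X <= _]mulnC [D ^ a * _]mulnC; apply: leq_mul.
  apply: leq_trans step; rewrite mulnA ltn_pmul2r //.
  apply: leq_ltn_trans dense; rewrite expnMn.
  have h48 : 4 ^ b <= 8 ^ b by rewrite leq_exp2r.
  have -> : 4 ^ b * n ^ b * 2 ^ a * C = C * 4 ^ b * 2 ^ a * n ^ b.
    by move: (4 ^ b) (n ^ b) (2 ^ a) => *; nia.
  by rewrite !leq_mul.
have fXY u : f u \in (if col (f u) then Y' else X').
  have := fS u; rewrite inE /X' /Y' !inE => /orP[] /andP[ne gu].
    by have := gcol _ _ gu; rewrite cy; case: (col (f u)) => //= _; rewrite !inE ne.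
  by have := gcol _ _ gu; rewrite (negPf cx); case: (col (f u)) => //= _; rewrite !inE ne.
(* Since [col x] is false, the neighbours of [x] have colour true; the root for side [val c] must
   see free vertices of colour [val c (+) fl]. *)
pose F (v : blowup_vertex U ext_root l) : V :=
  match v with
  | inl (inl r) => f (inl r)
  | inl (inr c) => if val c (+) fl then x else y
  | inr iu => f (inr iu)
  end.
have fx u : f u != x.
  have := fXY u; case: ifP => cu; rewrite !inE => /andP[] //.
  by move=> _ _; apply/eqP => E1; move: cu; rewrite E1 (negPf cx).
have fy u : f u != y.
  have := fXY u; case: ifP => cu; rewrite !inE => /andP[] //.
  by move=> _ _; apply/eqP => E1; move: cu; rewrite E1 cy.
have xy : x != y by apply/eqP => E1; move: cx; rewrite E1 cy.
have fnew u (t : bool) : f u = (if t then x else y) -> False.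
  by case: t => E1; [move: (fx u)|move: (fy u)]; rewrite E1 eqxx.
exists F, fl; split=> [u v|u|i p pe|u]; rewrite ?inE //.
- case: u v => [[r1|c1]|iu] [[r2|c2]|iv] /=;
    try solve [by move/finj => -[->]|by move/finj|by move/fnew|by move/esym/fnew].
  case: c1 c2 => [b1 p1] [b2 p2] /= E1; congr (inl (inr _)); apply: val_inj => /=.
  by move: E1 xy; case: b1 p1 => p1; case: b2 p2 => p2; case: (fl) => //= ->; rewrite eqxx.
- case: p pe => [u [v|[s|c]]]; rewrite inE /= => ue.
  + by have := fe i (u, inl v); apply; rewrite inE.
  + by have := fe i (u, inr s); apply; rewrite inE.
  + have := fXY (inr (i, u)); have := fc (inr (i, u)); rewrite /= (eqP ue) => ->.
    by case: ifP => _; rewrite !inE => /andP[_]; rewrite gsym.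
- case: u => [[s|c]|iu] /=; rewrite ?fc //.
  by case: ifP; rewrite ?cy ?(negPf cx); case: (val c); case: (fl).
Qed.
End Extension.

(** * Paths *)

(** The potential is four times the surviving incidences, plus [3 * #|A w|] for each discarded [w]
    and [4 * D0] for each discarded [u]. At its maximum no single deletion helps, which gives both
    degree conditions; by density the maximum is not attained with [W'] empty. *)
Lemma cleaning (V : finType) (A : V -> {set V}) (L W : {set V}) (D0 : nat) :
  (forall w, w \in W -> A w \subset L) -> 4 * D0 * #|L| < \sum_(w in W) #|A w| ->
  exists L' W' : {set V}, [/\ L' \subset L, W' \subset W, W' != set0,
    forall w, w \in W' -> 3 * #|A w| <= 4 * #|A w :&: L'| &
    forall u, u \in L' -> D0 <= #|[set w in W' | u \in A w]|].
Proof.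
move=> AL dense.
pose pot (LW : {set V} * {set V}) := 4 * (\sum_(w in LW.2) #|A w :&: LW.1|)
  + 3 * (\sum_(w in W :\: LW.2) #|A w|) + 4 * D0 * #|L :\: LW.1|.
pose ok (LW : {set V} * {set V}) := (LW.1 \subset L) && (LW.2 \subset W).
have ok0 : ok (L, W) by rewrite /ok /= !subxx.
have [[L' W']] := @arg_maxnP _ (L, W) ok pot ok0.
rewrite /ok /= => /andP[L'L W'W] max.
have sumW (S : {set V}) w : w \in S -> \sum_(x in S) #|A x :&: L'| = #|A w :&: L'| + \sum_(x in S :\ w) #|A x :&: L'|.
  by move=> wS; rewrite (big_setD1 w).
exists L', W'; split=> //.
- apply/eqP => W0; have := max (L, W) ok0; rewrite /pot /= !setDv big_set0 cards0 !muln0 !addn0.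
  rewrite (eq_bigr (fun w => #|A w|)) => [|w wW]; last by rewrite (setIidPl (AL w wW)).
  rewrite W0 big_set0 setD0 muln0 add0n.
  have : 4 * D0 * #|L :\: L'| <= 4 * D0 * #|L| by rewrite leq_mul2l subset_leq_card ?subsetDl ?orbT.
  move: dense; move: (4 * D0 * #|L|) (4 * D0 * #|L :\: L'|) (\sum_(w in W) _) => *; lia.
- move=> w wW'; rewrite leqNgt; apply/negP => lt.
  have := max (L', W' :\ w); rewrite L'L (subset_trans (subsetDl _ _) W'W) => /(_ isT).
  rewrite /pot /= (sumW W' w wW').
  have -> : W :\: (W' :\ w) = w |: (W :\: W').
    apply/setP => x; rewrite !inE negb_and negbK; case: eqVneq => [->|] //=.
    by rewrite (subsetP W'W).
  rewrite big_setU1 ?inE ?wW' //=; move: lt.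
  move: (\sum_(x in W' :\ w) _) (\sum_(x in W :\: W') _) (4 * D0 * _) (#|A w|) (#|A w :&: L'|) => *; lia.
- move=> u uL'; rewrite leqNgt; apply/negP => lt.
  have := max (L' :\ u, W'); rewrite (subset_trans (subsetDl _ _) L'L) W'W => /(_ isT).
  rewrite /pot /=.
  have -> : L :\: (L' :\ u) = u |: (L :\: L').
    apply/setP => x; rewrite !inE negb_and negbK; case: eqVneq => [->|] //=.
    by rewrite (subsetP L'L).
  rewrite cardsU1 !inE uL' /= mulnDr muln1.
  have sE : \sum_(w in W') #|A w :&: L'| = \sum_(w in W') #|A w :&: (L' :\ u)| + #|[set w in W' | u \in A w]|.
    rewrite -sum1_card [X in _ = _ + X]big_mkcond /= [X in _ = _ + X](bigID (mem W')) /=.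
    rewrite [X in _ = _ + (_ + X)]big1 ?addn0; last by move=> w; rewrite inE => /negPf->.
    rewrite -big_split; apply: eq_bigr => w wW' /=; rewrite inE wW' /=.
    have [uA|uA] := boolP (u \in A w).
      by rewrite addn1 (cardsD1 u) inE uA uL' /= add1n setIDA.
    by rewrite addn0; apply: eq_card => x; rewrite !inE; case: eqVneq => [->|] //=; rewrite (negPf uA).
  rewrite sE; move: lt.
  move: (\sum_(w in W') #|A w :&: (L' :\ u)|) (#|[set w in W' | u \in A w]|) (\sum_(x in W :\: W') _) (#|L :\: L'|) => s c t y lt.
  move: (4 * D0 * y) => P; lia.
Qed.

(** * Branches of a layered tree *)

Section Tree.
Variables (V : finType) (g : V -> V -> bool) (par : V -> V) (L : nat -> {set V}) (j l : nat).
Hypothesis par_level : forall i w, i < j -> w \in L i.+1 -> par w \in L i /\ g (par w) w.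
Hypothesis L_disj : forall i i' x, x \in L i -> x \in L i' -> i = i'.
Variables (x0 : V).
Hypothesis L0 : L 0 = [set x0].

Definition anc i (v : V) := iter (j - i) par v.

Lemma anc_level i v : i <= j -> v \in L j -> anc i v \in L i.
Proof.
move=> ij vL; rewrite /anc.
have H k : k <= j -> iter k par v \in L (j - k).
  elim: k => [|k IH] kj; first by rewrite subn0.
  have := IH (ltnW kj); rewrite -subSS subSn // => /par_level[] //; lia.
by have := H (j - i) (leq_subr _ _); rewrite subKn.
Qed.

Lemma anc_par i v : i < j -> par (anc i.+1 v) = anc i v.
Proof. by move=> ij; rewrite /anc -[RHS]/(iter _ _ _) (_ : j - i = (j - i.+1).+1) //; lia. Qed.

Lemma anc_adj i v : i < j -> v \in L j -> g (anc i v) (anc i.+1 v).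
Proof. by move=> ij vL; rewrite -(anc_par v ij); apply: (par_level ij (anc_level ij vL)).2. Qed.

Lemma anc_eq_up i i' u v : i' <= i -> i <= j -> anc i u = anc i v -> anc i' u = anc i' v.
Proof.
move=> ii ij E; rewrite /anc (_ : j - i' = (i - i') + (j - i)) ?iterD; last by lia.
by rewrite -!/(anc _ _) E.
Qed.

(* Walk down from the root into a branch holding at least [1 / (2 l)] of [N] as
   long as some [l] branches hold half of it. *)
Lemma branching (N : {set V}) : 0 < l -> N \subset L j -> (2 * l) ^ j < #|N| ->
  exists i y (A : {set V}), [/\ i < j, A \subset N, forall u, u \in A -> anc i u = y,
    #|N| <= #|A| * (2 * l) ^ j &
    forall Q : {set V}, #|Q| <= l -> 2 * #|[set u in A | anc i.+1 u \in Q]| <= #|A|].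
Proof.
move=> l0 NL big; apply: NNPP => nex.
have H i : i <= j -> exists y (A : {set V}), [/\ A \subset N, forall u, u \in A -> anc i u = y &
    #|N| <= #|A| * (2 * l) ^ i].
  elim: i => [|i IH] ij.
    exists x0, N; split=> // [u uN|]; last by rewrite expn0 muln1.
    by have := anc_level (leq0n j) (subsetP NL _ uN); rewrite L0 inE => /eqP.
  have [y [A [AN Ay NA]]] := IH (ltnW ij).
  have [Q Ql QA] : exists2 Q : {set V}, #|Q| <= l & #|A| < 2 * #|[set u in A | anc i.+1 u \in Q]|.
    apply: NNPP => nQ; apply: nex; exists i, y, A; split=> //.
      apply: leq_trans NA _; rewrite leq_mul2l leq_pexp2l ?orbT ?muln_gt0 //; exact: ltnW.
    by move=> Q Ql; rewrite leqNgt; apply/negP => lt; apply: nQ; exists Q.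
  have [c cQ Ac] : exists2 c, c \in Q & #|A| <= 2 * l * #|[set u in A | anc i.+1 u == c]|.
    apply: NNPP => nc.
    have small c : c \in Q -> 2 * l * #|[set u in A | anc i.+1 u == c]| < #|A|.
      by move=> cQ; rewrite ltnNge; apply/negP => le; apply: nc; exists c.
    have A0 : 0 < #|A|.
      rewrite lt0n; apply/eqP => A0; move: QA; rewrite A0.
      by rewrite (_ : [set u in A | _] = set0) ?cards0 ?muln0 //; apply/setP => u; rewrite !inE (cards0_eq A0) inE.
    have : #|[set u in A | anc i.+1 u \in Q]| <= ((#|A|.-1) %/ (2 * l)) * #|Q|.
      apply: (@leq_card_fibers _ _ (anc i.+1)) => [u|c cQ]; first by rewrite !inE => /andP[].
      have sub : #|[set x in [set u in A | anc i.+1 u \in Q] | anc i.+1 x == c]| <=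
           #|[set u in A | anc i.+1 u == c]|.
        by apply/subset_leq_card/subsetP => u; rewrite !inE => /andP[/andP[-> _] ->].
      apply: leq_trans sub _; rewrite leq_divRL ?muln_gt0 // mulnC -ltnS prednK //; exact: small.
    move=> le; have : 2 * #|[set u in A | anc i.+1 u \in Q]| <= #|A|.-1.
      apply: leq_trans (_ : 2 * (#|A|.-1 %/ (2 * l) * l) <= _).
        by rewrite leq_mul2l /=; apply: leq_trans le _; rewrite leq_mul2l Ql orbT.
      by rewrite mulnCA; apply: leq_trunc_div.
    by move: QA A0; case: #|A| => // n /=; lia.
  exists c, [set u in A | anc i.+1 u == c]; split.
  - by apply/subsetP => u; rewrite inE => /andP[/(subsetP AN)].
  - by move=> u; rewrite inE => /andP[_ /eqP].
  - by apply: leq_trans NA _; rewrite expnS mulnA leq_mul2r [_ * (2 * l)]mulnC Ac orbT.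
have [y [A [AN Ay NA]]] := H j (leqnn j).
(* At level [j] a vertex is its own ancestor, so the branch reached is a single vertex, against the
   size of [N]. *)
have A1 : #|A| <= 1.
  rewrite leqNgt; apply/negP => /card_gt1P[u [v [uA vA ne]]]; case/eqP: ne.
  by have := Ay u uA; have := Ay v vA; rewrite /anc subnn /= => -> ->.
move: big; rewrite ltnNge => /negP; apply; apply: leq_trans NA _.
by rewrite -[X in _ <= X]mul1n leq_mul2r A1 orbT.
Qed.
End Tree.

(** * Disjoint legs from a common vertex *)

Section Spider.
Variables (V : finType) (L' W' : {set V}) (A : V -> {set V}) (clr : V -> V) (zz l : nat).
Hypothesis H1 : forall u, u \in L' -> zz < #|[set w in W' | u \in A w]|.
Hypothesis H2 : forall w, w \in W' -> forall Q : {set V}, #|Q| <= l -> forall Z : {set V}, #|Z| <= zz ->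
  exists u, [/\ u \in A w, u \in L', clr u \notin Q & u \notin Z].

Definition hop x y := [&& x \in W', y \in L' & y \in A x] || [&& x \in L', y \in W' & x \in A y].

(** Greedy walk: a vertex of [L'] has more than [zz] continuations, a vertex of [W'] has one
    avoiding any [zz] vertices and any [l] branches. The parity of [t] makes the last step arrive in
    [L'], where the branch is chosen outside [Q]. *)
Lemma leg t : forall s (Z Q : {set V}), #|Z| + t <= zz -> #|Q| <= l ->
  s \in (if odd t then L' else W') ->
  exists ps, [/\ size ps = t.+1, path hop s ps, uniq ps, {in ps, forall x, x \notin Z} &
    last s ps \in L' /\ clr (last s ps) \notin Q].
Proof.
elim: t => [|t IH] s Z Q Zt Ql sP.
  rewrite addn0 in Zt; have [u [uA uL uQ uZ]] := H2 sP Ql Zt.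
  exists [:: u]; split=> //=; first by rewrite /hop sP uL uA.
  by move=> x; rewrite inE => /eqP->.
have [s' [hs s'P s'Z]] : exists s', [/\ hop s s', s' \in (if odd t then L' else W') & s' \notin Z].
  move: sP => /=; case: (odd t) => /= sP.
    have [u [uA uL _ uZ]] := H2 sP Ql (leq_trans (leq_addr _ _) Zt).
    by exists u; split=> //; rewrite /hop sP uL uA.
  have : ~~ ([set w in W' | s \in A w] \subset Z).
    apply/negP => /subset_leq_card le; have := H1 sP; rewrite ltnNge (leq_trans le) //.
    by apply: leq_trans Zt; rewrite leq_addr.
  case/subsetPn => w; rewrite inE => /andP[wW sA] wZ.
  by exists w; split=> //; rewrite /hop sP wW sA orbT.
have [|ps [sz pp up pZ pl]] := IH s' (s' |: Z) Q _ Ql s'P.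
  by rewrite cardsU1 s'Z; move: Zt; rewrite addnS add1n addSn.
exists (s' :: ps); split=> //=; first by rewrite sz.
- by rewrite hs.
- by rewrite up andbT; apply/negP => /pZ; rewrite !inE eqxx.
- by move=> x; rewrite inE => /predU1P[->//|/pZ]; rewrite !inE negb_or => /andP[].
Qed.

(** Legs are built one after another. Each avoids [s] and the earlier legs, at most [1 + l * t.+1]
    vertices, as well as the branches where those legs end; the summand [t] provides for the
    vertices of the new leg itself. *)
Lemma spider t s c : c <= l -> 1 + l * t.+1 + t <= zz -> s \in (if odd t then L' else W') ->
  exists lg : nat -> seq V,
    [/\ forall i, i < c -> [/\ size (lg i) = t.+1, path hop s (lg i), uniq (lg i) & last s (lg i) \in L'],
        forall i x, i < c -> x \in lg i -> x != s,
        forall i i' x, i < c -> i' < c -> x \in lg i -> x \in lg i' -> i = i' &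
        forall i i', i < c -> i' < c -> clr (last s (lg i)) = clr (last s (lg i')) -> i = i'].
Proof.
move=> cl zzb sP; elim: c cl => [|c IH] cl; first by exists (fun _ => [::]); split.
have [lg [l1 l2 l3 l4]] := IH (ltnW cl).
pose Z := s |: \bigcup_(i < c) [set x in lg i].
pose Q := [set clr (last s (lg i)) | i : 'I_c].
have Ql : #|Q| <= l by apply: leq_trans (leq_imset_card _ _) _; rewrite card_ord ltnW.
have cZ : #|Z| <= 1 + l * t.+1.
  rewrite cardsU1; apply: leq_add; first exact: leq_b1.
  apply: leq_trans (leq_card_bigcup _ _) _.
  apply: leq_trans (_ : \sum_(i < c) t.+1 <= _); last by rewrite sum_nat_const card_ord leq_mul2r ltnW ?orbT.
  apply: leq_sum => i _; have [<- _ _ _] := l1 i (ltn_ord i).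
  by rewrite cardsE; apply: card_size.
have [|ps [sz pp up pZ [pl pQ]]] := leg (t := t) (s := s) (Z := Z) (Q := Q) _ Ql sP.
  by apply: leq_trans zzb; rewrite leq_add2r.
have psn i x : i < c -> x \in lg i -> x \notin ps.
  move=> ic xi; apply/negP => /pZ; rewrite !inE negb_or => /andP[_ /negP]; apply.
  by apply/bigcupP; exists (Ordinal ic); rewrite ?inE.
have pscl i : i < c -> clr (last s (lg i)) <> clr (last s ps).
  by move=> ic E; case/negP: pQ; apply/imsetP; exists (Ordinal ic); rewrite ?E.
exists (fun i => if i == c then ps else lg i); split.
- by move=> i; case: eqVneq => [-> _|ne ic]; [split|apply: l1; lia].
- move=> i x; case: eqVneq => [-> _ /pZ|ne ic]; first by rewrite !inE negb_or => /andP[].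
  by apply: l2; lia.
- move=> i i' x; case: eqVneq => [->|ne] ic; case: eqVneq => [->|ne'] ic' //.
  + move=> xp xi; have ic2 : i' < c by lia.
    by have := psn i' x ic2 xi; rewrite xp.
  + move=> xi xp; have ic2 : i < c by lia.
    by have := psn i x ic2 xi; rewrite xp.
  + by apply: l3; lia.
- move=> i i'; case: eqVneq => [->|ne] ic; case: eqVneq => [->|ne'] ic' //.
  + by move=> /esym /pscl; case; lia.
  + by move=> /pscl; case; lia.
  + by apply: l4; lia.
Qed.
End Spider.

Section PathPattern.
Variable a : nat.

Definition path_edge (u : 'I_a) (w : 'I_a + bool) :=
  match w with
  | inl v => v == u.+1 :> nat
  | inr false => u == 0 :> nat
  | inr true => u.+1 == a
  end.

Definition path_side (w : 'I_a + bool) :=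
  match w with inl v => odd v.+1 | inr c => c && odd a.+1 end.

Lemma path_listed_once : listed_once path_edge.
Proof. by move=> u v /= /eqP->; rewrite neq_ltn ltnS leqnSn. Qed.

Lemma path_covered : 0 < a -> forall r, exists u, path_edge u (inr r).
Proof.
move=> a0 [|]; last by exists (Ordinal a0).
have lt : a.-1 < a by rewrite prednK.
by exists (Ordinal lt) => /=; rewrite prednK.
Qed.

(** The blow-up of the path pattern is a theta graph: [l] internally disjoint paths of length
    [a + 1] from [s] to [y]. Colours follow from the parity of the position. *)
Lemma theta_intro (V : finType) (g : V -> V -> bool) col l (P : 'I_l -> nat -> V) s y :
  0 < l -> bipartite_by g col -> (forall c, P c 0 = s) -> (forall c, P c a.+1 = y) ->
  (forall c t, t <= a -> g (P c t) (P c t.+1)) -> s != y ->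
  (forall c t, 0 < t <= a -> (P c t != s) && (P c t != y)) ->
  (forall c c' t t', 0 < t <= a -> 0 < t' <= a -> P c t = P c' t' -> c = c' /\ t = t') ->
  has_blowup path_edge path_side l g col setT.
Proof.
move=> l0 [gsym gcol] P0 Pa Padj sy Pne Pinj.
pose f (x : blowup_vertex 'I_a bool l) := match x with
  | inl false => s | inl true => y | inr cu => P cu.1 cu.2.+1 end.
have colP c t : t <= a.+1 -> col (P c t) = odd t (+) col s.
  elim: t => [|t IH] ta; first by rewrite P0.
  have := gcol _ _ (Padj c t ta); rewrite IH ?(ltnW ta) //=.
  by case: (odd t); case: (col s); case: (col (P c t.+1)).
have Pf c (u : 'I_a) : (P c u.+1 != s) && (P c u.+1 != y) by apply: Pne; rewrite /= ltn_ord.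
exists f, (col s); split=> [x x'|x|i [u w]|x]; rewrite ?inE //.
- case: x x' => [[|]|[c u]] [[|]|[c' u']] //= E.
  + by case/eqP: sy.
  + by have := Pf c' u'; rewrite -E eqxx andbF.
  + by case/eqP: sy.
  + by have := Pf c' u'; rewrite -E eqxx.
  + by have := Pf c u; rewrite E eqxx andbF.
  + by have := Pf c u; rewrite E eqxx.
  + have [||-> [/val_inj->]] := Pinj _ _ _ _ _ _ E => //; by rewrite /= ltn_ord.
- case: w => [v|[|]] /= /eqP E.
  + by rewrite E; apply: Padj; rewrite -E ltnW.
  + by rewrite E -(Pa i); apply: Padj.
  + by rewrite E gsym -(P0 i); apply: Padj.
- case: x => [[|]|[c u]] /=.
  + by rewrite -(Pa (Ordinal l0)) colP.
  + by [].
  + by rewrite colP // ltnW // ltnS.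
Qed.

End PathPattern.

(** [spider_size] bounds the vertices to be avoided. In [tree_const], the power of [2 * l] is the
    loss in [branching]; the first summand pays for the choice of a branching depth and for
    [cleaning], the second for discarding vertices with few neighbours in the last level. *)
Definition spider_size a l := 1 + l * a.+1 + a.
Definition tree_const a l :=
  (2 * l) ^ a * (a.+1 * (4 * (spider_size a l).+1) + 4 * (spider_size a l).+1).

Section TreeTheta.
Variables (V : finType) (g : V -> V -> bool) (col : V -> bool) (par : V -> V).
Variables (L : nat -> {set V}) (j l a : nat) (x0 : V) (W : {set V}).
Hypothesis bip : bipartite_by g col.
Hypothesis par_level : forall i w, i < j -> w \in L i.+1 -> par w \in L i /\ g (par w) w.
Hypothesis L_disj : forall i i' x, x \in L i -> x \in L i' -> i = i'.
Hypothesis L0 : L 0 = [set x0].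
Hypotheses (l0 : 0 < l) (ja : j <= a).
Hypothesis WL : forall w i, w \in W -> i <= j -> w \notin L i.
Notation ancj := (anc par j).
Let N w := nbrs g w :&: L j.
Let zz := spider_size a l.
Let K := (2 * l) ^ a.

(** For each [w] with many neighbours in the last level, [branching] finds a depth at which they
    spread over many branches. One depth with a fair share of the incidences is kept, and [cleaning]
    leaves a bipartite graph in which legs can be grown. *)
Lemma tree_theta_branch : tree_const a l * (#|L j| + #|W|) < \sum_(w in W) #|N w| ->
  exists i (A : V -> {set V}) (yw : V -> V) (L' W' : {set V}),
  [/\ i < j, L' \subset L j /\ W' \subset W, W' != set0,
      forall w, w \in W' -> A w \subset N w /\ (forall u, u \in A w -> ancj i u = yw w) &
      (forall u, u \in L' -> zz < #|[set w in W' | u \in A w]|) /\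
      (forall w, w \in W' -> forall Q : {set V}, #|Q| <= l -> forall Z : {set V}, #|Z| <= zz ->
        exists u, [/\ u \in A w, u \in L', ancj i.+1 u \notin Q & u \notin Z])].
Proof.
have K0 : 0 < K by rewrite expn_gt0 muln_gt0 l0.
have jK : (2 * l) ^ j <= K by rewrite leq_pexp2l ?muln_gt0 ?l0.
rewrite /tree_const -/zz -/K; set D1 := 4 * zz.+1 => dense.
pose H := [set w in W | K * D1 <= #|N w|].
have choice w : exists t : nat * V * {set V}, w \in H -> [/\ t.1.1 < j, t.2 \subset N w,
    forall u, u \in t.2 -> ancj t.1.1 u = t.1.2, #|N w| <= #|t.2| * K &
    forall Q : {set V}, #|Q| <= l -> 2 * #|[set u in t.2 | ancj t.1.1.+1 u \in Q]| <= #|t.2|].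
  have [wH|] := boolP (w \in H); last by exists (0, x0, set0).
  have [||i [y [A [ij AN Ay NA AQ]]]] := branching par_level L0 l0 (N := N w).
  - exact: subsetIr.
  - move: wH; rewrite inE => /andP[_ le]; apply: leq_ltn_trans jK _; apply: leq_trans le.
    by rewrite -[X in X < _]muln1 ltn_pmul2l // /D1; lia.
  exists (i, y, A) => _; split=> //=; apply: leq_trans NA _; by rewrite leq_mul2l jK orbT.
have [T HT] := fin_all_exists choice.
have sumH : a.+1 * D1 * #|L j| < \sum_(w in H) #|(T w).2|.
  have h1 : \sum_(w in W) #|N w| <= \sum_(w in H) #|N w| + K * D1 * #|W|.
    rewrite (bigID (mem H)) /=; apply: leq_add.
      rewrite (eq_bigl (mem H)) // => w; rewrite /= !inE; by case: (w \in W).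
    rewrite mulnC -sum_nat_const [X in _ <= X](bigID (mem H)) /=.
    apply: leq_trans (leq_addl _ _); apply: leq_sum => w /andP[wW].
    by rewrite inE wW /= -ltnNge => /ltnW.
  have h2 : \sum_(w in H) #|N w| <= (\sum_(w in H) #|(T w).2|) * K.
    by rewrite big_distrl; apply: leq_sum => w /HT[].
  rewrite -(ltn_pmul2r K0); apply: leq_trans h2.
  move: dense h1; rewrite -/D1 [_ * (#|L j| + _)]mulnDr.
  move: (\sum_(w in W) _) (\sum_(w in H) #|N w|) => s1 s2.
  have -> : K * (a.+1 * D1 + D1) * #|L j| = a.+1 * D1 * #|L j| * K + K * D1 * #|L j| by rewrite mulnDr mulnDl; congr (_ + _); rewrite -[K * _ * _]mulnA mulnC.
  have : K * D1 * #|W| <= K * (a.+1 * D1 + D1) * #|W|.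
    by rewrite leq_mul2r leq_mul2l leq_addl !orbT.
  move: (K * D1 * #|W|) (K * (a.+1 * D1 + D1) * #|W|) (a.+1 * D1 * #|L j| * K) (K * D1 * #|L j|) => *; lia.
have [i Hi] : exists i, 4 * zz.+1 * #|L j| < \sum_(w in [set w in H | (T w).1.1 == i]) #|(T w).2|.
  apply: NNPP => nex; move: sumH; rewrite ltnNge => /negP; apply.
  rewrite (partition_big (fun w => inord (T w).1.1 : 'I_a.+1) xpredT) //=.
  rewrite -mulnA -[X in _ <= X * _]card_ord -sum_nat_const; apply: leq_sum => i _.
  rewrite leqNgt; apply/negP => lt; apply: nex; exists (val i); apply: leq_trans lt _.
  apply: eq_leq; apply: eq_bigl => w; rewrite inE; have [wH|//] := boolP (w \in H).
  have [lt _ _ _ _] := HT w wH; rewrite -val_eqE /= inordK //; lia.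
pose A w := (T w).2.
have [|L' [W' [L'L W'H W'0 c1 c2]]] := cleaning (A := A) _ Hi.
  by move=> w; rewrite inE => /andP[/HT[_ AN _ _ _] _]; apply: subset_trans AN (subsetIr _ _).
have W'P w : w \in W' -> w \in H /\ (T w).1.1 = i.
  by move=> /(subsetP W'H); rewrite inE => /andP[-> /eqP].
exists i, A, (fun w => (T w).1.2), L', W'; split=> //.
- have /set0Pn[w /W'P[wH <-]] := W'0; by have [] := HT w wH.
- by split=> //; apply/subsetP => w /W'P[]; rewrite inE => /andP[].
- move=> w /W'P[wH wi]; have [_ AN Ay _ _] := HT w wH; split=> // u uA.
  by rewrite -wi; apply: Ay.
split=> [//|w wW' Q Ql Z Zz]; have [wH wi] := W'P w wW'.
have [_ AN _ NA AQ] := HT w wH.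
have AD : D1 <= #|A w|.
  by rewrite -(leq_pmul2r K0) mulnC; apply: leq_trans NA; move: wH; rewrite inE => /andP[].
(* Otherwise [A w :&: L'] has at most [#|A w| / 2 + zz] elements, but it has at least three quarters
   of [A w], and [#|A w|] is at least [4 * zz.+1]. *)
apply: NNPP => nex; have := c1 w wW'.
have sub : A w :&: L' \subset [set u in A w | ancj i.+1 u \in Q] :|: Z.
  apply/subsetP => u; rewrite !inE => /andP[uA uL]; rewrite uA /=; apply/negPn/negP.
  by rewrite negb_or => /andP[uQ uZ]; apply: nex; exists u.
have := leq_trans (subset_leq_card sub) (leq_card_setU _ _).
have := AQ Q Ql; rewrite wi -/(A w).
move: (#|A w :&: L'|) (#|[set u in A w | ancj i.+1 u \in Q]|) (#|A w|) (#|Z|) AD Zz; rewrite /D1 => *; lia.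
Qed.

(** A spider with legs of length [m] in the cleaned graph ends at [l] vertices of the last level, in
    different branches below one vertex [y] of level [i]. Climbing the tree from these ends to [y]
    adds [j - i] edges, making [a + 1] in all. *)
Lemma tree_theta : tree_const a l * (#|L j| + #|W|) < \sum_(w in W) #|N w| ->
  has_blowup (@path_edge a) (@path_side a) l g col setT.
Proof.
move=> /tree_theta_branch[i [A [yw [L' [W' [ij [L'L W'W] W'0 AP [H1 H2]]]]]]].
have [gsym gcol] := bip.
pose t := a - (j - i); set m := t.+1.
have mE : m + (j - i) = a.+1 by rewrite /m /t; lia.
have ma : m <= a by move: mE; lia.
have W'L x : x \in W' -> forall i', i' <= j -> x \notin L i'.
  by move=> /(subsetP W'W) xW i' ij'; apply: WL.
have [s sP] : exists s, s \in (if odd t then L' else W').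
  have /set0Pn[w wW'] := W'0; case: (odd t); last by exists w.
  by have [||u [_ uL _ _]] := H2 w wW' set0 _ set0 _; rewrite ?cards0 //; exists u.
have zzb : 1 + l * t.+1 + t <= zz.
  rewrite /zz /spider_size; apply: leq_add; last by rewrite /t leq_subr.
  by rewrite leq_add2l leq_mul2l ltnS /t leq_subr orbT.
have [lg [l1 l2 l3 l4]] := spider H1 H2 (leqnn l) zzb sP.
have hop_g x y : hop L' W' A x y -> g x y.
  case/orP => /and3P[h1 h2 h3].
    by have [/subsetP/(_ _ h3)] := AP x h1; rewrite !inE => /andP[].
  by have [/subsetP/(_ _ h3)] := AP y h2; rewrite !inE gsym => /andP[].
(* The common ancestor does not change along a hop, because each [A w] lies below the single vertex
   [yw w]; hence all legs end below the same [y]. *)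
pose Yv x := if x \in L' then ancj i x else yw x.
have hop_Y x y : hop L' W' A x y -> Yv x = Yv y.
  have W'n w : w \in W' -> w \notin L'.
    by move=> wW; apply/negP => /(subsetP L'L) wL; have := W'L w wW j (leqnn j); rewrite wL.
  case/orP => /and3P[h1 h2 h3]; rewrite /Yv.
    by rewrite (negPf (W'n _ h1)) h2; have [_ /(_ _ h3)] := AP x h1.
  by rewrite (negPf (W'n _ h2)) h1; have [_ /(_ _ h3)] := AP y h2.
pose y := Yv s.
have path_Y ps : path (hop L' W' A) s ps -> Yv (last s ps) = y.
  rewrite /y; elim: ps (s) => //= z ps IH s' /andP[/hop_Y -> /IH] //.
have lastP c : c < l -> last s (lg c) \in L' /\ ancj i (last s (lg c)) = y.
  move=> cl; have [_ pp _ lL] := l1 c cl; split=> //.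
  by have := path_Y _ pp; rewrite /Yv lL.
have sLW : s \in L' :|: W' by move: sP; rewrite inE; case: (odd t) => ->; rewrite ?orbT.
have lgLW c x : c < l -> x \in lg c -> x \in L' :|: W'.
  move=> cl; have [_ pp _ _] := l1 c cl; elim: (lg c) (s) pp => //= z ps IH s' /andP[hz /IH{}IH].
  rewrite inE => /predU1P[->|/IH //]; rewrite inE.
  by case/orP: hz => /and3P[_ -> _]; rewrite ?orbT.
have topL x i' : x \in L' :|: W' -> i' < j -> x \notin L i'.
  rewrite inE => /orP[/(subsetP L'L) xL|xW] i'j; last by apply: W'L => //; apply: ltnW.
  by apply/negP => xL'; have := L_disj xL xL'; lia.
pose P (c : 'I_l) tt := if tt <= m then nth s (s :: lg c) tt else iter (tt - m) par (last s (lg c)).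
have size_lg (c : 'I_l) : size (lg c) = m by have [] := l1 c (ltn_ord c).
have PE (c : 'I_l) tt : m <= tt -> P c tt = iter (tt - m) par (last s (lg c)).
  rewrite /P leq_eqVlt => /predU1P[<-|lt]; last by rewrite leqNgt lt.
  by rewrite leqnn subnn /= -nth_last size_lg.
have Panc (c : 'I_l) tt : m <= tt <= a.+1 -> P c tt = ancj (j - (tt - m)) (last s (lg c)).
  move=> /andP[mt ta]; rewrite PE // /anc; congr (iter _ _ _); move: mE; lia.
have lastL (c : 'I_l) : last s (lg c) \in L j by apply: (subsetP L'L); apply: (lastP c (ltn_ord c)).1.
have Plev (c : 'I_l) tt : m <= tt <= a.+1 -> P c tt \in L (j - (tt - m)).
  by move=> mt; rewrite Panc //; apply: anc_level par_level _ _ _ _ => //; apply: leq_subr.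
have Plow (c : 'I_l) tt : 0 < tt <= m -> P c tt \in lg c.
  case: tt => // tt /= tm; rewrite /P tm /=; apply: mem_nth; by rewrite size_lg.
have yL : y \in L i.
  have c0 : 'I_l := Ordinal l0; rewrite -(lastP c0 (ltn_ord c0)).2.
  by apply: anc_level par_level _ _ _ _ => //; apply: ltnW.
apply: (@theta_intro a V g col l P s y) => //.
- move=> c; rewrite Panc ?leqnn ?andbT; last exact: leq_trans ma (leqnSn a).
  by rewrite -(lastP c (ltn_ord c)).2; congr (ancj _ _); move: mE; lia.
- move=> c tt ta; have [lt|ge] := ltnP tt m.
    rewrite /P (ltnW lt) lt /=; have [_ pp _ _] := l1 c (ltn_ord c).
    apply: hop_g; have /(pathP s) := pp; apply; by rewrite size_lg.
  rewrite !Panc ?ge ?ta ?(leq_trans ge (leqnSn _)) ?(leq_trans ta (leqnSn _)) // gsym.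
  have -> : j - (tt - m) = (j - (tt.+1 - m)).+1 by move: mE; lia.
  by apply: anc_adj par_level _ _ _ _ => //; move: mE; lia.
- by apply/eqP => E; have := topL s i sLW ij; rewrite E yL.
- move=> c tt /andP[t0 ta]; have [le|gt] := leqP tt m.
    have tin : P c tt \in lg c by apply: Plow; rewrite t0.
    rewrite (l2 c _ (ltn_ord c) tin) /=; apply/eqP => E.
    by have := topL _ i (lgLW c _ (ltn_ord c) tin) ij; rewrite E yL.
  have mt : m <= tt <= a.+1 by rewrite (ltnW gt) (leq_trans ta (leqnSn a)).
  have := Plev c tt mt => inL; apply/andP; split; apply/eqP => E; rewrite E in inL.
    by have := topL s _ sLW (_ : j - (tt - m) < j); rewrite inL; move=> /(_ _)/negP; apply; [move: mE; lia|].
  by have := L_disj inL yL; move: mE; lia.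
- move=> c c' tt tt' /andP[t0 ta] /andP[t0' ta'] E.
  have low_high (d d' : 'I_l) u u' : 0 < u <= m -> m < u' <= a -> P d u = P d' u' -> False.
    move=> um /andP[mu' ua'] Eq; have := lgLW d _ (ltn_ord d) (Plow d u um); rewrite Eq => inLW.
    have lt : j - (u' - m) < j by move: mE mu'; lia.
    by have := topL _ _ inLW lt; rewrite Plev // (ltnW mu') (leq_trans ua' (leqnSn a)).
  have [le|gt] := leqP tt m; have [le'|gt'] := leqP tt' m.
  + have tin := Plow c tt; rewrite t0 le in tin; have {}tin := tin isT.
    have tin' := Plow c' tt'; rewrite t0' le' in tin'; have {}tin' := tin' isT.
    have cc : c = c' by apply: val_inj; apply: (l3 _ _ _ (ltn_ord c) (ltn_ord c') tin); rewrite E.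
    split=> //; move: E; rewrite -cc /P le le' -[tt]prednK // -[tt']prednK //=.
    have [_ _ ul _] := l1 c (ltn_ord c).
    by move/eqP; rewrite nth_uniq ?size_lg ?prednK // => /eqP E2; rewrite -(prednK t0) E2 prednK.
  + by case: (low_high _ _ _ _ _ _ E); rewrite ?t0 ?le ?gt' ?ta'.
  + by case: (low_high _ _ _ _ _ _ (esym E)); rewrite ?t0' ?le' ?gt ?ta.
  + have mt : m <= tt <= a.+1 by rewrite (ltnW gt) (leq_trans ta (leqnSn a)).
    have mt' : m <= tt' <= a.+1 by rewrite (ltnW gt') (leq_trans ta' (leqnSn a)).
    have tE : tt = tt'.
      have := Plev c tt mt; rewrite E => h; have := L_disj h (Plev c' tt' mt'); move: mE; lia.
    split=> //; apply: val_inj; apply: (l4 _ _ (ltn_ord c) (ltn_ord c')).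
    move: E; rewrite !Panc // -tE => E; apply: anc_eq_up E; move: mE; lia.
Qed.

End TreeTheta.

(** * Breadth-first levels *)

Section BFS.
Variables (V : finType) (g : V -> V -> bool) (col : V -> bool) (x0 : V).
Hypothesis bip : bipartite_by g col.

Fixpoint ball j : {set V} :=
  if j is j'.+1 then ball j' :|: [set w | [exists v in ball j', g v w]] else [set x0].

Definition level j : {set V} := if j is j'.+1 then ball j :\: ball j' else [set x0].

Lemma ball_mono i j : i <= j -> ball i \subset ball j.
Proof.
move=> /subnKC <-; elim: (j - i) => [|k IH]; first by rewrite addn0.
by rewrite addnS; apply: subset_trans IH (subsetUl _ _).
Qed.

Lemma level_ball j : level j \subset ball j.
Proof. by case: j => [|j] //; apply: subsetDl. Qed.

Lemma level_disj i i' x : x \in level i -> x \in level i' -> i = i'.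
Proof.
wlog lt : i i' / i < i'.
  move=> W xi xi'; case: (ltngtP i i') => // lt; first exact: W lt xi xi'.
  by apply/esym; apply: W lt xi' xi.
case: i' lt => // i' lt /(subsetP (level_ball i)) xi; rewrite inE.
by rewrite (subsetP (ball_mono (lt : i <= i'))).
Qed.

Lemma ball_step j v w : v \in ball j -> g v w -> w \in ball j.+1.
Proof. by move=> vb gvw; rewrite !inE; apply/orP; right; apply/existsP; exists v; rewrite vb. Qed.

Lemma level_parent j w : w \in level j.+1 -> exists2 v, v \in level j & g v w.
Proof.
rewrite inE => /andP[nb]; rewrite inE (negPf nb) /= inE => /existsP[v /andP[vb gvw]].
exists v => //; case: j nb vb => [|j] nb vb //; rewrite inE vb andbT.
by apply: contra nb => vb'; apply: ball_step gvw.
Qed.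

Lemma level_col j w : w \in level j -> col w = odd j (+) col x0.
Proof.
elim: j w => [|j IH] w; first by rewrite inE => /eqP->.
move=> /level_parent[v /IH cv gvw]; have := bip.2 _ _ gvw; rewrite cv /=.
by case: (odd j); case: (col x0); case: (col w).
Qed.

Lemma ball_level j w : w \in ball j -> exists2 i, i <= j & w \in level i.
Proof.
elim: j => [|j IH]; first by exists 0.
have [/IH[i ij wi] _|nb wb] := boolP (w \in ball j); first by exists i => //; apply: leqW.
by exists j.+1; rewrite // inE nb.
Qed.

(** Colours alternate with the level, so no edge stays inside a level, and adjacency changes the
    distance from [x0] by at most 1. *)
Lemma level_nbr j v w : v \in level j -> g v w ->
  w \in level j.+1 \/ (exists2 i, j = i.+1 & w \in level i).
Proof.
move=> vj gvw; have vb := subsetP (level_ball j) _ vj.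
have [wb|nb] := boolP (w \in ball j); last by left; rewrite inE nb (ball_step vb gvw).
have [i ij wi] := ball_level wb; right.
have := bip.2 _ _ gvw; rewrite (level_col vj) (level_col wi) => par.
have ne : i != j by apply: contraNneq par => ->.
case: j vj {vb wb} ij ne par => [|j] vj ij ne par; first by move: ij ne; rewrite leqn0 => ->.
have ij' : i <= j by rewrite -ltnS ltn_neqAle ne.
exists j => //; have [<-//|ne'] := eqVneq i j.
have gwv : g w v by rewrite bip.1.
have : v \in ball j.
  have lt : i.+1 <= j by rewrite ltn_neqAle ne'.
  by apply: (subsetP (ball_mono lt)); apply: ball_step gwv; apply: (subsetP (level_ball i)).
by move: vj; rewrite inE => /andP[/negPf->].
Qed.

Lemma parent_function : exists par : V -> V,
  forall i w, w \in level i.+1 -> par w \in level i /\ g (par w) w.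
Proof.
have H w : exists v, forall i, w \in level i.+1 -> v \in level i /\ g v w.
  have [[i wi]|nw] := classic (exists i, w \in level i.+1); last first.
    by exists w => i wi; case: nw; exists i.
  have [v vi gvw] := level_parent wi; exists v => i' wi'.
  by have [<-] := level_disj wi wi'.
by have [par Hpar] := fin_all_exists H; exists par => i w; apply: Hpar.
Qed.

Lemma level_degrees D j : (forall v, D <= #|nbrs g v|) ->
  D * #|level j| <= #|cross_pairs g (level j) (level j.+1)| +
    (if j is i.+1 then #|cross_pairs g (level i) (level j)| else 0).
Proof.
move=> deg; rewrite mulnC -sum_nat_const.
have -> : #|cross_pairs g (level j) (level j.+1)| = \sum_(v in level j) #|nbrs g v :&: level j.+1|.
  rewrite (cross_pairsC _ _ bip.1) cross_pairs_sum; apply: eq_bigr => v _.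
  by apply: eq_card => w; rewrite !inE andbC bip.1.
have -> : (if j is i.+1 then #|cross_pairs g (level i) (level j)| else 0) =
    \sum_(v in level j) (if j is i.+1 then #|nbrs g v :&: level i| else 0).
  case: j => [|i]; first by rewrite big1.
  rewrite cross_pairs_sum; apply: eq_bigr => v _.
  by apply: eq_card => w; rewrite !inE andbC bip.1.
rewrite -big_split; apply: leq_sum => v vj /=; apply: leq_trans (deg v) _.
case: j vj => [|i] vj.
  rewrite addn0; apply/subset_leq_card/subsetP => w; rewrite inE => gvw.
  by have [wl|[]//] := level_nbr vj gvw; rewrite inE wl inE gvw.
apply: leq_trans (leq_card_setU _ _); apply/subset_leq_card/subsetP => w; rewrite inE => gvw.
have [wl|[i' [<-] wl]] := level_nbr vj gvw.
  by rewrite inE [in X in X || _]inE wl inE gvw.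
by rewrite inE; apply/orP; right; rewrite inE wl inE gvw.
Qed.

End BFS.

Lemma has_blowup_widen (U Rt : finType) (ee : U -> U + Rt -> bool) side l l'
    (V : finType) (g : V -> V -> bool) col S : l <= l' ->
  has_blowup ee side l' g col S -> has_blowup ee side l g col S.
Proof.
move=> le [f [fl [finj fS fe fc]]].
pose w (x : blowup_vertex U Rt l) : blowup_vertex U Rt l' :=
  match x with inl r => inl r | inr iu => inr (widen_ord le iu.1, iu.2) end.
have winj : injective w.
  move=> [r|[i u]] [r'|[i' u']] //= [] => [->//|E ->]; congr (inr (_, _)); exact: val_inj.
exists (fun x => f (w x)), fl; split=> // [x y /finj /winj //|i p pe|x].
  by case: p pe => [u [v|r]] pe; apply: (fe (widen_ord le i) _ pe).
by rewrite fc; case: x.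
Qed.

(** Without the theta graph, consecutive levels span at most [CA] times as many edges as vertices.
    As all degrees are at least [D], each level exceeds the previous one by a factor [D / (2 CA)],
    and level [a + 1] would outgrow [V]. *)
Theorem path_min_degree_bound a : 0 < a -> min_degree_bound (@path_edge a) (@path_side a) a a.+1.
Proof.
move=> a0 l.
suff [C HC] : exists C, forall (V : finType) (g : V -> V -> bool) (col : V -> bool) (D : nat),
    bipartite_by g col -> 0 < #|V| -> (forall v, D <= #|nbrs g v|) ->
    C * #|V| < D ^ a.+1 -> has_blowup (@path_edge a) (@path_side a) l.+1 g col setT.
  exists C => V g col D bip V0 deg; rewrite subSnn expn1 => lt.
  exact: has_blowup_widen (leqnSn l) (HC V g col D bip V0 deg lt).
pose CA := (tree_const a l.+1).+1; exists ((6 * CA) ^ a.+1) => V g col D bip V0 deg dense.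
apply: NNPP => nblow.
have /card_gt0P[x0 _] := V0; pose L := level g x0.
have [par parP] := parent_function g x0.
have CA0 : 0 < CA by [].
have D6 : 6 * CA <= D.
  rewrite leqNgt; apply/negP => lt; move: dense; rewrite ltnNge => /negP; apply.
  apply: leq_trans (_ : (6 * CA) ^ a.+1 <= _); first by rewrite leq_exp2r // ltnW.
  by rewrite leq_pmulr.
have eL j : j <= a -> #|cross_pairs g (L j) (L j.+1)| <= CA * (#|L j| + #|L j.+1|).
  move=> ja; rewrite leqNgt; apply/negP => lt; apply: nblow.
  apply: (@tree_theta V g col par L j l.+1 a x0 (L j.+1)) => //.
  - by move=> i w _; apply: parP.
  - exact: level_disj.
  - by move=> w i wL ij; apply/negP => wi; have := level_disj wL wi; lia.
  apply: leq_ltn_trans (_ : CA * (#|L j| + #|L j.+1|) < _); first by rewrite leq_mul2r leqnSn orbT.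
  apply: leq_trans lt _; rewrite cross_pairs_sum; apply: leq_sum => w _.
  by apply/subset_leq_card/subsetP => x; rewrite !inE bip.1 andbC.
have grow j : j <= a -> (#|L j| <= #|L j.+1|) && (D * #|L j| <= 2 * CA * #|L j.+1|).
  elim: j => [|j IH] ja.
    have := level_degrees x0 bip 0 deg; rewrite -/L addn0; have := eL 0 ja.
    rewrite (_ : #|L 0| = 1); last by rewrite /L /= cards1.
    move: (#|cross_pairs _ _ _|) (#|L 1|) D6 CA0 => e x D6 CA0.
    rewrite mulnDr !muln1 -mulnA => h1 h2.
    have y0 : 0 < CA * x by move: (CA * x) h1 => y *; lia.
    have x_gt0 : 0 < x by move: y0; rewrite muln_gt0 => /andP[].
    by rewrite x_gt0 /=; move: (CA * x) h1 => y *; lia.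
  have /andP[h1 h2] := IH (ltnW ja).
  have h5 : D * #|L j.+1| <= #|cross_pairs g (L j.+1) (L j.+2)| + #|cross_pairs g (L j) (L j.+1)|.
    exact: (level_degrees x0 bip j.+1 deg).
  have h3 := eL j (ltnW ja); have h4 := eL j.+1 ja; move: h1 h2 h3 h4 h5.
  move: (#|cross_pairs g (L j) (L j.+1)|) (#|cross_pairs g (L j.+1) (L j.+2)|) (#|L j|) (#|L j.+1|) (#|L j.+2|).
  move=> e1 e2 x y z h1 h2 h3 h4 h5.
  (* By [h6] and [h7] the terms in [x] and [y] of the edge bounds amount to at most [3 * CA * y],
     half of [D * y]. *)
  have h6 : 6 * (CA * y) <= D * y by rewrite mulnA leq_mul2r D6 orbT.
  have h7 : CA * x <= CA * y by rewrite leq_mul2l h1 orbT.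
  move: h3 h4; rewrite !mulnDr => h3 h4.
  have h8 : D * y <= 2 * (CA * z) by move: (CA * x) (CA * y) (CA * z) (D * y) h3 h4 h5 h6 h7 => *; lia.
  rewrite -[2 * CA * z]mulnA h8 andbT -(leq_pmul2l CA0).
  by move: (CA * y) (CA * z) (D * y) h6 h8 => *; lia.
have pow j : j <= a.+1 -> D ^ j <= (2 * CA) ^ j * #|L j|.
  elim: j => [|j IH] ja; first by rewrite /L /= cards1.
  have /andP[_ h] := grow j ja; rewrite !expnS mulnAC -mulnA.
  apply: leq_trans (leq_mul (leqnn D) (IH (ltnW ja))) _.
  rewrite mulnCA [X in _ <= X]mulnC; apply: leq_trans (leq_mul (leqnn _) h) _.
  apply: eq_leq; nia.
move: dense; rewrite ltnNge => /negP; apply; apply: leq_trans (pow a.+1 (leqnn _)) _.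
apply: leq_mul; last exact: max_card.
by rewrite leq_exp2r // leq_mul2r orbT.
Qed.

(** Each vertex of [A] contributes the edge on its left, and the largest one also the edge on its
    right: [#|A| + 1] edges, while [#|A| <= a]. *)
Lemma path_balanced a : balanced (@path_edge a) a a.+1.
Proof.
move=> A; have [->|[u0 u0A]] := set_0Vmem A; first by rewrite cards0 muln0.
have [u] := @arg_maxnP _ u0 (mem A) (fun u : 'I_a => val u) u0A.
rewrite /= -/(u \in A) => uA umax; set T := [set p in _ | _].
pose pv (v : 'I_a) : 'I_a := Ordinal (leq_ltn_trans (leq_pred v) (ltn_ord v)).
pose left (v : 'I_a) : 'I_a * ('I_a + bool) :=
  if v == 0 :> nat then (v, inr false) else (pv v, inl v).
pose right : 'I_a * ('I_a + bool) :=
  if insub u.+1 is Some w then (u, inl w) else (u, inr true).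
have left_inj : injective left.
  move=> v w; rewrite /left; case: eqVneq => [v0|nv]; case: eqVneq => [w0|nw] //.
    by move=> _; apply: val_inj; rewrite /= v0 w0.
  by case.
have lT : right |: left @: A \subset T.
  apply/subsetP => p; rewrite !inE => /predU1P[->|/imsetP[v vA ->]].
    rewrite /right; case: insubP => [w _ /= wE|]; first by rewrite /= wE eqxx /touches /= uA.
    by rewrite -leqNgt /= => ua; rewrite eqn_leq ltn_ord ua /touches /= uA.
  rewrite /left; case: eqVneq => [v0|nv] /=; first by rewrite v0 eqxx /touches /= vA.
  by rewrite prednK ?lt0n // eqxx /touches /= vA orbT.
have rn : right \notin left @: A.
  apply/imsetP => -[v vA]; rewrite /right /left.
  case: insubP => [w _ /= wE|_]; case: eqVneq => [v0|nv] // [_ wv].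
  by have := umax v vA; rewrite -wv wE ltnn.
have := subset_leq_card lT; rewrite cardsU1 rn card_imset // add1n => le.
apply: leq_trans (leq_mul (leqnn a) le); rewrite mulSn mulnS leq_add2r.
by apply: leq_trans (max_card _) _; rewrite card_ord.
Qed.

(** * Subdivided stars *)

Section StarPattern.
Variable t : nat.

(** [None] is the centre and [Some j] the middle of the [j]-th subdivided edge; among the roots,
    [None] ends the edge left undivided. *)
Definition star_edge (u : option 'I_t) (w : option 'I_t + option 'I_t) :=
  match u, w with
  | None, inl (Some _) => true
  | None, inr None => true
  | Some j, inr (Some j') => j == j'
  | _, _ => false
  end.

Definition star_side (w : option 'I_t + option 'I_t) :=
  match w with inl u => isSome u | inr r => ~~ isSome r end.

Lemma star_listed_once : listed_once star_edge.
Proof. by move=> [u|] [v|]. Qed.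

Lemma star_covered r : exists u, star_edge u (inr r).
Proof. by case: r => [j|]; [exists (Some j) => /=|exists None]. Qed.

(** If the centre is not in [A], each vertex of [A] has two edges of its own. Otherwise let [x]
    count the other vertices of [A]: the [t + 1] edges at the centre and [x] outer edges are met,
    and the two sides differ by [t (t - x)]. *)
Lemma star_balanced : balanced star_edge t.+1 (2 * t).+1.
Proof.
move=> A; set T := [set p in _ | _].
have [cA|cA] := boolP (None \in A); last first.
  pose f (ub : option 'I_t * bool) : option 'I_t * (option 'I_t + option 'I_t) :=
    if ub.2 then (ub.1, inr ub.1) else (None, inl ub.1).
  have finj : {in setX A [set: bool] &, injective f}.
    by move=> [u []] [v []] _ _ //= [->].
  have sub : f @: setX A [set: bool] \subset T.
    apply/subsetP => p /imsetP[[u c]]; rewrite inE /= => /andP[uA _] ->.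
    case: u uA => [j|] uA; last by rewrite uA in cA.
    by case: c; rewrite !inE /= ?eqxx /touches /= uA ?orbT.
  have := subset_leq_card sub; rewrite card_in_imset // cardsX cardsT card_bool => le.
  by apply: leq_trans (leq_mul (leqnn _) le); nia.
pose A' := [set j : 'I_t | Some j \in A].
pose f (v : option 'I_t + 'I_t) : option 'I_t * (option 'I_t + option 'I_t) :=
  match v with inl None => (None, inr None) | inl (Some j) => (None, inl (Some j))
             | inr j => (Some j, inr (Some j)) end.
pose B : {set option 'I_t + 'I_t} := inl @: [set: option 'I_t] :|: inr @: A'.
have finj : injective f by move=> [[u|]|u] [[v|]|v] //= [->].
have sub : f @: B \subset T.
  apply/subsetP => p /imsetP[v vB ->]; rewrite !inE /touches.
  case: v vB => [[j|]|j] /=; rewrite ?cA ?eqxx //.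
  by rewrite inE => /orP[/imsetP[]//|/imsetP[x]]; rewrite !inE => xA [->]; rewrite xA.
have cB : #|B| = t.+1 + #|A'|.
  rewrite cardsU (_ : _ :&: _ = set0) ?cards0 ?subn0; last first.
    by apply/setP => v; rewrite !inE; apply/negP => /andP[/imsetP[x _ ->] /imsetP[]].
  rewrite !card_imset ?cardsT ?card_option ?card_ord //; by move=> ? ? [].
have := subset_leq_card sub; rewrite card_imset // cB => le.
apply: leq_trans (leq_mul (leqnn _) le).
have -> : #|A| = #|A'|.+1.
  rewrite (cardsD1 None) cA add1n; congr _.+1.
  have -> : A :\ None = Some @: A'.
    apply/setP => -[j|]; rewrite !inE /=.
      by rewrite mem_imset ?inE //; move=> ? ? [].
    by apply/esym/negP => /imsetP[].
  by rewrite card_imset //; move=> ? ? [].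
have : #|A'| <= t by apply: leq_trans (max_card _) _; rewrite card_ord.
by move: (#|A'|) => x xt; nia.
Qed.

Lemma star_intro (V : finType) (g : V -> V -> bool) col l (r0 : V) (r : 'I_t -> V)
    (c : 'I_l -> V) (x : 'I_l -> 'I_t -> V) : 0 < l -> bipartite_by g col ->
  (forall i, g (c i) r0) -> (forall i j, g (c i) (x i j)) -> (forall i j, g (x i j) (r j)) ->
  injective c -> injective r -> (forall i j, c i != r j) ->
  (forall i i' j j', x i j = x i' j' -> i = i' /\ j = j') -> (forall i j, x i j != r0) ->
  has_blowup star_edge star_side l g col setT.
Proof.
move=> l0 [gsym gcol] g1 g2 g3 cinj rinj cr xinj xr0.
pose k := ~~ col r0.
have cc i : col (c i) = k by have := gcol _ _ (g1 i); rewrite /k; case: (col (c i)); case: (col r0).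
have cx i j : col (x i j) = ~~ k by have := gcol _ _ (g2 i j); rewrite cc; case: (k); case: (col (x i j)).
have crj j : col (r j) = k.
  by have := gcol _ _ (g3 (Ordinal l0) j); rewrite cx; case: (k); case: (col (r j)).
have cr0 : col r0 = ~~ k by rewrite /k negbK.
pose f (v : blowup_vertex (option 'I_t) (option 'I_t) l) := match v with
  | inl None => r0 | inl (Some j) => r j | inr (i, None) => c i | inr (i, Some j) => x i j end.
have neq u v : col u = k -> col v = ~~ k -> u = v -> False.
  by move=> cu cv E; move: cu; rewrite E cv; case: (k).
exists f, k; split=> [u v|u|i [u w]|u]; rewrite ?inE //.
- case: u v => [[j|]|[i [j|]]] [[j'|]|[i' [j'|]]] //= E;
    try solve [by case: (neq _ _ _ _ E)|by case: (neq _ _ _ _ (esym E))].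
  + by rewrite (rinj _ _ E).
  + by case/eqP: (cr i' j).
  + by case/eqP: (xr0 i' j').
  + by case/eqP: (xr0 i j).
  + by have [-> ->] := xinj _ _ _ _ E.
  + by case/eqP: (cr i j').
  + by rewrite (cinj _ _ E).
- by case: u w => [j|] [[j'|]|[j'|]] //= => /eqP; rewrite ?eqxx // => <-.
- by case: u => [[j|]|[i [j|]]] /=; rewrite ?cc ?cx ?crj ?cr0.
Qed.

End StarPattern.

(** Greedy choice suffices, each set being larger than all that has to be avoided. *)
Lemma distinct_representatives (I V : finType) (S : I -> {set V}) (Z : {set V}) :
  (forall i, #|I| + #|Z| <= #|S i|) ->
  exists f : I -> V, injective f /\ forall i, f i \in S i :\: Z.
Proof.
move=> big.
have [f [fi fS]] : exists f : I -> V, {in enum I &, injective f} /\ {in enum I, forall i, f i \in S i :\: Z}.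
  have : size (enum I) <= #|I| by rewrite -cardE.
  have : uniq (enum I) by apply: enum_uniq.
  elim: (enum I) => [|i s IH] /=.
    move=> _ _; have [[i0]|nI] := classic (exists i0 : I, True); last first.
      have f0 (i : I) : V by case: nI; exists i.
      by exists f0; split.
    move=> _; have : 0 < #|S i0|.
      by apply: leq_trans (big i0); rewrite addn_gt0; apply/orP; left; apply/card_gt0P; exists i0.
    by move=> /card_gt0P[v _]; exists (fun _ => v); split.
  move=> /andP[ni us] sz; have [f [fi fS]] := IH us (ltnW sz).
  have [v vP] : exists v, v \in S i :\: (Z :|: [set f k | k in s]).
    apply/set0Pn; rewrite -card_gt0 cardsD subn_gt0.
    apply: leq_ltn_trans (subset_leq_card (subsetIr _ _)) _.
    apply: leq_ltn_trans (leq_card_setU _ _) _; apply: leq_trans (big i); rewrite addnC ltn_add2r.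
    by apply: leq_trans sz; rewrite ltnS; apply: leq_trans (leq_imset_card _ _) (card_size s).
  move: vP; rewrite !inE negb_or => /andP[/andP[vZ vf] vS].
  have vne k : k \in s -> f k != v by move=> ks; apply: contraNneq vf => <-; apply: imset_f.
  exists (fun k => if k == i then v else f k); split.
    move=> k k'; rewrite !inE; case: eqVneq => [->|nk] /= ks; case: eqVneq => [->|nk'] /= ks' //.
    - by move=> E; have := vne k' ks'; rewrite -E eqxx.
    - by move=> E; have := vne k ks; rewrite E eqxx.
    - exact: fi.
  move=> k; rewrite inE; case: eqVneq => [-> _|nk /= /fS //]; by rewrite inE vZ.
exists f; split=> [i j|i]; first by apply: fi; rewrite mem_enum.
by apply: fS; rewrite mem_enum.
Qed.

(* Restricting to [2 t e] columns and sorting rows by their trace there. *)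
Lemma dense_biclique (V : finType) (h : V -> V -> bool) (P M : {set V}) (l t e : nat) :
  0 < e -> 2 * t * e <= #|M| -> 2 * e * (l * 2 ^ (2 * t * e)) < #|P| ->
  #|P| * #|M| <= e * #|cross_pairs h P M| ->
  exists P' S : {set V}, [/\ P' \subset P, S \subset M, l < #|P'|, t <= #|S| &
    forall p s, p \in P' -> s \in S -> h p s].
Proof.
move=> e0 bigM bigP dense; set m := 2 * t * e in bigM bigP.
have [M1 [M1M cM1 le]] := heavy_subset (fun y => #|[set x in P | h x y]|) bigM.
rewrite -!cross_pairs_sum in le.
pose tr p := [set y in M1 | h p y].
pose G := [set p in P | t <= #|tr p|].
have [t0|t0] := posnP t.
  exists P, set0; rewrite t0 sub0set cards0; split=> // [|p s]; last by rewrite inE.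
  by apply: leq_ltn_trans bigP; rewrite mulnCA leq_pmulr // !muln_gt0 e0 expn_gt0.
have m0 : 0 < m by rewrite !muln_gt0 t0 e0.
have M0 : 0 < #|M| by apply: leq_trans m0 bigM.
have h1 : #|P| * m <= e * #|cross_pairs h P M1|.
  rewrite -(leq_pmul2r M0) mulnAC; apply: leq_trans (leq_mul dense (leqnn m)) _.
  by rewrite -!mulnA leq_mul2l [_ * m]mulnC [_ * #|M|]mulnC le orbT.
have h2 : #|cross_pairs h P M1| <= #|G| * m + #|P| * t.
  have -> : #|cross_pairs h P M1| = \sum_(p in P) #|tr p|.
    rewrite -(cross_pairs_sum (fun x y => h y x) M1 P).
    have swap_inj : injective (fun p : V * V => (p.2, p.1)) by move=> [x y] [x' y'] [-> ->].
    rewrite -(card_imset _ swap_inj); apply: eq_card => -[x y]; apply/imsetP/idP => [[[u v]]|].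
      by rewrite inE /= => /and3P[a1 a2 a3] [-> ->]; rewrite inE /= a1 a2 a3.
    by rewrite inE /= => /and3P[a1 a2 a3]; exists (y, x); rewrite // inE /= a1 a2 a3.
  rewrite (bigID (fun p => t <= #|tr p|)) /=; apply: leq_add.
    rewrite -sum_nat_const (eq_bigl (fun p => p \in G)) => [|p]; last by rewrite inE.
    by apply: leq_sum => p _; rewrite -cM1; apply/subset_leq_card/subsetP => y; rewrite inE => /andP[].
  rewrite -sum_nat_const [X in _ <= X](bigID (fun p => t <= #|tr p|)) /=.
  apply: leq_trans (leq_addl _ _); apply: leq_sum => p /andP[_]; by rewrite -ltnNge => /ltnW.
have cG : l * 2 ^ m < #|G|.
  rewrite -(ltn_pmul2l (_ : 0 < 2 * e)) ?muln_gt0 ?e0 //; apply: leq_trans bigP _.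
  have := leq_trans h1 (leq_mul (leqnn e) h2); rewrite -(leq_pmul2r (_ : 0 < t)) //.
  rewrite /m => hh; rewrite -(leq_pmul2r (_ : 0 < t * e)) ?muln_gt0 ?t0 //.
  move: (#|P|) (#|G|) hh => x y; nia.
have [S lS] : exists S : {set V}, l < #|[set p in G | tr p == S]|.
  apply: NNPP => nex; move: cG; rewrite ltnNge => /negP; apply.
  rewrite -cM1 -card_powerset; apply: (@leq_card_fibers _ _ tr) => [p _|S _].
    by rewrite inE; apply/subsetP => y; rewrite inE => /andP[].
  by rewrite leqNgt; apply/negP => lt; apply: nex; exists S.
have [p0] : exists p, p \in [set p in G | tr p == S] by apply/card_gt0P; apply: leq_ltn_trans lS.
rewrite !inE => /andP[/andP[_ tp] /eqP pS].
exists [set p in G | tr p == S], S; split=> //.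
- by apply/subsetP => p; rewrite !inE => /andP[/andP[]].
- by apply: subset_trans M1M; rewrite -pS; apply/subsetP => y; rewrite inE => /andP[].
- by rewrite -pS.
- by move=> p s; rewrite !inE => /andP[_ /eqP <-]; rewrite inE => /andP[].
Qed.

(** At most [t * B] elements conflict with the entries already chosen, which leaves [q] for each new
    entry. *)
Lemma conflict_free_tuples (E : finType) (S : {set E}) (cf : rel E) (B q t : nat) :
  (forall y, y \in S -> #|[set x in S | cf x y]| <= B) -> q + t * B <= #|S| ->
  q ^ t <= #|[set s : t.-tuple E | all (mem S) s && pairwise (fun x y => ~~ cf x y) s]|.
Proof.
move=> few; elim: t => [|t IH] big.
  by rewrite expn0; apply/card_gt0P; exists [tuple]; rewrite inE.
have {}IH := IH (leq_trans (_ : _ <= q + t.+1 * B) big).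
set T := [set s : t.-tuple E | _] in IH.
pose X := [set xs : E * t.-tuple E | (xs.2 \in T) && ((xs.1 \in S) && all (fun y => ~~ cf xs.1 y) xs.2)].
have cons_inj : injective (fun xs : E * t.-tuple E => [tuple of xs.1 :: xs.2]).
  by move=> [x s] [y s'] /(congr1 val) /= [-> /val_inj ->].
have sub : (fun xs : E * t.-tuple E => [tuple of xs.1 :: xs.2]) @: X \subset
    [set s : t.+1.-tuple E | all (mem S) s && pairwise (fun x y => ~~ cf x y) s].
  apply/subsetP => s /imsetP[[x s']]; rewrite !inE /= => /andP[/andP[s1 s2] /andP[xS xs]] ->.
  by rewrite /= xS s1 xs s2.
apply: leq_trans (subset_leq_card sub); rewrite card_imset // expnS mulnC.
apply: leq_trans (leq_mul (IH _) (leqnn q)) _; first by rewrite leq_add2l leq_mul2r leqnSn orbT.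
rewrite -sum_nat_const -[X in _ <= X]sum1_card.
rewrite (eq_bigl (fun xs : E * t.-tuple E => (xs.2 \in T) && ((xs.1 \in S) && all (fun y => ~~ cf xs.1 y) xs.2))); last by move=> xs; rewrite inE.
rewrite -(pair_big_dep xpredT (fun x (s : t.-tuple E) => (s \in T) && ((x \in S) && all (fun y => ~~ cf x y) s)) (fun _ _ => 1)) /=.
rewrite (exchange_big_dep (mem T)) /= => [|x s _ /andP[] //].
apply: leq_sum => s sT.
have sS : all (mem S) s by move: sT; rewrite inE => /andP[].
pose Bad := \bigcup_(y <- s) [set x in S | cf x y].
have cBad : #|Bad| <= t * B.
  have : #|Bad| <= \sum_(y <- s) B.
    rewrite /Bad; elim: (val s) sS => [|y s' IHs] /=; first by rewrite !big_nil cards0.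
    move=> /andP[yS s'S]; rewrite !big_cons; apply: leq_trans (leq_card_setU _ _) _.
    by apply: leq_add; [apply: few|apply: IHs].
  by rewrite big_const_seq count_predT size_tuple iter_addn_0 mulnC.
apply: leq_trans (_ : #|S :\: Bad| <= _).
  rewrite cardsD leq_subRL; last by apply: subset_leq_card; apply: subsetIl.
  apply: leq_trans big; rewrite addnC leq_add2l mulSn; apply: leq_trans (leq_addl _ _).
  by apply: leq_trans cBad; apply: subset_leq_card; apply: subsetIr.
rewrite -sum1_card; apply: eq_leq; apply: eq_bigl => x; rewrite inE (_ : s \in T) //=.
rewrite andbC; apply: andb_id2l => xS; apply/negP/allP => [nb y ys|al].
  apply/negP => cxy; apply: nb; rewrite /Bad bigcup_seq; apply/bigcupP; exists y => //.
  by rewrite inE xS.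
by rewrite /Bad bigcup_seq => /bigcupP[y ys]; rewrite inE => /andP[_]; apply/negP; apply: al.
Qed.

(** Greedy choice: fewer than [l] chosen members cover at most [l * s] vertices, and each vertex
    rules out at most [B] members. *)
Lemma disjoint_family (X V : finType) (Cp : {set X}) (vs : X -> {set V}) (s B l : nat) :
  (forall x, x \in Cp -> #|vs x| <= s) -> (forall v, #|[set x in Cp | v \in vs x]| <= B) ->
  l * (s * B) < #|Cp| ->
  exists f : nat -> X, (forall i, i < l -> f i \in Cp) /\
    (forall i i' v, i < l -> i' < l -> v \in vs (f i) -> v \in vs (f i') -> i = i').
Proof.
move=> vss vB big.
have [x0 _] : exists x, x \in Cp by apply/card_gt0P; apply: leq_ltn_trans big.
have H k : k <= l -> exists f : nat -> X, (forall i, i < k -> f i \in Cp) /\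
    (forall i i' v, i < k -> i' < k -> v \in vs (f i) -> v \in vs (f i') -> i = i').
  elim: k => [|k IH] kl; first by exists (fun _ => x0); split.
  have [f [fC fd]] := IH (ltnW kl).
  pose used := \bigcup_(i < k) vs (f i).
  have cused : #|used| <= k * s.
    apply: leq_trans (leq_card_bigcup _ _) _.
    apply: leq_trans (_ : \sum_(i < k) s <= _); last by rewrite sum_nat_const card_ord.
    by apply: leq_sum => i _; apply: vss; apply: fC.
  have [x xC xu] : exists2 x, x \in Cp & [disjoint vs x & used].
    apply: NNPP => nex; move: big; rewrite ltnNge => /negP; apply.
    have sub : Cp \subset \bigcup_(v in used) [set x in Cp | v \in vs x].
      apply/subsetP => x xC; apply: contraT => nx; case: nex; exists x => //.
      rewrite -setI_eq0; apply/eqP/setP => v; rewrite !inE; apply/negP => /andP[vx vu].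
      by case/bigcupP: nx; exists v; rewrite // inE xC.
    apply: leq_trans (subset_leq_card sub) _; apply: leq_trans (leq_card_bigcup _ _) _.
    apply: leq_trans (_ : \sum_(v in used) B <= _); first by apply: leq_sum => v _; apply: vB.
    by rewrite sum_nat_const mulnA leq_mul2r (leq_trans cused) ?orbT // leq_mul2r ltnW ?orbT.
  have xd v i : i < k -> v \in vs x -> v \in vs (f i) -> False.
    move=> ik vx vi; move/pred0P: xu => /(_ v) /=; rewrite vx /= => /negP; apply.
    by apply/bigcupP; exists (Ordinal ik).
  exists (fun i => if i == k then x else f i); split.
    by move=> i; case: eqVneq => // ne ik; apply: fC; lia.
  move=> i i' v; case: eqVneq => [->|ne] ik; case: eqVneq => [->|ne'] ik' //.
  - by move=> vx vi; case: (xd v i' _ vx vi); lia.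
  - by move=> vi vx; case: (xd v i _ vx vi); lia.
  - by apply: fd; lia.
exact: H.
Qed.

Lemma enum_injection (V : finType) (S : {set V}) k : k <= #|S| ->
  exists f : 'I_k -> V, injective f /\ forall i, f i \in S.
Proof.
move=> le; exists (fun i => enum_val (widen_ord le i)); split=> [i j|i]; last exact: enum_valP.
by move=> /enum_val_inj /(congr1 val) /= /val_inj.
Qed.

Lemma exists_subset (V : finType) (S : {set V}) k : k <= #|S| ->
  exists2 S' : {set V}, S' \subset S & #|S'| = k.
Proof.
move=> /enum_injection[f [finj fS]]; exists (f @: setT).
  by apply/subsetP => x /imsetP[i _ ->].
by rewrite card_imset // cardsT card_ord.
Qed.

(* Many heavy pairs inside one neighbourhood [nbrs g x] give the blow-up at once,
   with [x] as central root.  Otherwise most copies only use light pairs, and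
   lightness bounds the number of copies with given roots through a vertex. *)
Section StarCounting.
Variables (V : finType) (g : V -> V -> bool) (col : V -> bool) (l t D : nat).
Hypothesis bip : bipartite_by g col.
Hypothesis l0 : 0 < l.
Hypothesis noblow : ~ has_blowup (@star_edge t) (@star_side t) l g col setT.

(** This codegree leaves room for [l * t] middle vertices distinct from one another and from the
    central root. *)
Let Lc := (l * t).+1.
Let codeg y z := #|nbrs g y :&: nbrs g z|.
Let heavy y z := (y != z) && (Lc <= codeg y z).
Let light y z := (y != z) && (codeg y z < Lc).
(** From this size on, [dense_biclique] applies with [e = 6]. *)
Let M0 := 12 * (l * 2 ^ (12 * t)) + 12 * t + 1.

(** [x] becomes the central root, [P] supplies the centres and [S] the outer roots; heaviness gives
    room for distinct middle vertices. *)
Lemma no_heavy_biclique x (P S : {set V}) : P \subset nbrs g x -> S \subset nbrs g x ->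
  l <= #|P| -> t <= #|S| -> ~ (forall p s, p \in P -> s \in S -> heavy p s).
Proof.
move=> PN SN lP tS hv; apply: noblow.
have [c [cinj cP]] := enum_injection lP; have [r [rinj rS]] := enum_injection tS.
have crh i j : heavy (c i) (r j) by apply: hv.
pose T (ij : 'I_l * 'I_t) := nbrs g (c ij.1) :&: nbrs g (r ij.2).
have bigT ij : #|{: 'I_l * 'I_t}| + #|[set x]| <= #|T ij|.
  by rewrite card_prod !card_ord cards1 addn1; case/andP: (crh ij.1 ij.2).
have [f [finj fS]] := distinct_representatives bigT.
apply: (@star_intro t V g col l x r c (fun i j => f (i, j))) => //.
- by move=> i; have := subsetP PN _ (cP i); rewrite inE bip.1.
- by move=> i j; have := fS (i, j); rewrite !inE => /and3P[].
- by move=> i j; have := fS (i, j); rewrite !inE => /and3P[_ _]; rewrite bip.1.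
- by move=> i j; case/andP: (crh i j).
- by move=> i i' j j' /finj [-> ->].
- by move=> i j; have := fS (i, j); rewrite !inE => /andP[].
Qed.

Lemma few_heavy x (P M : {set V}) : P \subset nbrs g x -> M \subset nbrs g x ->
  M0 <= #|P| -> M0 <= #|M| -> 6 * #|cross_pairs heavy P M| <= #|P| * #|M|.
Proof.
move=> PN MN bP bM; rewrite leqNgt; apply/negP => lt.
have [|||P' [S [P'P SM lP tS hv]]] := @dense_biclique V heavy P M l t 6 isT.
- by apply: leq_trans bM; rewrite /M0; lia.
- by apply: leq_trans bP; rewrite /M0 (_ : 2 * t * 6 = 12 * t); lia.
- exact: ltnW.
by apply: (no_heavy_biclique (subset_trans P'P PN) (subset_trans SM MN) (ltnW lP) tS).
Qed.

Variable Np : V -> {set V}.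
Hypotheses (NpN : forall v, Np v \subset nbrs g v) (NpD : forall v, #|Np v| = D).
Hypothesis Dbig : 6 * (2 + M0) <= D.

(** [p] is a centre with its central root, [xr] a leg: middle vertex and outer root. The first
    lightness condition bounds the centres once central root and middle vertex are known, the second
    the middle vertices once centre and outer root are known. *)
Let Sg (p : V * V) := [set xr : V * V |
  [&& xr.1 \in Np p.1, xr.2 \in Np xr.1, light p.2 xr.1 & light p.1 xr.2]].
Let n := #|V|.

Lemma not_light y z : ~~ light y z = (y == z) || heavy y z.
Proof. by rewrite /light /heavy negb_and negbK -leqNgt; case: eqVneq. Qed.

(** Of the [n * D ^ 3] choices of [c], [r0], [x], [r], those with [r0], [x] not light are counted
    inside [Np c], those with [c], [r] not light around [x]. Each kind takes a sixth plus lower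
    order terms, and [Dbig] bounds the latter together by another sixth. *)
Lemma good_paths : n * D ^ 3 <= 2 * \sum_c \sum_(r0 in Np c) #|Sg (c, r0)|.
Proof.
pose b1 c := #|cross_pairs (fun y z => ~~ light y z) (Np c) (Np c)|.
pose b2 c := #|[set xr : V * V | [&& xr.1 \in Np c, xr.2 \in Np xr.1 & ~~ light c xr.2]]|.
have all2 c : #|[set xr : V * V | (xr.1 \in Np c) && (xr.2 \in Np xr.1)]| = D ^ 2.
  rewrite -sum1_card (eq_bigl (fun xr : V * V => (xr.1 \in Np c) && (xr.2 \in Np xr.1))).
    rewrite -(pair_big_dep (mem (Np c)) (fun x r => r \in Np x) (fun _ _ => 1)) /=.
    under eq_bigr => x _ do rewrite sum1_card NpD.
    by rewrite sum_nat_const NpD mulnn.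
  by move=> xr; rewrite inE.
have step c : D ^ 3 <= \sum_(r0 in Np c) #|Sg (c, r0)| + D * b1 c + D * b2 c.
  have h r0 : D ^ 2 <= #|Sg (c, r0)| + D * #|[set x in Np c | ~~ light r0 x]| + b2 c.
    rewrite -(all2 c).
    have sub : [set xr : V * V | (xr.1 \in Np c) && (xr.2 \in Np xr.1)] \subset
      Sg (c, r0) :|: [set xr : V * V | (xr.1 \in [set x in Np c | ~~ light r0 x]) && (xr.2 \in Np xr.1)]
        :|: [set xr : V * V | [&& xr.1 \in Np c, xr.2 \in Np xr.1 & ~~ light c xr.2]].
      apply/subsetP => -[x r]; rewrite !inE /= => /andP[-> ->] /=.
      by case: (light r0 x); case: (light c r).
    apply: leq_trans (subset_leq_card sub) _; apply: leq_trans (leq_card_setU _ _) _.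
    rewrite leq_add2r; apply: leq_trans (leq_card_setU _ _) _; rewrite leq_add2l.
    rewrite -sum1_card (eq_bigl (fun xr : V * V => (xr.1 \in [set x in Np c | ~~ light r0 x]) && (xr.2 \in Np xr.1))).
      rewrite -(pair_big_dep (mem [set x in Np c | ~~ light r0 x]) (fun x r => r \in Np x) (fun _ _ => 1)) /=.
      under eq_bigr => x _ do rewrite sum1_card NpD.
      by rewrite sum_nat_const mulnC.
    by move=> xr; rewrite inE.
  have : \sum_(r0 in Np c) D ^ 2 <= \sum_(r0 in Np c)
      (#|Sg (c, r0)| + D * #|[set x in Np c | ~~ light r0 x]| + b2 c).
    by apply: leq_sum => r0 _; apply: h.
  rewrite sum_nat_const NpD -expnS !big_split /= sum_nat_const NpD -big_distrr /=.
  rewrite /b1 cross_pairs_sum.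
  have -> : \sum_(i in Np c) #|[set x in Np c | ~~ light i x]| =
            \sum_(y in Np c) #|[set x in Np c | ~~ light x y]|; last by [].
  apply: eq_bigr => y _; apply: eq_card => x; rewrite !inE /light eq_sym /codeg.
  by rewrite setIC.
have b1P c : 6 * b1 c <= 6 * D + D ^ 2.
  have hv := @few_heavy c (Np c) (Np c) (NpN c) (NpN c).
  rewrite NpD mulnn in hv.
  have le : b1 c <= D + #|cross_pairs heavy (Np c) (Np c)|.
    have sub : cross_pairs (fun y z => ~~ light y z) (Np c) (Np c) \subset
       (fun y => (y, y)) @: Np c :|: cross_pairs heavy (Np c) (Np c).
      apply/subsetP => -[y z]; rewrite !inE /= not_light => /and3P[yN zN /predU1P[<-|h]].
        by rewrite imset_f.
      by rewrite yN zN h orbT.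
    apply: leq_trans (subset_leq_card sub) _; apply: leq_trans (leq_card_setU _ _) _.
    by rewrite leq_add2r -(NpD c) leq_imset_card.
  have := hv _ _; move=> /(_ (ltac:(move: Dbig; lia)) (ltac:(move: Dbig; lia))).
  move: le; move: (D ^ 2) (b1 c) (#|cross_pairs _ _ _|) => *; lia.
(* [Np] need not be symmetric, so this set may be too small for [few_heavy]; the trivial bound then
   gives the term with [M0]. *)
pose Nm x := [set c | x \in Np c].
have sumNm : \sum_x #|Nm x| = n * D.
  transitivity (\sum_x \sum_c (x \in Np c : nat)).
    by apply: eq_bigr => x _; rewrite -sum1_card big_mkcond /=; apply: eq_bigr => c _; rewrite inE; case: (x \in Np c).
  rewrite exchange_big /= (eq_bigr (fun _ => D)) ?sum_nat_const // => c _.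
  by rewrite -(NpD c) -sum1_card [RHS]big_mkcond; apply: eq_bigr => x _; case: (x \in Np c).
have b2P : 6 * \sum_c b2 c <= 6 * (n * D) + n * D * D + n * (6 * M0 * D).
  have -> : \sum_c b2 c = \sum_x #|cross_pairs (fun y z => ~~ light y z) (Nm x) (Np x)|.
    transitivity (\sum_c \sum_x \sum_r ([&& x \in Np c, r \in Np x & ~~ light c r] : nat)).
      apply: eq_bigr => c _; rewrite pair_bigA /= /b2 -sum1_card big_mkcond /=.
      by apply: eq_bigr => xr _; rewrite inE; case: [&& _, _ & _].
    rewrite exchange_big /=; apply: eq_bigr => x _.
    rewrite pair_bigA /= -sum1_card [RHS]big_mkcond /=; apply: eq_bigr => cr _.
    by rewrite !inE; case: [&& _, _ & _].
  have h x : 6 * #|cross_pairs (fun y z => ~~ light y z) (Nm x) (Np x)| <=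
      6 * #|Nm x| + #|Nm x| * D + 6 * M0 * D.
    have le : #|cross_pairs (fun y z => ~~ light y z) (Nm x) (Np x)| <=
        #|Nm x| + #|cross_pairs heavy (Nm x) (Np x)|.
      have sub : cross_pairs (fun y z => ~~ light y z) (Nm x) (Np x) \subset
         (fun y => (y, y)) @: Nm x :|: cross_pairs heavy (Nm x) (Np x).
        apply/subsetP => -[y z]; rewrite !inE /= not_light => /and3P[yN zN /predU1P[<-|h]].
          by apply/orP; left; apply/imsetP; exists y; rewrite ?inE.
        by rewrite yN zN h orbT.
      apply: leq_trans (subset_leq_card sub) _; apply: leq_trans (leq_card_setU _ _) _.
      by rewrite leq_add2r leq_imset_card.
    have NmN : Nm x \subset nbrs g x.
      by apply/subsetP => c; rewrite !inE bip.1 => /(subsetP (NpN c)); rewrite inE.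
    have triv : #|cross_pairs heavy (Nm x) (Np x)| <= #|Nm x| * D.
      rewrite -(NpD x) -cardsX; apply/subset_leq_card/subsetP => p; rewrite !inE.
      by case/and3P => -> ->.
    have [big|small] := leqP M0 #|Nm x|.
      have := few_heavy NmN (NpN x) big; rewrite NpD => /(_ (ltac:(move: Dbig; lia))).
      move: le triv; move: (#|cross_pairs heavy _ _|) (#|cross_pairs _ _ _|) (#|Nm x|) (#|Nm x| * D) (6 * M0 * D) => *; lia.
    have : #|Nm x| * D <= M0 * D by rewrite leq_mul2r ltnW ?orbT.
    move: le triv; rewrite -mulnA.
    move: (#|cross_pairs heavy _ _|) (#|cross_pairs _ _ _|) (#|Nm x|) (#|Nm x| * D) (M0 * D) => *; lia.
  rewrite big_distrr /=; apply: leq_trans (_ : \sum_x (6 * #|Nm x| + #|Nm x| * D + 6 * M0 * D) <= _).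
    by apply: leq_sum => x _; apply: h.
  have -> : \sum_x (6 * #|Nm x| + #|Nm x| * D + 6 * M0 * D) =
      6 * \sum_x #|Nm x| + (\sum_x #|Nm x|) * D + n * (6 * M0 * D).
    by rewrite big_distrr big_distrl big_split big_split /n; congr (_ + _ + _); apply: sum_nat_const.
  by rewrite sumNm.
have tot : n * D ^ 3 <= \sum_c \sum_(r0 in Np c) #|Sg (c, r0)| + D * \sum_c b1 c + D * \sum_c b2 c.
  rewrite /n -sum_nat_const [X in X <= _]big_mkcond /= !big_distrr -!big_split /=.
  apply: leq_sum => c _; exact: step.
have sb1 : 6 * \sum_c b1 c <= n * (6 * D + D ^ 2).
  by rewrite big_distrr /= -sum_nat_const [X in _ <= X]big_mkcond; apply: leq_sum.
move: tot sb1 b2P Dbig; move: (\sum_c \sum_(r0 in Np c) _) (\sum_c b1 c) (\sum_c b2 c) => s s1 s2 h1 h2 h3 h4.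
have k1 : D * (6 * s1) <= D * (n * (6 * D + D ^ 2)) by rewrite leq_mul2l h2 orbT.
have k2 : D * (6 * s2) <= D * (6 * (n * D) + n * D * D + n * (6 * M0 * D)) by rewrite leq_mul2l h3 orbT.
have k3 : n * D ^ 2 * (6 * (2 + M0)) <= n * D ^ 2 * D by rewrite leq_mul2l h4 orbT.
have e1 : D * (n * (6 * D + D ^ 2)) = 6 * (n * D ^ 2) + n * D ^ 3 by rewrite !expnS; nia.
have e2 : D * (6 * (n * D) + n * D * D + n * (6 * M0 * D)) = 6 * (n * D ^ 2) + n * D ^ 3 + 6 * M0 * (n * D ^ 2).
  by rewrite !expnS; nia.
have e3 : n * D ^ 2 * D = n * D ^ 3 by rewrite !expnS; nia.
rewrite e1 in k1; rewrite e2 in k2; rewrite e3 in k3.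
have e4 : n * D ^ 2 * (6 * (2 + M0)) = 12 * (n * D ^ 2) + 6 * M0 * (n * D ^ 2) by nia.
rewrite e4 in k3; move: h1 k1 k2 k3.
rewrite !(mulnCA D 6); move: (n * D ^ 3) (6 * M0 * (n * D ^ 2)) (n * D ^ 2) (D * s1) (D * s2) => *; lia.
Qed.

Hypothesis Dbig2 : 8 * t * (1 + Lc) + 4 <= D.

Let Gd := [set p : V * V | (p.2 \in Np p.1) && (D ^ 2 <= 4 * #|Sg p|)].

(** Pairs outside [Gd] carry at most [n * D ^ 3 / 4] of the paths in [good_paths], and each pair in
    [Gd] at most [D ^ 2]. *)
Lemma card_Gd : n * D <= 4 * #|Gd|.
Proof.
have D0 : 0 < D by apply: leq_trans Dbig2; rewrite addn4.
have sumE : \sum_c \sum_(r0 in Np c) #|Sg (c, r0)| = \sum_(p : V * V | p.2 \in Np p.1) #|Sg p|.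
  rewrite (pair_big_dep xpredT (fun c r0 => r0 \in Np c) (fun c r0 => #|Sg (c, r0)|)) /=.
  by apply: eq_bigr => -[c r0].
have cardp : #|[set p : V * V | p.2 \in Np p.1]| = n * D.
  rewrite -sum1_card (eq_bigl (fun p : V * V => true && (p.2 \in Np p.1))); last by move=> p; rewrite inE.
  rewrite -(pair_big_dep xpredT (fun c r0 => r0 \in Np c) (fun _ _ => 1)) /=.
  under eq_bigr => c _ do rewrite sum1_card NpD.
  by rewrite sum_nat_const.
have Sle p : #|Sg p| <= D ^ 2.
  apply: leq_trans (_ : #|[set xr : V * V | (xr.1 \in Np p.1) && (xr.2 \in Np xr.1)]| <= _).
    by apply/subset_leq_card/subsetP => xr; rewrite !inE => /and4P[-> ->].
  rewrite -sum1_card (eq_bigl (fun xr : V * V => (xr.1 \in Np p.1) && (xr.2 \in Np xr.1))); last first.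
    by move=> xr; rewrite inE.
  rewrite -(pair_big_dep (mem (Np p.1)) (fun x r => r \in Np x) (fun _ _ => 1)) /=.
  under eq_bigr => x _ do rewrite sum1_card NpD.
  by rewrite sum_nat_const NpD mulnn.
have up : 4 * \sum_(p : V * V | p.2 \in Np p.1) #|Sg p| <= 4 * #|Gd| * D ^ 2 + n * D * D ^ 2.
  rewrite (bigID (fun p => p \in Gd)) /= mulnDr; apply: leq_add.
    rewrite -mulnA leq_mul2l /= -sum_nat_const.
    rewrite [X in X <= _](eq_bigl (fun p => p \in Gd)); first by apply: leq_sum => p _; apply: Sle.
    by move=> p; rewrite !inE; case: (p.2 \in Np p.1).
  rewrite -cardp -sum_nat_const big_distrr /= [X in _ <= X](bigID (fun p => p \in Gd)) /=.
  apply: leq_trans (leq_addl _ _).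
  rewrite [X in _ <= X](eq_bigl (fun p => (p.2 \in Np p.1) && (p \notin Gd))); last by move=> p; rewrite inE.
  apply: leq_sum => p /andP[pN]; rewrite inE pN /= -ltnNge; exact: ltnW.
have := good_paths; rewrite sumE => gp.
have D2 : 0 < D ^ 2 by rewrite expn_gt0 D0.
rewrite -(leq_pmul2r D2); move: gp up; rewrite (_ : n * D ^ 3 = n * D * D ^ 2); last by rewrite -mulnA -expnS.
move: (\sum_(p | _) _) (n * D * D ^ 2) (4 * #|Gd| * D ^ 2) => *; lia.
Qed.

Let conf (y z : V * V) := (y.1 == z.1) || (y.2 == z.2).
Let qq := D ^ 2 %/ 8.

Lemma qq_bound : D ^ 2 <= 16 * qq.
Proof.
have D4 : 4 <= D by apply: leq_trans Dbig2; rewrite leq_addl.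
have : 16 <= D ^ 2 by rewrite -mulnn (leq_mul D4 D4).
have := divn_eq (D ^ 2) 8; have := ltn_pmod (D ^ 2) (ltn0Sn 7); rewrite -/qq.
move: (D ^ 2) (D ^ 2 %% 8) qq => *; lia.
Qed.

(** A leg conflicts with at most [D] legs through its middle vertex and, by lightness, with fewer
    than [Lc] legs to its outer root. Of the [D ^ 2 / 4] available legs, [t] such exclusions still
    leave [D ^ 2 / 8]. *)
Lemma copies_of_pair p : p \in Gd ->
  qq ^ t <= #|[set s : t.-tuple (V * V) | all (mem (Sg p)) s && pairwise (fun y z => ~~ conf y z) s]|.
Proof.
rewrite inE => /andP[_ big]; apply: (@conflict_free_tuples _ _ conf (D + Lc)).
  move=> y; rewrite inE => /and4P[y1 y2 y3 y4].
  have sub : [set x in Sg p | conf x y] \subset (fun r => (y.1, r)) @: Np y.1 :|: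
      (fun x => (x, y.2)) @: (nbrs g p.1 :&: nbrs g y.2).
    apply/subsetP => -[x r]; rewrite !inE /conf /= => /andP[/and4P[x1 x2 _ _] /orP[]/eqP E].
      by rewrite -E; apply/orP; left; apply: imset_f.
    apply/orP; right; rewrite E; apply/imsetP; exists x => //; rewrite !inE.
    have := subsetP (NpN p.1) _ x1; have := subsetP (NpN x) _ x2; rewrite !inE E bip.1 => -> -> //.
  apply: leq_trans (subset_leq_card sub) _; apply: leq_trans (leq_card_setU _ _) _.
  apply: leq_add; first by rewrite -(NpD y.1) leq_imset_card.
  apply: leq_trans (leq_imset_card _ _) _; by case/andP: y4 => _ /ltnW.
have k1 : 8 * (t * (D + Lc)) <= D ^ 2.
  have D0 : 0 < D by apply: leq_trans Dbig2; rewrite addn4.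
  apply: leq_trans (_ : D * (8 * t * (1 + Lc)) <= _).
    rewrite mulnA mulnCA leq_mul2l; apply/orP; right.
    by rewrite mulnDr muln1 leq_add2l leq_pmull.
  by rewrite -mulnn leq_mul2l (leq_trans (leq_addr _ _) Dbig2) orbT.
have k2 : 8 * qq <= D ^ 2 by rewrite mulnC leq_trunc_div.
move: big k1 k2; move: (t * (D + Lc)) (D ^ 2) (#|Sg p|) => *; lia.
Qed.

Let Cops := [set w : (V * V) * t.-tuple (V * V) | (w.1 \in Gd) &&
  (all (mem (Sg w.1)) w.2 && pairwise (fun y z => ~~ conf y z) w.2)].

Lemma card_Cops : n * D ^ (2 * t).+1 <= 4 * 16 ^ t * #|Cops|.
Proof.
have : #|Gd| * qq ^ t <= #|Cops|.
  rewrite -sum_nat_const -sum1_card.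
  rewrite (eq_bigl (fun w : (V * V) * t.-tuple (V * V) => (w.1 \in Gd) &&
    (all (mem (Sg w.1)) w.2 && pairwise (fun y z => ~~ conf y z) w.2))); last by move=> w; rewrite inE.
  rewrite -(pair_big_dep (fun p => p \in Gd) (fun p (s : t.-tuple (V * V)) =>
     all (mem (Sg p)) s && pairwise (fun y z => ~~ conf y z) s) (fun _ _ => 1)) /=.
  apply: leq_sum => p pG; apply: leq_trans (copies_of_pair pG) _.
  by rewrite -sum1_card; apply: eq_leq; apply: eq_bigl => s; rewrite inE.
have h2 : (D ^ 2) ^ t <= (16 * qq) ^ t.
  have [->|t0] := posnP t; first by rewrite !expn0.
  by rewrite leq_exp2r // qq_bound.
move=> h1; rewrite expnS expnM mulnA.
apply: leq_trans (leq_mul card_Gd h2) _; rewrite expnMn mulnACA.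
by apply: leq_mul.
Qed.

Let root_tuple (w : (V * V) * t.-tuple (V * V)) : V * t.-tuple V :=
  (w.1.2, map_tuple snd w.2).
Let B1 := Lc ^ t + t * (Lc * Lc ^ t).
Let Mc := l * (t.+1 * B1).

Lemma CopsP w : w \in Cops -> [/\ w.1.2 \in Np w.1.1,
   forall j, tnth w.2 j \in Sg w.1 &
   forall j j', j != j' -> ~~ conf (tnth w.2 j) (tnth w.2 j')].
Proof.
rewrite !inE => /andP[/andP[h1 _] /andP[/allP h2 h3]]; split=> //.
  by move=> j; apply: h2; apply: mem_tnth.
move=> j j' ne; wlog lt : j j' ne / j < j'.
  move=> W; have [lt|gt|/val_inj E] := ltngtP j j'; first exact: W.
    by rewrite /conf eq_sym [_.2 == _]eq_sym; apply: W; rewrite // eq_sym.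
  by rewrite E eqxx in ne.
have x0 := tnth w.2 j; rewrite !(tnth_nth x0).
by have /(pairwiseP x0) := h3; apply; rewrite ?inE ?size_tuple ?ltn_ord.
Qed.

(** The two summands of [B1] treat [v] as centre and as one of the [t] middle vertices. Lightness
    leaves fewer than [Lc] candidates for each middle vertex once the centre is known, and fewer
    than [Lc] centres once a middle vertex is known. *)
Lemma copies_through (rho : V * t.-tuple V) v :
  #|[set w in [set w in Cops | root_tuple w == rho] |
      v \in w.1.1 |: [set x | x \in map fst w.2]]| <= B1.
Proof.
set Cp := [set w in Cops | root_tuple w == rho].
have CpP w : w \in Cp -> [/\ w \in Cops, w.1.2 = rho.1 & forall j, (tnth w.2 j).2 = tnth rho.2 j].
  rewrite inE => /andP[wC /eqP <-]; split=> // j; by rewrite tnth_map.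
have center c : #|[set w in Cp | w.1.1 == c]| <= Lc ^ t.
  pose T j := nbrs g c :&: nbrs g (tnth rho.2 j).
  pose code (w : (V * V) * t.-tuple (V * V)) : {ffun 'I_t -> 'I_Lc} :=
    [ffun j => inord (index (tnth w.2 j).1 (enum (T j)))].
  have inT w j : w \in Cp -> w.1.1 = c -> ((tnth w.2 j).1 \in T j) && (#|T j| < Lc).
    move=> /CpP[wC _ wr] wc; have [_ /(_ j)] := CopsP wC; rewrite inE wr wc => /and4P[h1 h2 _ h4] _.
    case/andP: h4 => _ h4; rewrite /T -/(codeg _ _) h4 andbT !inE.
    have := subsetP (NpN c) _ h1; have := subsetP (NpN _) _ h2; rewrite !inE bip.1 => -> -> //.
  have cinj : {in [set w in Cp | w.1.1 == c] &, injective code}.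
    move=> w w'; rewrite inE => /andP[wC /eqP wc]; rewrite inE => /andP[wC' /eqP wc'] /ffunP E.
    have [_ w12 wr] := CpP w wC; have [_ w12' wr'] := CpP w' wC'.
    case: w w' wC wc wC' wc' E w12 wr w12' wr' => [[c1 r1] s] [[c2 r2] s'] /= wC wc wC' wc' E w12 wr w12' wr'.
    rewrite wc wc' w12 w12'; congr (_, _); apply: eq_from_tnth => j.
    rewrite [LHS]surjective_pairing [RHS]surjective_pairing wr wr'; congr (_, _).
    have /andP[i1 lt] := inT _ j wC wc; have /andP[i2 _] := inT _ j wC' wc'.
    have idx x : x \in T j -> index x (enum (T j)) < Lc.
      by move=> xT; apply: ltn_trans lt; rewrite cardE index_mem mem_enum.
    have := congr1 val (E j); rewrite !ffunE /= !inordK ?idx //.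
    by apply: (index_inj c); rewrite mem_enum.
  rewrite -(card_in_imset cinj); apply: leq_trans (max_card _) _.
  by rewrite card_ffun !card_ord.
have spoke j : #|[set w in Cp | (tnth w.2 j).1 == v]| <= Lc * Lc ^ t.
  have [->|[w0 w0P]] := set_0Vmem [set w in Cp | (tnth w.2 j).1 == v]; first by rewrite cards0.
  have lt : #|nbrs g rho.1 :&: nbrs g v| < Lc.
    move: w0P; rewrite inE => /andP[/CpP[wC wr _] /eqP <-].
    have [_ /(_ j)] := CopsP wC; rewrite inE wr => /and4P[_ _ /andP[_ //] _].
  rewrite mulnC; apply: leq_trans (_ : Lc ^ t * #|nbrs g rho.1 :&: nbrs g v| <= _).
    apply: (@leq_card_fibers _ _ (fun w : (V * V) * t.-tuple (V * V) => w.1.1)).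
      move=> w; rewrite inE => /andP[/CpP[wC wr _] /eqP wv]; rewrite !inE.
      have [h1 /(_ j)] := CopsP wC; rewrite inE wv => /and4P[h2 _ _ _] _.
      have := subsetP (NpN _) _ h1; have := subsetP (NpN _) _ h2; rewrite !inE wr.
      by rewrite (bip.1 rho.1) (bip.1 v) => -> ->.
    move=> c _; apply: leq_trans (center c); apply/subset_leq_card/subsetP => w.
    by rewrite !inE => /andP[/andP[-> _] ->].
  by rewrite leq_mul2l ltnW ?orbT.
have sub : [set w in Cp | v \in w.1.1 |: [set x | x \in map fst w.2]] \subset
    [set w in Cp | w.1.1 == v] :|: \bigcup_(j < t) [set w in Cp | (tnth w.2 j).1 == v].
  apply/subsetP => w; rewrite inE => /andP[wC]; rewrite in_setU1 => /orP[/eqP E|].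
    by apply/setUP; left; rewrite inE wC E eqxx.
  rewrite in_set => /mapP[y /tnthP[j ->] E]; apply/setUP; right; apply/bigcupP; exists j => //.
  by rewrite inE wC E eqxx.
apply: leq_trans (subset_leq_card sub) _; apply: leq_trans (leq_card_setU _ _) _.
apply: leq_add; first exact: center.
apply: leq_trans (leq_card_bigcup _ _) _.
apply: leq_trans (_ : \sum_(j < t) Lc * Lc ^ t <= _); first by apply: leq_sum => j _; apply: spoke.
by rewrite sum_nat_const card_ord.
Qed.

(** There are [n ^ t.+1] root tuples and at least a constant times [n * D ^ (2 * t).+1] copies. A
    tuple carrying more than [Mc] copies, few of them through any given vertex, has [l] disjoint
    ones. *)
Lemma star_density : 0 < n -> D ^ (2 * t).+1 <= 4 * 16 ^ t * Mc * n ^ t.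
Proof.
move=> n0; rewrite leqNgt; apply/negP => dense.
have manyC : Mc * #|[set: V * t.-tuple V]| < #|Cops|.
  rewrite cardsT card_prod card_tuple -/n -(ltn_pmul2l (_ : 0 < 4 * 16 ^ t)) ?muln_gt0 ?expn_gt0 //.
  apply: leq_trans card_Cops.
  by rewrite (mulnCA Mc) (mulnCA _ n) ltn_pmul2l // mulnA.
have [rho big] : exists rho, Mc < #|[set w in Cops | root_tuple w == rho]|.
  apply: NNPP => nex; move: manyC; rewrite ltnNge => /negP; apply.
  apply: (@leq_card_fibers _ _ root_tuple) => [w _|rho _]; first by rewrite inE.
  by rewrite leqNgt; apply/negP => lt; apply: nex; exists rho.
pose vs (w : (V * V) * t.-tuple (V * V)) := w.1.1 |: [set x | x \in map fst w.2].
have [||f [fC fdisj]] := @disjoint_family _ _ _ vs t.+1 B1 l _ _ big.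
- move=> w _; apply: leq_trans (leq_card_setU _ _) _; rewrite cards1 add1n ltnS.
  apply: leq_trans (_ : #|map fst w.2| <= _); first by apply: eq_leq; apply: eq_card => x; rewrite inE.
  by apply: leq_trans (card_size _) _; rewrite size_map size_tuple.
- by move=> v; apply: copies_through.
pose F (i : 'I_l) := f i.
have FP i : [/\ F i \in Cops, (F i).1.2 = rho.1 & forall j, (tnth (F i).2 j).2 = tnth rho.2 j].
  have := fC i (ltn_ord i); rewrite inE => /andP[wC /eqP <-]; split=> // j; by rewrite tnth_map.
have cvs i : (F i).1.1 \in vs (F i) by rewrite in_setU1 eqxx.
have xvs i j : (tnth (F i).2 j).1 \in vs (F i).
  by rewrite in_setU1; apply/orP; right; rewrite in_set map_f // mem_tnth.
apply: noblow; apply: (@star_intro t V g col l rho.1 (fun j => tnth rho.2 j)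
  (fun i => (F i).1.1) (fun i j => (tnth (F i).2 j).1)) => //.
- move=> i; have [wC <- _] := FP i; have [h _ _] := CopsP wC.
  by have := subsetP (NpN _) _ h; rewrite inE.
- move=> i j; have [wC _ _] := FP i; have [_ /(_ j) h _] := CopsP wC.
  by move: h; rewrite inE => /and4P[/(subsetP (NpN _))]; rewrite inE.
- move=> i j; have [wC _ <-] := FP i; have [_ /(_ j) h _] := CopsP wC.
  by move: h; rewrite inE => /and4P[_ /(subsetP (NpN _))]; rewrite inE.
- move=> i i' E; apply: val_inj; apply: (fdisj i i' _ _ _ (cvs i)) => //.
  by rewrite -/(F i') E.
- move=> j j' E; apply/eqP/negPn/negP => ne; pose i := Ordinal l0.
  have [wC _ wr] := FP i; have [_ _ /(_ _ _ ne)] := CopsP wC.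
  by rewrite /conf !wr E eqxx orbT.
- move=> i j; have [wC _ <-] := FP i; have [_ /(_ j) h _] := CopsP wC.
  by move: h; rewrite inE => /and4P[_ _ _ /andP[]].
- move=> i i' j j' E.
  have ii : i = i'.
    apply: val_inj; apply: (fdisj i i' _ _ _ (xvs i j)) => //.
    by rewrite -/(F i') E.
  split=> //; rewrite -ii in E; apply/eqP/negPn/negP => ne.
  have [wC _ _] := FP i; have [_ _ /(_ _ _ ne)] := CopsP wC.
  by rewrite /conf E eqxx.
- move=> i j; have [wC <- _] := FP i; have [_ /(_ j) h _] := CopsP wC.
  by move: h; rewrite inE eq_sym => /and4P[_ _ /andP[]].
Qed.

End StarCounting.

Lemma star_min_degree_bound t : min_degree_bound (@star_edge t) (@star_side t) t.+1 (2 * t).+1.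
Proof.
move=> l.
pose Lc := (l.+1 * t).+1.
pose Dmin := 6 * (2 + (12 * (l.+1 * 2 ^ (12 * t)) + 12 * t + 1)) + (8 * t * (1 + Lc) + 4).
pose Mc := l.+1 * (t.+1 * (Lc ^ t + t * (Lc * Lc ^ t))).
exists (Dmin ^ (2 * t).+1 + 4 * 16 ^ t * Mc) => V g col D bip V0 Dg.
rewrite (_ : (2 * t).+1 - t.+1 = t); last by rewrite subSS mul2n -addnn addnK.
move=> dense; apply: (@has_blowup_widen _ _ _ _ l l.+1) => //; apply: NNPP => nb.
have [Np NpP] : exists Np : V -> {set V}, forall v, Np v \subset nbrs g v /\ #|Np v| = D.
  have h v : exists S : {set V}, S \subset nbrs g v /\ #|S| = D.
    by have [S SN SD] := exists_subset (Dg v); exists S.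
  by have [Np NpP] := fin_all_exists h; exists Np.
have DD : Dmin <= D.
  rewrite -(@leq_exp2r _ _ (2 * t).+1) //; apply: leq_trans (ltnW dense).
  by rewrite mulnDl; apply: leq_trans (leq_addr _ _); rewrite leq_pmulr // expn_gt0 V0.
have := @star_density V g col l.+1 t D bip (ltn0Sn l) nb Np (fun v => (NpP v).1) (fun v => (NpP v).2)
  (leq_trans (leq_addr _ _) DD) (leq_trans (leq_addl _ _) DD) V0.
rewrite leqNgt => /negP; apply; apply: leq_ltn_trans dense.
by rewrite leq_mul2r leq_addl orbT.
Qed.

(** * Bounds for the extremal number *)

Definition good_pattern (a b : nat) := exists (U Rt : finType) (ee : U -> U + Rt -> bool)
    (side : U + Rt -> bool) (u0 : U),
  [/\ listed_once ee, forall r, exists u, ee u (inr r), balanced ee a b &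
      min_degree_bound ee side a b].

Lemma good_pattern_path a : 0 < a -> good_pattern a a.+1.
Proof.
move=> a0; exists 'I_a, bool, (@path_edge a), (@path_side a), (Ordinal a0); split.
- exact: path_listed_once.
- exact: path_covered.
- exact: path_balanced.
- exact: path_min_degree_bound.
Qed.

Lemma good_pattern_star t : good_pattern t.+1 (2 * t).+1.
Proof.
exists (option 'I_t), (option 'I_t), (@star_edge t), (@star_side t), None; split.
- exact: star_listed_once.
- exact: star_covered.
- exact: star_balanced.
- exact: star_min_degree_bound.
Qed.

Lemma good_pattern_extend a b k : 0 < a -> a <= b -> good_pattern a b -> good_pattern a (k * a + b).
Proof.
move=> a0 ab gp; elim: k => [//|k [U [Rt [ee [side [u0 [once cov bal mdb]]]]]]].
exists U, (ext_root side), (ext_edge ee (side := side)), (ext_side (side := side)), u0.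
rewrite mulSn -addnA; split.
- exact: ext_listed_once.
- exact: ext_covered.
- exact: ext_balanced.
- by apply: ext_min_degree_bound => //; apply: leq_trans ab (leq_addl _ _).
Qed.

(** A uniformly random colouring cuts a given ordered pair in the required direction with
    probability one quarter: overwriting the colours of its ends is at most four to one. *)
Lemma exists_cut (V : finType) (P : {set V * V}) : (forall p, p \in P -> p.1 != p.2) ->
  exists col : {ffun V -> bool}, #|P| <= 4 * #|[set p in P | col p.1 && ~~ col p.2]|.
Proof.
move=> Pirr; apply: NNPP => nex.
have fewer (col : {ffun V -> bool}) : 4 * #|[set p in P | col p.1 && ~~ col p.2]| < #|P|.
  by rewrite ltnNge; apply/negP => le; apply: nex; exists col.
have quarter p : p \in P -> #|{ffun V -> bool}| <= 4 * #|[set col : {ffun V -> bool} | col p.1 && ~~ col p.2]|.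
  case: p => x y /Pirr /= xy.
  pose fix_ends (col : {ffun V -> bool}) : {ffun V -> bool} :=
    [ffun z => if z == x then true else if z == y then false else col z].
  rewrite -cardsT; apply: (@leq_card_fibers _ _ fix_ends) => [col _|col' _].
    by rewrite inE !ffunE eqxx eq_sym (negPf xy) eqxx.
  have inj : {in [set col in [set: {ffun V -> bool}] | fix_ends col == col'] &,
      injective (fun col : {ffun V -> bool} => (col x, col y))}.
    move=> c1 c2; rewrite !inE /= => /eqP E1 /eqP E2 [Ex Ey]; apply/ffunP => z.
    have : fix_ends c1 z = fix_ends c2 z by rewrite E1 E2.
    by rewrite !ffunE; case: eqVneq => [->|_] //; case: eqVneq => [->|_].
  by rewrite -(card_in_imset inj); apply: leq_trans (max_card _) _; rewrite card_prod card_bool.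
have : \sum_(col : {ffun V -> bool}) 4 * #|[set p in P | col p.1 && ~~ col p.2]| <
       \sum_(col : {ffun V -> bool}) #|P|.
  pose col0 : {ffun V -> bool} := [ffun=> true].
  rewrite (bigD1 col0) //= [X in _ < X](bigD1 col0) //= -addSn leq_add //.
  by apply: leq_sum => col _; apply: ltnW.
rewrite ltnNge => /negP; apply; rewrite sum_nat_const mulnC -sum_nat_const -big_distrr /=.
have -> : \sum_(col : {ffun V -> bool}) #|[set p in P | col p.1 && ~~ col p.2]| =
    \sum_(p in P) #|[set col : {ffun V -> bool} | col p.1 && ~~ col p.2]|.
  transitivity (\sum_(col : {ffun V -> bool}) \sum_(p in P) (col p.1 && ~~ col p.2 : nat)).
    apply: eq_bigr => col _; rewrite -sum1_card big_mkcond [RHS]big_mkcond /=.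
    by apply: eq_bigr => p _; rewrite inE; case: (p \in P) => //=; case: (_ && _).
  rewrite exchange_big /=; apply: eq_bigr => p _; rewrite -sum1_card [RHS]big_mkcond /=.
  by apply: eq_bigr => col _; rewrite inE; case: (_ && _).
rewrite big_distrr /=; apply: leq_sum => p; exact: quarter.
Qed.

Lemma ex_upper_bound (U Rt : finType) (ee : U -> U + Rt -> bool) side a b l :
  a <= b -> 0 < b -> min_degree_bound ee side a b ->
  exists C, forall n, ex n (blowup ee (l := l)) ^ b <= C * n ^ (2 * b - a).
Proof.
move=> ab b0 mdb; have [C HC] := min_degree_bound_set l ab b0 mdb.
exists (4 ^ b * C) => n; rewrite /ex.
elim/big_ind: _ => [|x y hx hy|G /andP[Gs Gfree]]; first by rewrite exp0n.
  by rewrite /maxn; case: ifP.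
have Gsym x y : G (x, y) = G (y, x) by move/forallP: Gs => /(_ x)/forallP/(_ y)/andP[/eqP].
have Girr x : ~~ G (x, x) by move/forallP: Gs => /(_ x)/forallP/(_ x)/andP[].
pose P := [set p : 'I_n * 'I_n | G p].
have [|col cut] := @exists_cut _ P.
  by move=> [x y]; rewrite inE /=; apply: contraTneq => ->.
pose g x y := G (x, y) && (col x != col y).
have bip : bipartite_by g col.
  by split=> [x y|x y /andP[]//]; rewrite /g Gsym eq_sym.
have EP : nedges G <= 4 * #|inner_pairs g setT|.
  apply: leq_trans (_ : #|P| <= _).
    by apply/subset_leq_card/subsetP => p; rewrite !inE => /andP[].
  apply: leq_trans cut _; rewrite leq_mul2l /=; apply/subset_leq_card/subsetP => -[x y].
  by rewrite !inE /g /= => /and3P[-> -> /negPf ->].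
have [lt|le] := ltnP (C * #|[set: 'I_n]| ^ (2 * b - a)) (#|inner_pairs g setT| ^ b).
  case/negP: Gfree; have [f [fl [finj _ fe _]]] := HC _ _ _ _ bip lt.
  by apply: (contains_intro finj Gsym) => i p /(fe i) /andP[].
rewrite cardsT card_ord in le; rewrite -mulnA.
apply: leq_trans (leq_mul (leqnn _) le); rewrite -expnMn.
by rewrite leq_exp2r.
Qed.

(** The largest power [q] of 2 for which [q ^ b] fits into [n] satisfies [n < (2 q) ^ b], so padding
    costs only a constant factor. *)
Lemma ex_lower_bound (U Rt : finType) (ee : U -> U + Rt -> bool) a b (u0 : U) :
  listed_once ee -> (forall r, exists u, ee u (inr r)) -> balanced ee a b -> a <= b -> 0 < b ->
  exists l K n0, forall n, n0 <= n -> n ^ (2 * b - a) <= K * ex n (blowup ee (l := l)) ^ b.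
Proof.
move=> once cov bal ab b0; have [l [j0 Hj]] := blowup_lower_bound u0 once bal b0.
exists l.+1, (2 ^ (b * (2 * b - a)) * 8 ^ b), ((2 ^ j0.+1) ^ b) => n nn.
(* Roots are covered by assumption, free vertices by balancedness applied to a singleton. *)
have covv v : exists2 p, p \in pattern_edges ee & v = inl p.1 \/ v = p.2.
  case: v => [u|r]; last by have [u e] := cov r; exists (u, inr r); rewrite ?inE //; right.
  have := bal [set u]; rewrite cards1 muln1 => le.
  have : 0 < #|[set p in pattern_edges ee | touches [set u] p]|.
    by move: (leq_trans b0 le); rewrite muln_gt0 => /andP[].
  case/card_gt0P => -[v w]; rewrite inE => /andP[pe]; rewrite /touches /= !inE.
  case/orP => [/eqP <-|]; first by exists (v, w) => //; left.
  case: w pe => // w pe; rewrite inE => /eqP E; exists (v, inl w) => //; by right; rewrite E.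
have [j jP jmax] : exists2 j, (2 ^ j.+1) ^ b <= n & forall k, (2 ^ k.+1) ^ b <= n -> k <= j.
  have ex0 : exists k, (2 ^ k.+1) ^ b <= n by exists j0.
  have bnd k : (2 ^ k.+1) ^ b <= n -> k <= n.
    move=> le; apply: leq_trans le; apply: leq_trans (_ : 2 ^ k.+1 <= _).
      by apply: leq_trans (leqnSn k) (ltnW (ltn_expl _ _)).
    by rewrite -{1}[2 ^ _]expn1 leq_pexp2l // expn_gt0.
  by case: (ex_maxnP ex0 bnd) => j h1 h2; exists j.
have [G [Gs Gfree dense]] := Hj j (jmax _ nn).
set q := 2 ^ j.+1 in jP G Gs Gfree dense.
have q0 : 0 < q by rewrite expn_gt0.
have ltn : n < (2 * q) ^ b by rewrite /q -expnS ltnNge; apply/negP => /jmax; rewrite ltnn.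
have Eex : nedges G <= ex n (blowup ee (l := l.+1)).
  apply: leq_trans (pad_nedges jP G) _; rewrite /ex.
  apply: (@leq_bigmax_cond _ _ (fun G : hgraph n => nedges G)).
  rewrite pad_simple //=; apply: contra Gfree => /(pad_contains Gs covv); exact.
have qE : q ^ (2 * b - a) <= 8 * ex n (blowup ee (l := l.+1)).
  apply: leq_trans (leq_mul (leqnn 8) Eex); rewrite -(leq_pmul2l (_ : 0 < q ^ a)) ?expn_gt0 ?q0 //.
  rewrite -expnD subnKC; last by rewrite (leq_trans ab) // leq_pmull.
  by move: dense; rewrite -expnM mulnC [8 * _]mulnC mulnA.
apply: leq_trans (_ : ((2 * q) ^ b) ^ (2 * b - a) <= _).
  by have [->|s0] := posnP (2 * b - a); rewrite ?expn0 // leq_exp2r // ltnW.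
rewrite -expnM expnMn -mulnA leq_mul2l -expnMn; apply/orP; right.
by rewrite mulnC expnM leq_exp2r.
Qed.

(** * Real exponents *)

From Stdlib Require Import Reals.

Section RealExponents.
Import ssrnat.

Lemma INR_expn m k : INR (m ^ k) = (INR m ^ k)%R.
Proof. by elim: k => [|k IH] //=; rewrite expnS mult_INR IH. Qed.

Lemma pow_le_inv (x y : R) k : 0 < k -> (0 <= y)%R -> (x ^ k <= y ^ k)%R -> (x <= y)%R.
Proof.
move=> k0 y0 le; apply: Rnot_lt_le => lt; apply: (Rlt_irrefl (y ^ k)).
apply: Rlt_le_trans le; case: k k0 => // k _.
elim: k => [|k IH]; first by rewrite !pow_1.
rewrite -!(tech_pow_Rmult _ k.+1); apply: Rmult_le_0_lt_compat => //; exact: pow_le.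
Qed.

Lemma Rpower_ratio (n a b : nat) : 0 < n -> 0 < b -> a <= 2 * b ->
  (Rpower (INR n) (2 - INR a / INR b) ^ b = INR (n ^ (2 * b - a)))%R.
Proof.
move=> n0 b0 ab; have Rn : (0 < INR n)%R by apply/lt_0_INR/ltP.
have Rb : INR b <> 0%R by apply/not_0_INR => b00; rewrite b00 in b0.
rewrite INR_expn -!Rpower_pow //; last exact: exp_pos.
rewrite Rpower_mult minus_INR; last exact/leP.
by congr Rpower; rewrite mult_INR /=; field.
Qed.

Lemma good_pattern_realisable a b : 0 < a -> a <= b -> good_pattern a b ->
  realisable (2 - INR a / INR b)%R.
Proof.
move=> a0 ab [U [Rt [ee [side [u0 [once cov bal mdb]]]]]].
have b0 : 0 < b by apply: leq_trans ab.
have a2b : a <= 2 * b by rewrite (leq_trans ab) // leq_pmull.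
have [l [K [n0 low]]] := ex_lower_bound u0 once cov bal ab b0.
have [C up] := ex_upper_bound l ab b0 mdb.
exists #|blowup_vertex U Rt l|, (blowup ee (l := l)); split; first exact: blowup_simple.
have pos k : (0 < INR k.+1)%R by apply/lt_0_INR/ltP.
have grow k : k <= k.+1 ^ b.
  by apply: leq_trans (leqnSn k) _; rewrite -{1}[k.+1]expn1 leq_pexp2l.
exists (/ INR K.+1)%R, (INR C.+1); split; first exact: Rinv_0_lt_compat.
split=> //; exists n0.+1 => n /leP nn.
have n00 : 0 < n by apply: leq_trans nn.
set y := Rpower _ _; have y0 : (0 < y)%R by apply: exp_pos.
have yE : (y ^ b = INR (n ^ (2 * b - a)))%R by apply: Rpower_ratio.
(* Constants are enlarged to [b]-th powers so that a [b]-th root of the inequality can be taken. *)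
have comb M m k : m <= M * k -> m <= M.+1 ^ b * k.
  by move=> le; apply: leq_trans le _; rewrite leq_mul2r grow orbT.
split.
  apply: (Rmult_le_reg_l (INR K.+1)) => //.
  rewrite -Rmult_assoc Rinv_r ?Rmult_1_l; last by apply/Rgt_not_eq/pos.
  apply: (@pow_le_inv _ _ b) => //; first by apply: Rmult_le_pos; apply: pos_INR.
  rewrite Rpow_mult_distr yE -!INR_expn -mult_INR; apply/le_INR/leP.
  by apply/comb/low/ltnW.
apply: (@pow_le_inv _ _ b) => //; first by apply: Rmult_le_pos; [apply: pos_INR|apply: Rlt_le].
rewrite Rpow_mult_distr yE -!INR_expn -mult_INR; apply/le_INR/leP.
by apply/comb/up.
Qed.

(** If [b] is 1 modulo [a], it is [a + 1] plus a multiple of [a]. If [a] divides [b + 1], then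
    [b + 1] is at least [2 a] because [b > a], so [b] is [2 a - 1] plus a multiple of [a], and the
    star with [t = a - 1] is extended. *)
Lemma good_pattern_residue a b : 0 < a -> a < b ->
  b %% a = 1 %% a \/ (b + 1) %% a = 0 -> good_pattern a b.
Proof.
move=> a0 ab [] E.
  have dv : a %| b - a.+1.
    rewrite -(eqn_mod_dvd _ ab); by rewrite E -[a.+1]addn1 modnDl.
  rewrite -(subnK ab) -(divnK dv); apply: good_pattern_extend => //; exact: good_pattern_path.
case: a a0 ab E => // t _ ab E.
have le : (2 * t).+1 <= b.
  have [q Eq] : exists q, b + 1 = q * t.+1 by exists ((b + 1) %/ t.+1); rewrite {1}(divn_eq (b + 1) t.+1) E addn0.
  have : 1 < q by rewrite ltnNge; apply/negP => q1; move: (leq_mul q1 (leqnn t.+1)); rewrite -Eq; lia.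
  by move=> q1; move: (leq_mul q1 (leqnn t.+1)); rewrite -Eq; lia.
have dv : t.+1 %| b - (2 * t).+1.
  have -> : b - (2 * t).+1 = b + 1 - 2 * t.+1 by lia.
  by rewrite dvdn_sub ?dvdn_mull // /dvdn E.
rewrite -(subnK le) -(divnK dv); apply: good_pattern_extend => //; last exact: good_pattern_star.
by lia.
Qed.

Lemma modulo_modn m d : 0 < d -> Nat.modulo m d = m %% d.
Proof.
move=> d0; apply/esym/(Nat.mod_unique m d (m %/ d)); first exact/ltP/ltn_pmod.
by rewrite {1}(divn_eq m d) mulnC.
Qed.

End RealExponents.

Theorem theorem1p4 (a b : nat) :
  (1 <= a)%coq_nat -> (a < b)%coq_nat ->
  (Nat.modulo b a = Nat.modulo 1 a \/ Nat.modulo (b + 1) a = 0) ->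
  realisable (2 - INR a / INR b)%R.
Proof.
move=> /leP a0 /ltP ab; rewrite !modulo_modn // => E.
by apply: good_pattern_realisable => //; [apply: ltnW|apply: good_pattern_residue].
Qed.
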